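(* There is an algorithm that decides the ConjRelReach problem (defined in the context) with worst-case running time bounded by $2^{l_{\not\approx}}\cdot p(l\cdot m\cdot|\mathcal{M}|\cdot 2^{l\cdot m})$ for some polynomial $p$, where $l$ is the number of predicates (conjuncts), $l_{\not\approx}$ is the number of predicates whose comparison operator is $\not\approx_\epsilon$ with $\epsilon>0$, $m$ is the number of probability operators per predicate, and $|\mathcal{M}|$ is the size of an explicit encoding of the MDP.
   Context: A Markov decision process (MDP) is a triple $\mathcal{M}=(S,\mathit{Act},\mathbf{P})$ with finite non-empty $S,\mathit{Act}$ and $\mathbf{P}:S\times\mathit{Act}\times S\to[0,1]$ such that each state has a non-empty set $\mathit{Act}(s)$ of enabled actions $\alpha$ with $\sum_{s'}\mathbf{P}(s,\alpha,s')=1$, and $\sum_{s'}\mathbf{P}(s,\alpha,s')=0$ for other actions. A (general) scheduler maps finite paths to distributions over actions enabled in the last state. $\Pr^\sigma_s(\mathbf{F}\,T)$ is the probability under $\sigma$ from $s$ of eventually reaching $T\subseteq S$. $r\approx_\epsilon r'$ iff $|r-r'|\le\epsilon$; $r\not\approx_\epsilon r'$ iff $|r-r'|>\epsilon$. ConjRelReach: given an MDP $\mathcal{M}$, naturals $l,m,n$, rational coefficients $q_{i,j}$ ($1\le i\le m$, $1\le j\le l$), rational bounds $q_1,\dots,q_l$, states $s_{i,j}\in S$, indices $k_{i,j}$ with $\{k_{i,j}\mid i,j\}=\{1,\dots,n\}$, target sets $T_{i,j}\subseteq S$ (none necessarily distinct), and comparison operators $\bowtie_1,\dots,\bowtie_l\in\{>,\ge,\approx_\epsilon,\not\approx_\epsilon\mid\epsilon\in\mathbb{Q}_{\ge0}\}$,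 decide whether there exist general schedulers $\sigma_1,\dots,\sigma_n$ with $\bigwedge_{j=1}^l\sum_{i=1}^m q_{i,j}\Pr^{\sigma_{k_{i,j}}}_{s_{i,j}}(\mathbf{F}\,T_{i,j})\bowtie_j q_j$.
   Formalization: Time is Turing-machine steps; transition probabilities are rational; the size |M| in the bound is replaced by |M| plus the total binary length of the constants q_{i,j}, q_j, ε (which must be read), and the time bound is claimed only for l, m ≥ 1, though all instances are decided. *)

(* Defs.v *)
From HB Require Import structures.
From mathcomp Require Import all_boot all_order all_algebra.
From mathcomp Require Import all_classical all_reals all_analysis.

Set Implicit Arguments.
Unset Strict Implicit.
Unset Printing Implicit Defensive.

Import Order.TTheory GRing.Theory Num.Theory.

Local Open Scope classical_set_scope.
Local Open Scope ring_scope.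

Record mdp := MDP {
  state : finType;
  act : finType;
  trans : state -> act -> state -> rat;
  state_gt0 : (0 < #|state|)%N;
  act_gt0 : (0 < #|act|)%N;
  trans_itv : forall s a s', 0 <= trans s a s' <= 1;
  trans_sum : forall s a,
    \sum_s' trans s a s' = 1 \/ \sum_s' trans s a s' = 0;
  trans_enabled : forall s, exists a, \sum_s' trans s a s' = 1 }.

Definition enabled (M : mdp) (s : state M) (a : act M) : bool :=
  \sum_s' trans s a s' == 1.

(** The finite path [s a_1 s_1 ... a_k s_k] is the state [s] together with the
    history [:: (a_1, s_1); ...; (a_k, s_k)]. *)

Definition history (M : mdp) := seq (act M * state M).

Definition last_state (M : mdp) (s : state M) (h : history M) : state M :=
  last s (unzip2 h).

Fixpoint is_path (M : mdp) (s : state M) (h : history M) : bool :=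
  if h is (a, s') :: h' then (0 < trans s a s') && is_path s' h' else true.

(** Only the values on finite paths are constrained (and matter). *)
Record scheduler (R : realType) (M : mdp) := Scheduler {
  sched_fun :> state M -> history M -> act M -> R;
  sched_ge0 : forall s h, is_path s h -> forall a, 0 <= sched_fun s h a;
  sched_sum1 : forall s h, is_path s h -> \sum_a sched_fun s h a = 1;
  sched_enabled : forall s h, is_path s h ->
    forall a, sched_fun s h a != 0 -> enabled (last_state s h) a }.

(** [w : run M] stands for the infinite sequence
    [(w 0).1 (w 0).2 (w 1).1 (w 1).2 ...] of alternating states and actions;
    sequences with transitions of probability 0 form a null set. *)
Definition run (M : mdp) : Type := nat -> state M * act M.

HB.instance Definition _ (M : mdp) := gen_eqMixin (run M).
HB.instance Definition _ (M : mdp) := gen_choiceMixin (run M).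
HB.instance Definition _ (M : mdp) := isPointed.Build (run M)
  (fun=> (enum_val (Ordinal (state_gt0 M)), enum_val (Ordinal (act_gt0 M)))).

Definition cylinder (M : mdp) (s : state M) (h : history M) : set (run M) :=
  [set w | (w 0%N).1 = s /\
           mkseq (fun i => ((w i).2, (w i.+1).1)) (size h) = h].

Definition cylinders (M : mdp) : set (set (run M)) :=
  [set C | exists s h, C = cylinder s h].

Definition run_space (M : mdp) := g_sigma_algebraType (@cylinders M).

Fixpoint path_prob_from (R : realType) (M : mdp) (sigma : scheduler R M)
    (s : state M) (past h : history M) : R :=
  if h is (a, s') :: h' then
    sigma s past a * ratr (trans (last_state s past) a s')
      * path_prob_from sigma s (rcons past (a, s')) h'
  else 1.

Definition path_prob (R : realType) (M : mdp) (sigma : scheduler R M)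
    (s : state M) (h : history M) : R := path_prob_from sigma s [::] h.

Definition is_path_measure (R : realType) (M : mdp) (sigma : scheduler R M)
    (s : state M) (mu : probability (run_space M) R) : Prop :=
  forall s0 h, mu (cylinder s0 h) =
    (if s0 == s then path_prob sigma s h else 0)%:E.

(** Well defined by [path_measureP] and [path_measure_unique] below. *)
Definition path_measure (R : realType) (M : mdp) (sigma : scheduler R M)
    (s : state M) : probability (run_space M) R :=
  get [set mu | is_path_measure sigma s mu].

Definition eventually (M : mdp) (T : {set state M}) : set (run M) :=
  [set w | exists i, (w i).1 \in T].

Definition reach_prob (R : realType) (M : mdp) (sigma : scheduler R M)
    (s : state M) (T : {set state M}) : R :=
  fine (path_measure sigma s (eventually T)).

Inductive cmp_op :=
  | CmpGt
  | CmpGe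
  | CmpApprox of rat
  | CmpNApprox of rat.

Definition cmp_eps (op : cmp_op) : rat :=
  match op with CmpApprox e | CmpNApprox e => e | _ => 0 end.

Definition cmp_holds (R : realType) (op : cmp_op) (x y : R) : Prop :=
  match op with
  | CmpGt => x > y
  | CmpGe => x >= y
  | CmpApprox e => `|x - y| <= ratr e
  | CmpNApprox e => `|x - y| > ratr e
  end.

(** Indices are 0-based: [i : 'I_m], [j : 'I_l], and scheduler indices are in
    ['I_n]. *)
Record conj_rel_reach := ConjRelReach {
  crr_mdp : mdp;
  crr_l : nat;
  crr_m : nat;
  crr_n : nat;
  crr_coef : 'I_crr_m -> 'I_crr_l -> rat;
  crr_bound : 'I_crr_l -> rat;
  crr_state : 'I_crr_m -> 'I_crr_l -> state crr_mdp;
  crr_sched : 'I_crr_m -> 'I_crr_l -> 'I_crr_n;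
  crr_sched_surj : forall k, exists i j, crr_sched i j = k;
  crr_target : 'I_crr_m -> 'I_crr_l -> {set state crr_mdp};
  crr_cmp : 'I_crr_l -> cmp_op;
  crr_eps_ge0 : forall j, 0 <= cmp_eps (crr_cmp j) }.

Definition crr_holds (R : realType) (I : conj_rel_reach) : Prop :=
  exists sigma : 'I_(crr_n I) -> scheduler R (crr_mdp I),
  forall j : 'I_(crr_l I),
    cmp_holds (crr_cmp j)
      (\sum_(i < crr_m I) ratr (crr_coef i j) *
         reach_prob (sigma (crr_sched i j)) (crr_state i j) (crr_target i j))
      (ratr (crr_bound j)).

Definition crr_lneq (I : conj_rel_reach) : nat :=
  #|[pred j : 'I_(crr_l I) | if crr_cmp j is CmpNApprox e then 0 < e else false]|.

(** Words consist of binary digits [Some b] and the separator [None]. *)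
Definition letter : finType := option bool.
Definition word := seq letter.

(** Least significant digit first, without leading zeros. *)
Definition bits (n : nat) : seq bool :=
  mkseq (fun i => odd (n %/ 2 ^ i)) (up_log 2 n.+1).

Definition enc_nat (n : nat) : word := rcons (map Some (bits n)) None.

Definition enc_rat (q : rat) : word :=
  enc_nat (numq q < 0)%R ++ enc_nat `|numq q|%N ++ enc_nat `|denq q|%N.

Definition enc_fin (T : finType) (x : T) : word := enc_nat (enum_rank x).

Definition enc_set (T : finType) (A : {set T}) : word :=
  flatten [seq enc_nat (x \in A) | x <- enum T].

Definition enc_cmp (op : cmp_op) : word :=
  match op with
  | CmpGt => enc_nat 0
  | CmpGe => enc_nat 1
  | CmpApprox e => enc_nat 2 ++ enc_rat e
  | CmpNApprox e => enc_nat 3 ++ enc_rat e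
  end.

Definition enc_mdp (M : mdp) : word :=
  enc_nat #|state M| ++ enc_nat #|act M| ++
  flatten [seq enc_rat (trans sa.1 sa.2 s')
          | sa <- enum {: state M * act M}, s' <- enum (state M)].

Definition enc_crr (I : conj_rel_reach) : word :=
  enc_nat (crr_l I) ++ enc_nat (crr_m I) ++ enc_nat (crr_n I) ++
  enc_mdp (crr_mdp I) ++
  flatten [seq enc_cmp (crr_cmp j) ++ enc_rat (crr_bound j) ++
     flatten [seq enc_rat (crr_coef i j) ++ enc_fin (crr_state i j) ++
                enc_fin (crr_sched i j) ++ enc_set (crr_target i j)
             | i <- enum 'I_(crr_m I)]
    | j <- enum 'I_(crr_l I)].

Definition mdp_size (M : mdp) : nat := size (enc_mdp M).

(** The rational constants of the predicates are part of the input, so any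
    bound on the number of Turing machine steps has to account for their binary
    length in addition to [mdp_size]. *)
Definition const_size (I : conj_rel_reach) : nat :=
  (\sum_(j < crr_l I)
    (size (enc_rat (crr_bound j)) + size (enc_rat (cmp_eps (crr_cmp j))) +
     \sum_(i < crr_m I) size (enc_rat (crr_coef i j))))%N.

Inductive move := MoveLeft | MoveStay | MoveRight.

(** The tape alphabet consists of the input letters, the extra symbols
    [tm_extra], and the blank [None]; [tm_halt q = Some b] means that [q] is a
    halting state with verdict [b]. *)
Record turing_machine := TuringMachine {
  tm_work : nat;
  tm_state : finType;
  tm_extra : finType;
  tm_start : tm_state;
  tm_halt : tm_state -> option bool;
  tm_trans : tm_state -> {ffun 'I_tm_work.+1 -> option (letter + tm_extra)} ->
    tm_state * ('I_tm_work.+1 -> option (letter + tm_extra) * move) }.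

Definition tm_symbol (A : turing_machine) : Type :=
  option (letter + tm_extra A).

(** [(l, r)] is the two-way infinite tape with the reversal of [l] to the left
    of the head, [r] from the head onwards, and blanks elsewhere. *)
Definition tape (A : turing_machine) : Type :=
  (seq (tm_symbol A) * seq (tm_symbol A))%type.

Definition tape_read (A : turing_machine) (t : tape A) : tm_symbol A :=
  head None t.2.

Definition tape_write (A : turing_machine) (x : tm_symbol A) (t : tape A) :
  tape A := (t.1, x :: behead t.2).

Definition tape_move (A : turing_machine) (d : move) (t : tape A) : tape A :=
  match d with
  | MoveLeft => (behead t.1, head None t.1 :: t.2)
  | MoveStay => t
  | MoveRight => (head None t.2 :: t.1, behead t.2)
  end.

Definition config (A : turing_machine) : Type :=
  (tm_state A * ('I_(tm_work A).+1 -> tape A))%type.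

(** The input is written on tape 0, under and to the right of the head. *)
Definition tm_init (A : turing_machine) (w : word) : config A :=
  (tm_start A,
   fun i => if i == ord0 then ([::], [seq Some (inl x) | x <- w])
            else ([::], [::])).

Definition tm_step (A : turing_machine) (c : config A) : config A :=
  if tm_halt c.1 is Some _ then c
  else let: (q, f) := tm_trans c.1 [ffun i => tape_read (c.2 i)] in
       (q, fun i => tape_move (f i).2 (tape_write (f i).1 (c.2 i))).

Definition tm_verdict (A : turing_machine) (w : word) (t : nat) : option bool :=
  tm_halt (iter t (@tm_step A) (tm_init A w)).1.

(** On input [w], [A] halts after at most [t] steps and accepts iff [P]. *)
Definition decides_within (A : turing_machine) (w : word) (P : Prop) (t : nat) :
  Prop := exists2 b : bool, tm_verdict A w t = Some b & (b <-> P).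

Definition run_of_seq (M : mdp) (w : seq (state M * act M)) : run M :=
  nth ((point : run M) 0%N) w.

Definition prefix_cylinder (M : mdp) (v : seq (state M * act M)) :
  set (run M) := [set w | mkseq w (size v) = v].

Lemma eq_mkseqP (M : mdp) (w w' : run M) n :
  mkseq w n = mkseq w' n <-> forall i, (i < n)%N -> w i = w' i.
Proof.
split=> [e i lti|e]; last first.
  by apply/eq_in_map => i; rewrite mem_iota => /andP[_ lti]; exact: e.
by rewrite -(nth_mkseq (w i) w lti) e nth_mkseq.
Qed.

Section run_measure.
Variables (R : realType) (M : mdp).
Let X : finType := (state M * act M)%type.
Local Notation ext := (@run_of_seq M).
Local Notation prefix_cylinder := (@prefix_cylinder M).
Variable f : seq X -> R.
Hypothesis f1 : f [::] = 1.
Hypothesis f_ge0 : forall w, 0 <= f w.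
Hypothesis f_split : forall w, f w = \sum_x f (rcons w x).

Definition depth_at (n : nat) (A : set (run M)) :=
  forall w w' : run M, mkseq w n = mkseq w' n -> A w -> A w'.

Definition fin_depth : set (set (run M)) := [set A | exists n, depth_at n A].

Lemma depth_atW m n A : (m <= n)%N -> depth_at m A -> depth_at n A.
Proof.
move=> le_mn dA w w' /eq_mkseqP e; apply: dA; apply/eq_mkseqP => i lti.
exact: e (leq_trans lti le_mn).
Qed.

Let fin_depth0 : fin_depth set0. Proof. by exists 0%N. Qed.

Let fin_depthU : setU_closed fin_depth.
Proof.
move=> A B [m dA] [n dB]; exists (maxn m n) => w w' e [Aw|Bw].
  by left; apply: (depth_atW (leq_maxl m n) dA) e Aw.
by right; apply: (depth_atW (leq_maxr m n) dB) e Bw.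
Qed.

Let fin_depthC : setC_closed fin_depth.
Proof. by move=> A [m dA]; exists m => w w' e Aw Aw'; apply: Aw; exact: dA Aw'. Qed.

Definition run_algebra : Type := run M.
HB.instance Definition _ := Pointed.on run_algebra.
HB.instance Definition _ := @isAlgebraOfSets.Build default_measure_display
  run_algebra fin_depth fin_depth0 fin_depthU fin_depthC.

Fixpoint weight_from (n : nat) (w : seq X) (A : set (run M)) : R :=
  if n is n'.+1 then \sum_x weight_from n' (rcons w x) A
  else if `[< A (ext w) >] then f w else 0.

Let ext_mkseq w : mkseq (ext w) (size w) = w.
Proof. exact: mkseq_nth. Qed.

Let mkseq_ext_rcons w x : mkseq (ext (rcons w x)) (size w) = w.
Proof.
rewrite -[RHS]ext_mkseq; apply/eq_mkseqP => i lti.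
by rewrite /run_of_seq nth_rcons lti.
Qed.

Lemma weight_from_ge0 n w A : 0 <= weight_from n w A.
Proof.
elim: n w => [|n IHn] w /=; first by case: ifP.
by apply: sumr_ge0 => x _.
Qed.

Lemma weight_from0 n w : weight_from n w set0 = 0.
Proof.
elim: n w => [|n IHn] w /=; last by rewrite big1.
by case: ifP => // /asboolP.
Qed.

Lemma weight_fromU n w A B : [disjoint A & B] ->
  weight_from n w (A `|` B) = weight_from n w A + weight_from n w B.
Proof.
move=> /disj_setPS dAB.
elim: n w => [|n IHn] w /=; last by rewrite -big_split; apply: eq_bigr.
case: (pselect (A (ext w))) => [Aw|nAw]; case: (pselect (B (ext w))) => [Bw|nBw].
- by have := dAB _ (conj Aw Bw).
- rewrite (asboolT (or_introl _ Aw)) (asboolT Aw) (asboolF nBw) addr0 //.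
- rewrite (asboolT (or_intror _ Bw)) (asboolT Bw) (asboolF nAw) add0r //.
- by rewrite !asboolF ?addr0// => -[].
Qed.

Lemma weight_fromS n w A : depth_at (size w + n) A ->
  weight_from n.+1 w A = weight_from n w A.
Proof.
elim: n w => [|n IHn] w dA; last first.
  apply: eq_bigr => x _; apply: IHn.
  by rewrite size_rcons addSnnS.
rewrite addn0 in dA; rewrite /=.
have eqA x : `[< A (ext (rcons w x)) >] = `[< A (ext w) >].
  by apply: asbool_equiv_eq; split; apply: dA; rewrite mkseq_ext_rcons ext_mkseq.
under eq_bigr do rewrite eqA.
by case: ifP => _; [rewrite [RHS]f_split|rewrite big1].
Qed.

Lemma weight_from_depth m n A : (m <= n)%N -> depth_at m A ->
  weight_from n [::] A = weight_from m [::] A.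
Proof.
move=> /subnKC <-; elim: (n - m)%N => [|k IHk] dA; first by rewrite addn0.
by rewrite addnS weight_fromS ?IHk//; apply: depth_atW dA; rewrite leq_addr.
Qed.

Definition run_content (A : set run_algebra) : \bar R :=
  match pselect (fin_depth A) with
  | left dA => (weight_from (projT1 (cid dA)) [::] A)%:E
  | right _ => 0%E
  end.

Lemma run_contentE n A : depth_at n A ->
  run_content A = (weight_from n [::] A)%:E.
Proof.
move=> dA; rewrite /run_content; case: pselect => [e|[]]; last by exists n.
case: (cid e) => m /= dmA; congr _%:E; have [lemn|/ltnW ltnm] := leqP m n.
  by rewrite (weight_from_depth lemn).
by rewrite (weight_from_depth ltnm).
Qed.

Let run_content0 : run_content set0 = 0%E.
Proof. by rewrite (@run_contentE 0%N)// weight_from0. Qed.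

Let run_content_ge0 A : (0 <= run_content A)%E.
Proof.
rewrite /run_content; case: pselect => [e|//]; by rewrite lee_fin weight_from_ge0.
Qed.

Let run_contentU A B : fin_depth A -> fin_depth B -> [disjoint A & B] ->
  run_content (A `|` B) = (run_content A + run_content B)%E.
Proof.
move=> [m dA] [n dB] dAB.
have dA' := depth_atW (leq_maxl m n) dA; have dB' := depth_atW (leq_maxr m n) dB.
rewrite (run_contentE dA') (run_contentE dB') (@run_contentE (maxn m n)).
  by rewrite weight_fromU.
by move=> w w' e [/dA'|/dB'] => /(_ _ e); [left|right].
Qed.

Let run_compact (F : (set run_algebra)^nat) U : (forall i, fin_depth (F i)) ->
  fin_depth U -> U `<=` \bigcup_i F i ->
  exists N, forall w, U w -> exists2 i, (i < N)%N & F i w.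
Proof.
move=> dF [n dU] UF; apply: contrapT => /forallNP noN.
pose alive (v : seq X) := forall N, exists w : run M,
  [/\ mkseq w (size v) = v, U w & forall i, (i < N)%N -> ~ F i w].
have alive0 : alive [::].
  move=> N; have /existsNP[w /not_implyP[Uw nF]] := noN N.
  by exists w; split => // i ltiN Fi; apply: nF; exists i.
have aliveS v : alive v -> exists x, alive (rcons v x).
  move=> av; apply: contrapT => /forallNP nx.
  have {}nx x : exists N, forall w : run M,
      ~ [/\ mkseq w (size v).+1 = rcons v x, U w &
            forall i, (i < N)%N -> ~ F i w].
    have /existsNP[N /forallNP nN] := nx x; exists N => w.
    by have := nN w; rewrite size_rcons.
  have [N /= hN] := choice nx.
  have [w [vw Uw nFw]] := av (\max_x N x)%N.
  apply: (hN (w (size v)) w); split => //.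
    by rewrite mkseqS vw.
  by move=> i lti; apply: nFw; apply: leq_trans lti (leq_bigmax _).
have aliveE v : exists x, alive v -> alive (rcons v x).
  have [/aliveS[x ax]|nv] := pselect (alive v); first by exists x.
  by exists ((point : run M) 0%N).
have [g gP] := choice aliveE.
pose pre := fix pre k := if k is k'.+1 then rcons (pre k') (g (pre k')) else [::].
have preA k : alive (pre k) by elim: k => //= k; exact: gP.
pose w : run M := fun k => g (pre k).
have wE k : mkseq w k = pre k by elim: k => //= k IHk; rewrite mkseqS IHk.
have ag k N : exists w' : run M,
    [/\ mkseq w' k = mkseq w k, U w' & forall i, (i < N)%N -> ~ F i w'].
  have [w' [e Uw' nF]] := preA k N; exists w'; split => //.
  by move: e; rewrite -wE size_mkseq.
have Uw : U w by have [w' [e Uw' _]] := ag n 0%N; exact: dU e Uw'.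
have [i _ Fiw] := UF _ Uw; have [k dFi] := dF i.
have [w' [e _ /(_ i (ltnSn _))]] := ag k i.+1; apply.
exact: dFi (esym e) Fiw.
Qed.

Let run_content_sigma_additive : semi_sigma_additive run_content.
Proof.
move=> F mF tF mU.
have [N hN] := run_compact mF mU (@subset_refl _ _).
have addF n : fin_depth (\big[setU/set0]_(i < n) F i) /\
    run_content (\big[setU/set0]_(i < n) F i) = (\sum_(i < n) run_content (F i))%E.
  elim: n => [|n [dn IHn]]; first by rewrite !big_ord0 run_content0; split.
  rewrite !big_ord_recr /=; split; first exact: (fin_depthU dn (mF n)).
  rewrite (run_contentU dn (mF n)) ?IHn//; apply/disj_setPS => w [+ Fnw].
  rewrite -bigcup_mkord => -[i /= ltin Fiw].
  have /trivIsetP/(_ i n I I) := tF.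
  by rewrite (ltn_eqF ltin) => /(_ isT) e; have : (F i `&` F n) w by []; rewrite e.
apply: (cvg_near_cst); near=> n.
rewrite big_mkord -(addF n).2; congr run_content.
apply/seteqP; split => [w|w Uw]; rewrite -bigcup_mkord.
  by move=> [i _ Fiw]; exists i.
have [i ltiN Fiw] := hN _ Uw; exists i => //=; apply: leq_trans ltiN _.
by near: n; exact: nbhs_infty_ge.
Unshelve. all: by end_near. Qed.

HB.instance Definition _ := isMeasure.Build _ run_algebra R run_content
  run_content0 run_content_ge0 run_content_sigma_additive.

Let weight_from_out n w A : (forall v, size v = n -> ~ A (ext (w ++ v))) ->
  weight_from n w A = 0.
Proof.
elim: n w => [|n IHn] w nA /=.
  by rewrite asboolF//; have := nA [::] erefl; rewrite cats0.
rewrite big1// => x _; apply: IHn => v sv; rewrite cat_rcons; apply: nA.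
by rewrite /= sv.
Qed.

Let weight_from_prefix w v :
  weight_from (size v) w (prefix_cylinder (w ++ v)) = f (w ++ v).
Proof.
elim: v w => [|x v IHv] w /=.
  by rewrite cats0 asboolT// /prefix_cylinder/= ext_mkseq.
rewrite (bigD1 x)//= -cat_rcons IHv big1 ?addr0// => y /eqP nyx.
apply: weight_from_out => v' sv'; rewrite /prefix_cylinder/= !cat_rcons.
have -> : size (w ++ x :: v) = size (w ++ y :: v').
  by rewrite !size_cat/= sv'.
rewrite ext_mkseq => /eqP; rewrite eqseq_cat// eqxx/= eqseq_cons.
by move=> /andP[/eqP].
Qed.

Lemma run_content_prefix v : run_content (prefix_cylinder v) = (f v)%:E.
Proof.
rewrite (@run_contentE (size v)) ?(weight_from_prefix [::])//.
by move=> w w' e; rewrite /prefix_cylinder/= e.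
Qed.

Let sub_cylinders (A : set (run M)) :
  (@cylinders M).-sigma.-measurable A -> <<s fin_depth >> A.
Proof.
move: A; apply: smallest_sub; first exact: smallest_sigma_algebra.
move=> _ [s [h ->]]; apply: sub_sigma_algebra; exists (size h).+1.
move=> w w' /eq_mkseqP e [<- eh]; split; first by rewrite e.
rewrite -eh size_mkseq; apply/eq_in_map => i; rewrite mem_iota => /andP[_ lti].
by rewrite !e// ltnW.
Qed.

Definition run_measure (A : set (run_space M)) : \bar R :=
  measure_extension (run_content : {measure set run_algebra -> \bar R}) A.

Let run_measure0 : run_measure set0 = 0%E.
Proof. exact: measure0. Qed.

Let run_measure_ge0 A : (0 <= run_measure A)%E.
Proof. exact: measure_ge0. Qed.

Let run_measure_sigma_additive : semi_sigma_additive run_measure.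
Proof.
move=> F mF tF mU; apply: measure_semi_sigma_additive => //.
  by move=> i; apply: sub_cylinders; exact: mF.
exact: sub_cylinders.
Qed.

HB.instance Definition _ := isMeasure.Build _ (run_space M) R run_measure
  run_measure0 run_measure_ge0 run_measure_sigma_additive.

Lemma run_measure_prefix v : run_measure (prefix_cylinder v) = (f v)%:E.
Proof.
rewrite /run_measure/= /measure_extension measurable_mu_extE/=.
  exact: run_content_prefix.
by exists (size v) => w w' e; rewrite /prefix_cylinder/= e.
Qed.

Let run_measure_setT : run_measure setT = 1%E.
Proof.
rewrite -f1 -run_measure_prefix; congr run_measure.
by apply/seteqP; split.
Qed.

HB.instance Definition _ := Measure_isProbability.Build _ _ R run_measure
  run_measure_setT.

Lemma run_measure_exists : exists mu : probability (run_space M) R,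
  forall v, mu (prefix_cylinder v) = (f v)%:E.
Proof. by exists run_measure; exact: run_measure_prefix. Qed.

End run_measure.

Section path_measure_exists.
Variables (R : realType) (M : mdp) (sigma : scheduler R M) (s : state M).
Local Notation ext := (@run_of_seq M).
Local Notation pprob := (path_prob sigma s).

Let path_prob_from_rcons past h a s' :
  path_prob_from sigma s past (rcons h (a, s')) =
  path_prob_from sigma s past h *
    (sigma s (past ++ h) a * ratr (trans (last_state s (past ++ h)) a s')).
Proof.
elim: h past => [|[a1 s1] h IHh] past /=; first by rewrite cats0 mulr1 mul1r.
by rewrite IHh cat_rcons !mulrA.
Qed.

Let path_prob_rcons h a s' : pprob (rcons h (a, s')) =
  pprob h * (sigma s h a * ratr (trans (last_state s h) a s')).
Proof. exact: path_prob_from_rcons. Qed.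

Let is_path_rcons (t : state M) h a s' :
  is_path t (rcons h (a, s')) = is_path t h && (0 < trans (last_state t h) a s').
Proof. by elim: h t => [|[a1 s1] h IHh] t /=; rewrite ?andbT// IHh andbA. Qed.

Let trans_ge0 (t : state M) a t' : 0 <= trans t a t'.
Proof. by have /andP[] := trans_itv t a t'. Qed.

Let path_prob_out h : ~~ is_path s h -> pprob h = 0.
Proof.
elim/last_ind: h => // h [a s'] IHh; rewrite is_path_rcons path_prob_rcons.
have [_|/IHh ->] := boolP (is_path s h); last by rewrite mul0r.
rewrite lt_neqAle trans_ge0 andbT negbK => /eqP <-.
by rewrite raddf0 !mulr0.
Qed.

Let path_prob_ge0 h : 0 <= pprob h.
Proof.
elim/last_ind: h => [|h [a s'] IHh]; first exact: ler01.
rewrite path_prob_rcons.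
have [hP|/path_prob_out ->] := boolP (is_path s h); last by rewrite mul0r.
apply: mulr_ge0 => //; apply: mulr_ge0; last by rewrite ler0q.
exact: (sched_ge0 sigma hP).
Qed.

Let hist (w : run M) n : history M :=
  mkseq (fun i => ((w i).2, (w i.+1).1)) n.

Let eq_hist w w' n : (forall i, (i <= n)%N -> w i = w' i) -> hist w n = hist w' n.
Proof.
move=> e; apply/eq_in_map => i; rewrite mem_iota => /andP[_ lti].
by rewrite !e// ltnW.
Qed.

Let last_hist w n : (w 0%N).1 = s -> last_state s (hist w n) = (w n).1.
Proof.
by case: n => [|n] e; rewrite /hist /last_state ?mkseqS// /unzip2 map_rcons last_rcons.
Qed.

Let wt (w : run M) n : R :=
  if (w 0%N).1 == s then pprob (hist w n) * sigma s (hist w n) (w n).2 else 0.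

Let f (v : seq (state M * act M)) : R :=
  if size v is n.+1 then wt (ext v) n else 1.

Let wt_ge0 w n : 0 <= wt w n.
Proof.
rewrite /wt; case: ifP => // _.
have [hP|/path_prob_out ->] := boolP (is_path s (hist w n)); last by rewrite mul0r.
by apply: mulr_ge0 => //; exact: (sched_ge0 sigma hP).
Qed.

Let f_ge0 v : 0 <= f v.
Proof. by rewrite /f; case: (size v). Qed.

Let eq_wt w w' n : (forall i, (i <= n)%N -> w i = w' i) -> wt w n = wt w' n.
Proof. by move=> e; rewrite /wt (eq_hist e) !e. Qed.

Let path_sched h : pprob h * (\sum_a sigma s h a) = pprob h.
Proof.
have [hP|/path_prob_out ->] := boolP (is_path s h); last by rewrite mul0r.
by rewrite (sched_sum1 sigma hP) mulr1.
Qed.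

Let f_split v : f v = \sum_x f (rcons v x).
Proof.
have extR x i : (i < size v)%N -> ext (rcons v x) i = ext v i.
  by move=> lti; rewrite /run_of_seq nth_rcons lti.
have extL x : ext (rcons v x) (size v) = x.
  by rewrite /run_of_seq nth_rcons ltnn eqxx.
rewrite /f; under eq_bigr do rewrite size_rcons.
case sv: (size v) => [|n]; rewrite sv in extR extL.
  rewrite (eq_bigr (fun x => (if x.1 == s then 1 else 0) * sigma s [::] x.2)).
    rewrite -(pair_bigA _ (fun t a => (if t == s then 1 else 0) * sigma s [::] a))/=.
    rewrite (bigD1 s)//= [X in _ + X]big1 ?addr0.
      rewrite eqxx -mulr_sumr mul1r; exact/esym/(@sched_sum1 _ _ sigma s [::]).
    by move=> t /negbTE ->; rewrite big1// => a _; rewrite mul0r.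
  move=> x _; rewrite /wt extL; case: eqP => _; last by rewrite mul0r.
  by rewrite /hist/= /path_prob/=.
have wtE x : wt (ext (rcons v x)) n.+1 =
    if (ext v 0%N).1 == s then
      pprob (rcons (hist (ext v) n) ((ext v n).2, x.1)) *
      sigma s (rcons (hist (ext v) n) ((ext v n).2, x.1)) x.2 else 0.
  rewrite /wt extR// {1 2}/hist mkseqS -/(hist _ _) extL extR//.
  by rewrite (@eq_hist _ (ext v))// => i lei; exact: extR.
rewrite (eq_bigr _ (fun x _ => wtE x)) /wt; case: eqP => [e0|_]; last first.
  by rewrite big1.
set h := hist _ _; set a := (ext v n).2.
rewrite -(pair_bigA _ (fun t b => pprob (rcons h (a, t)) *
                         sigma s (rcons h (a, t)) b))/=.
under eq_bigr do rewrite -mulr_sumr path_sched path_prob_rcons mulrA.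
rewrite -mulr_sumr -raddf_sum/=.
have [hP|/path_prob_out ->] := boolP (is_path s h); last by rewrite !mul0r.
have [-> |/(sched_enabled hP)/eqP ->] := eqVneq (sigma s h a) 0.
  by rewrite mulr0 mul0r.
by rewrite rmorph1 mulr1.
Qed.

Lemma path_measure_exists :
  exists mu : probability (run_space M) R, is_path_measure sigma s mu.
Proof.
have [mu muE] := @run_measure_exists R M f erefl f_ge0 f_split.
exists mu => s0 h.
pose n := size h.
pose wa a : run M :=
  fun i => (nth s0 (s0 :: unzip2 h) i, nth a (unzip1 h) i).
have cylP (w : run M) : cylinder s0 h w <-> (w 0%N).1 = s0 /\ hist w n = h by [].
have wa_cyl a : cylinder s0 h (wa a).
  apply/cylP; split => //; rewrite -[RHS](mkseq_nth (a, s0)).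
  apply/eq_in_map => i; rewrite mem_iota => /andP[_ lti].
  rewrite /wa/= (nth_map (a, s0))// (nth_map (a, s0))//.
  by case: (nth _ _ _).
have wa_n a : (wa a n).2 = a by rewrite /wa/= nth_default// size_map.
have waP a (w : run M) : cylinder s0 h w -> (w n).2 = a ->
    forall i, (i <= n)%N -> w i = wa a i.
  move=> [w0 wh] wn.
  have [wa0 wah] := wa_cyl a.
  have nthw i : (i < n)%N -> ((w i).2, (w i.+1).1) = ((wa a i).2, (wa a i.+1).1).
    move=> lti; have := congr1 (fun t => nth (a, s0) t i) (etrans wh (esym wah)).
    by rewrite !nth_mkseq.
  move=> i lein.
  have w1 : (w i).1 = (wa a i).1.
    by case: i lein => [_|i /nthw[_ ->]//]; rewrite w0 wa0.
  have w2 : (w i).2 = (wa a i).2.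
    move: lein; rewrite leq_eqVlt => /predU1P[->|/nthw[-> _]//].
    by rewrite wn wa_n.
  by rewrite [LHS]surjective_pairing w1 w2 -surjective_pairing.
pose V a := mkseq (wa a) n.+1.
have VP a w : prefix_cylinder (V a) w <-> cylinder s0 h w /\ (w n).2 = a.
  have -> : prefix_cylinder (V a) w = (mkseq w n.+1 = V a).
    by rewrite /prefix_cylinder /mkset size_mkseq.
  rewrite eq_mkseqP; split => [e|[cw wn] i lti].
    split; last by rewrite e// wa_n.
    have [wa0 wah] := wa_cyl a; apply/cylP; split; first by rewrite e.
    by rewrite -[RHS]wah; apply: eq_hist => i lein; rewrite e.
  exact: waP.
have mV a : measurable (prefix_cylinder (V a) : set (run_space M)).
  have -> : prefix_cylinder (V a) =
      \bigcup_(t in [set` index_enum (state M)]) cylinder s0 (rcons h (a, t)).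
    apply/seteqP; split => w.
      move=> /VP[[w0 wh] wn]; exists (w n.+1).1; first exact: mem_index_enum.
      by split => //; rewrite size_rcons mkseqS wh wn.
    move=> [t _ [w0]]; rewrite size_rcons mkseqS => /rcons_inj[wh wn _].
    exact/VP.
  apply: fin_bigcup_measurable => // t _; apply: sub_sigma_algebra.
  by exists s0, (rcons h (a, t)).
have -> : cylinder s0 h =
    \bigcup_(a in [set` index_enum (act M)]) prefix_cylinder (V a).
  apply/seteqP; split => w; last by move=> [a _ /VP[]].
  by move=> cw; exists (w n).2; [exact: mem_index_enum|exact/VP].
rewrite measure_fin_bigcup//; last first.
  by move=> a b _ _ [w [/VP[_ <-] /VP[]]].
rewrite -fsbig_seq ?index_enum_uniq//.
rewrite (eq_bigr (fun a => (if s0 == s then pprob h * sigma s h a else 0)%:E)).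
  rewrite sumEFin; case: eqP => _; last by rewrite big1.
  by rewrite -mulr_sumr path_sched.
move=> a _; apply: (etrans (muE (V a))); rewrite /f size_mkseq; congr _%:E.
rewrite (@eq_wt _ (wa a)); last by move=> i lein; rewrite /run_of_seq nth_mkseq.
have [wa0 wah] := wa_cyl a.
by rewrite /wt wa0 wa_n -/n /hist wah.
Qed.

End path_measure_exists.

Lemma path_measureP (R : realType) (M : mdp) (sigma : scheduler R M)
  (s : state M) : is_path_measure sigma s (path_measure sigma s).
Proof. by have [mu muP] := path_measure_exists sigma s; exact: (getI muP). Qed.

Lemma path_measure_unique (R : realType) (M : mdp) (sigma : scheduler R M)
    (s : state M) (mu nu : probability (run_space M) R) :
  is_path_measure sigma s mu -> is_path_measure sigma s nu ->
  forall A, measurable A -> mu A = nu A.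
Proof.
move=> muP nuP A mA.
pose G : set (set (run_space M)) := set0 |` @cylinders M.
have sG : (measurable : set (set (run_space M))) = <<s G >>.
  apply/seteqP; split; apply: smallest_sub; first exact: smallest_sigma_algebra.
  - by move=> C cC; apply: sub_sigma_algebra; right.
  - exact: smallest_sigma_algebra.
  - move=> C [->|cC]; last exact: sub_sigma_algebra.
    exact: (@measurable0 _ (run_space M)).
have cyl_sub (t : state M) (h h' : history M) w : (size h <= size h')%N ->
    cylinder t h w -> cylinder t h' w -> cylinder t h' `<=` cylinder t h.
  move=> le [w0 wh] [_ wh'] v [v0 vh']; split => //; rewrite -[RHS]wh.
  apply/eq_in_map => i; rewrite mem_iota => /andP[_ lti].
  have lti' := leq_trans lti le.
  have := congr1 (fun x => nth ((w i).2, t) x i) (etrans vh' (esym wh')).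
  by rewrite !nth_mkseq.
have GI : setI_closed G.
  move=> B C [->|[t [h ->]]] => [_|]; first by left; rewrite set0I.
  move=> [->|[t' [h' ->]]]; first by left; rewrite setI0.
  have [->|/set0P[w [cw cw']]] := eqVneq (cylinder t h `&` cylinder t' h') set0.
    by left.
  have e : t = t' by case: cw => <- _; case: cw' => <- _.
  rewrite -{}e in cw' *; right.
  have [le|/ltnW le] := leqP (size h) (size h').
    by exists t, h'; apply/setIidPr; exact: cyl_sub le cw cw'.
  by exists t, h; apply/setIidPl; exact: cyl_sub le cw' cw.
pose g (n : nat) : set (run_space M) :=
  if insub n is Some i then cylinder (enum_val (i : 'I_#|state M|)) [::] else set0.
apply: (measure_unique G g) => //.
- move=> n; rewrite /g; case: insub => [i|]; last by left.
  by right; exists (enum_val i), [::].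
- apply/seteqP; split => // w _; exists (enum_rank (w 0%N).1) => //.
  by rewrite /g valK enum_rankK.
- move=> B [->|[t [h ->]]]; first by rewrite !measure0.
  exact: (etrans (muP t h) (esym (nuP t h))).
- move=> n; apply: (le_lt_trans (probability_le1 mu _)); last exact: ltry.
  rewrite sG; apply: sub_sigma_algebra; rewrite /g.
  by case: insub => [i|]; [right; exists (enum_val i), [::]|left].
Qed.

Lemma measurable_eventually (M : mdp) (T : {set state M}) :
  measurable (eventually T : set (run_space M)).
Proof.
pose F k : set (run_space M) :=
  if @unpickle (state M * history M)%type k is Some sh then
    if last_state sh.1 sh.2 \in T then cylinder sh.1 sh.2 else set0
  else set0.
have lastE (w : run M) n : last_state (w 0%N).1
    (mkseq (fun i => ((w i).2, (w i.+1).1)) n) = (w n).1.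
  case: n => [|n] //; rewrite /last_state mkseqS /unzip2 map_rcons.
  by rewrite last_rcons.
have -> : eventually T = \bigcup_k F k.
  apply/seteqP; split => [w [n wn]|w [k _]].
    pose h : history M := mkseq (fun i => ((w i).2, (w i.+1).1)) n.
    exists (pickle ((w 0%N).1, h)) => //.
    by rewrite /F pickleK /= lastE wn; split; rewrite // size_mkseq.
  rewrite /F; case: unpickle => // -[s h] /=.
  case: ifP => // hT [w0 wh]; exists (size h).
  by rewrite -lastE w0 wh.
apply: bigcupT_measurable => k; rewrite /F; case: unpickle => [[s h]|] //=.
by case: ifP => // _; apply: sub_sigma_algebra; exists s, h.
Qed.

(* Main.v *)
(** The polynomial [p] absorbs the factor [2 ^ l], so it suffices to decide the
    problem in time polynomial in the input, [2 ^ l] and [2 ^ (l * m)].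

    Unfolding the MDP with the set of targets visited so far, the reachability
    probabilities of one scheduler from one initial state are exactly the values
    [\sum_(u : g \in u.2) y u] over the solutions of a linear system: a flow [x]
    from the initial state that leaves at rate [y], and a circulation [c] that is
    positive wherever [y] is.  A scheduler yields a solution by Farkas' lemma and
    potentials; conversely, a solution is played by following [x], stopping with
    the conditional probability given by [y], and then following [c], which never
    visits a new target.  Choosing a sign for each [CmpNApprox] predicate, the
    whole question becomes the existence of a nonnegative vector in the kernel of
    an integer matrix with some entries positive.  This is decided by Chubanov's
    rescaled perceptron with exact integer projections.

    The running time is tracked in a small language of programs on stacks, stored
    on the tapes of a Turing machine and holding binary trees; [PT mu f] says that
    [f] is computed there in time polynomial in [mu], and is shown to be closed
    under the usual list and integer operations. *)

Require Import Defs.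
From HB Require Import structures.
From mathcomp Require Import all_boot all_order all_algebra.
From mathcomp Require Import all_classical all_reals all_analysis.
From mathcomp Require Import zify ring lra.
Set Implicit Arguments.
Unset Strict Implicit.
Unset Printing Implicit Defensive.

Import Order.TTheory GRing.Theory Num.Theory.

Local Open Scope ring_scope.

(** * Stack programs on a Turing machine *)

Local Open Scope nat_scope.

(** Strict comparisons are why the final problem is a kernel vector with some entries positive: a
    positive slack expresses [CmpGt] and [CmpNApprox], and a positive homogenizing variable may be
    divided out. The support condition on the circulation becomes linear because circulations can be
    scaled, so [y] is simply required to be at most the outflow of [c]. A circulation is needed
    because a run cannot halt; it must be parked where no further target is met. A scheduler sees
    the initial state as part of its path, so each pair of a scheduler and an initial state has its
    own copy of the flow system, and only the rows of the predicates tie the copies together. Every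
    scheduler index occurs, hence [n <= l * m], which keeps the number of copies small. The
    remaining obstacle is the bit length of numbers: a projector is kept as an integer matrix over a
    Gram determinant, which is at most a product of factors [1 + |a|^2] over the rows [a]; the same
    product tells how small a coordinate must be before it can be declared zero. *)

Definition extra : finType := option bool.
Definition sym : Set := (option bool + option bool)%type.
Definition cell : Set := option sym.

Inductive prog :=
  | Mv of 'I_4 & move
  | Wr of 'I_4 & sym
  | Seq of prog & prog
  | If of 'I_4 & (cell -> bool) & prog & prog
  | While of 'I_4 & (cell -> bool) & prog
  | Skip
  | Halt of bool.

HB.instance Definition _ := gen_eqMixin prog.
HB.instance Definition _ := gen_choiceMixin prog.

(** A step writes on every tape, so idle tapes get back the symbol just read; beyond the written
    part this leaves an explicit blank. *)
Definition stay (rd : 'I_4 -> cell) := fun i => (rd i, MoveStay).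

(* The control state is the stack [K] of the programs that remain to be run. *)
Definition kstep (K : seq prog) (rd : 'I_4 -> cell) :
    seq prog * ('I_4 -> cell * move) :=
  match K with
  | Mv i d :: K' => (K', fun j => (rd j, if j == i then d else MoveStay))
  | Wr i s :: K' => (K', fun j => (if j == i then Some s else rd j, MoveStay))
  | Seq p q :: K' => ([:: p, q & K'], stay rd)
  | If i P p q :: K' => ((if P (rd i) then p else q) :: K', stay rd)
  | While i P p :: K' => (if P (rd i) then p :: K else K', stay rd)
  | Skip :: K' => (K', stay rd)
  | Halt _ :: _ | [::] => (K, stay rd)
  end.

(** A machine has finitely many control states, although the stack of pending programs looks
    unbounded. A loop body runs on top of its own loop, so the stacks that occur above [K] are
    bounded by the syntax and can be listed ahead. *)
Fixpoint conts (p : prog) (K : seq prog) : seq (seq prog) :=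
  (p :: K) :: match p with
  | Seq p1 p2 => conts p1 (p2 :: K) ++ conts p2 K
  | If _ _ p1 p2 => conts p1 K ++ conts p2 K
  | While _ _ p1 => conts p1 (p :: K)
  | _ => [::]
  end.

Lemma mem_conts p K : p :: K \in conts p K.
Proof. by case: p => *; rewrite /= mem_head. Qed.

Lemma kstep_conts p K K' rd :
  K' \in conts p K -> (kstep K' rd).1 \in K :: conts p K.
Proof.
elim: p K K' => [i d|i s|p IHp q IHq|i P p IHp q IHq|i P p IHp||b] K K' /=;
  rewrite in_cons => /predU1P[->|]//=; rewrite ?mem_head ?inE ?eqxx ?mem_head ?orbT//.
- by rewrite mem_cat mem_conts !orbT.
- rewrite mem_cat => /orP[/IHp|/IHq]; rewrite !inE !mem_cat.
    by move=> /orP[/eqP ->|->]; rewrite ?mem_conts ?orbT.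
  by move=> /orP[/eqP ->|->]; rewrite ?eqxx ?orbT.
- by case: ifP => _; rewrite mem_cat mem_conts ?orbT.
- by rewrite mem_cat => /orP[/IHp|/IHq]; rewrite !inE mem_cat => /orP[->|->]; rewrite ?orbT.
- by case: ifP => _; rewrite ?mem_conts ?eqxx ?orbT.
- by move=> /IHp; rewrite !inE => /orP[/eqP ->|->]; rewrite ?eqxx ?orbT.
Qed.

Definition khalt (K : seq prog) : option bool :=
  if K is Halt b :: _ then Some b else None.

Definition kstate (p : prog) : finType := seq_sub ([::] :: conts p [::]).

Lemma kstate_start p : [:: p] \in [::] :: conts p [::].
Proof. by rewrite inE mem_conts orbT. Qed.

Definition mach (p : prog) : turing_machine :=
  @TuringMachine 3 (kstate p) extra (SeqSub (kstate_start p))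
    (fun q => khalt (val q))
    (fun q f => let: (K, g) := kstep (val q) f in (insubd q K, g)).

(** The tapes of [mach p] in a type that does not mention [p], so that runs of subprograms can be
    composed. *)
Definition ctape : Type := (seq cell * seq cell)%type.
Definition cread (t : ctape) : cell := head None t.2.
Definition cwrite (x : cell) (t : ctape) : ctape := (t.1, x :: behead t.2).
Definition cmove (d : move) (t : ctape) : ctape :=
  match d with
  | MoveLeft => (behead t.1, head None t.1 :: t.2)
  | MoveStay => t
  | MoveRight => (head None t.2 :: t.1, behead t.2)
  end.

Definition kconf : Type := (seq prog * ('I_4 -> ctape))%type.

Definition cstep (c : kconf) : kconf :=
  if khalt c.1 is Some _ then c
  else let: (K, f) := kstep c.1 (fun i => cread (c.2 i)) in
       (K, fun i => cmove (f i).2 (cwrite (f i).1 (c.2 i))).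

Lemma kstep_kstate p (K : kstate p) rd :
  (kstep (val K) rd).1 \in [::] :: conts p [::].
Proof.
have := valP K; rewrite inE => /predU1P[->|/kstep_conts]; last exact.
by rewrite mem_head.
Qed.

Lemma mach_step p (c : config (mach p)) (K : seq prog) (T : 'I_4 -> ctape) :
  val c.1 = K -> c.2 = T ->
  val (tm_step c).1 = (cstep (K, T)).1 /\ (tm_step c).2 = (cstep (K, T)).2.
Proof.
case: c => q T' /= <- {K} ->; rewrite /tm_step /cstep /=.
case: (khalt _) => // /=.
have -> : ([ffun i => tape_read (A := mach p) (T i)] : 'I_4 -> cell) =
    (fun i => cread (T i)).
  by apply/funext => i; rewrite ffunE.
have := kstep_kstate q (fun i => cread (T i)).
by case: (kstep _ _) => K g /= KP; rewrite insubdK.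
Qed.

Definition ctape0 (w : word) : 'I_4 -> ctape :=
  fun i => if i == ord0 then ([::], [seq Some (inl x) | x <- w]) else ([::], [::]).

Lemma mach_verdict p w t :
  tm_verdict (mach p) w t = khalt (iter t cstep ([:: p], ctape0 w)).1.
Proof.
rewrite /tm_verdict.
suff [<- _] : val (iter t (@tm_step (mach p)) (tm_init (mach p) w)).1 =
         (iter t cstep ([:: p], ctape0 w)).1 /\
       (iter t (@tm_step (mach p)) (tm_init (mach p) w)).2 =
         (iter t cstep ([:: p], ctape0 w)).2 by [].
elim: t => [//|t [IH1 IH2]]; rewrite !iterS.
have := mach_step IH1 IH2.
by case: (iter t cstep _).
Qed.

(** * Tapes as stacks *)

Definition stacks : Type := 'I_4 -> seq sym.

(** The stack is the part of the tape from the head to the right. Cells on the left hold popped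
    symbols, which pushes overwrite. Comparing by [nth] ignores explicit blanks at the end. *)
Definition tmatch (T : 'I_4 -> ctape) (S : stacks) : Prop :=
  forall i n, nth None (T i).2 n = nth None (map Some (S i)) n.

(** Quantifying over the continuation [K] makes runs composable; [t] is an upper bound, so times can
    be rounded up. *)
Variant exec (p : prog) (S S' : stacks) (t : nat) : Prop :=
  Exec of forall K T, tmatch T S -> exists T' t',
    [/\ t' <= t, tmatch T' S' & iter t' cstep (p :: K, T) = (K, T')].

Lemma exec_le p S S' t u : t <= u -> exec p S S' t -> exec p S S' u.
Proof.
move=> le [e]; split=> K T /(e K)[T' [t' [le' m' i]]]; exists T', t'; split=> //.
exact: leq_trans le.
Qed.

Lemma tmatch_read T S i : tmatch T S -> cread (T i) = ohead (S i).
Proof. by move=> /(_ i 0); rewrite /cread nth0 => ->; case: (S i). Qed.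

Definition tstay (T : 'I_4 -> ctape) : 'I_4 -> ctape :=
  fun i => cwrite (cread (T i)) (T i).

Lemma tmatch_stay T S : tmatch T S -> tmatch (tstay T) S.
Proof. by move=> m i n; rewrite -m /tstay /cread /=; case: (T i).2; case: n => [|[]]. Qed.

Definition upd (S : stacks) (i : 'I_4) v : stacks :=
  fun j => if j == i then v else S j.

Lemma exec_skip S : exec Skip S S 1.
Proof. by split=> K T m; exists (tstay T), 1; split=> //; exact: tmatch_stay. Qed.

Lemma exec_seq p q S S1 S2 t1 t2 : exec p S S1 t1 -> exec q S1 S2 t2 ->
  exec (Seq p q) S S2 (t1 + t2).+1.
Proof.
move=> [e1] [e2]; split=> K T /tmatch_stay /(e1 (q :: K))[T1 [t1' [l1 m1 i1]]].
have [T2 [t2' [l2 m2 i2]]] := e2 K _ m1.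
exists T2, (t1' + t2').+1; split=> //; first by rewrite ltnS leq_add.
by rewrite iterSr addnC iterD /cstep/= -/cstep i1.
Qed.

Lemma exec_if i (P : cell -> bool) p q S S' t :
  exec (if P (ohead (S i)) then p else q) S S' t -> exec (If i P p q) S S' t.+1.
Proof.
move=> [e]; split=> K T m; have r := tmatch_read i m.
have [T1 [t1 [l1 m1 i1]]] := e K _ (tmatch_stay m).
exists T1, t1.+1; split=> //.
by rewrite iterSr /cstep/= -/cstep r; exact: i1.
Qed.

Lemma exec_while0 i (P : cell -> bool) p S :
  ~~ P (ohead (S i)) -> exec (While i P p) S S 1.
Proof.
move=> nP; split=> K T m; have r := tmatch_read i m.
exists (tstay T), 1; split=> //; first exact: tmatch_stay.
by rewrite /= /cstep/= r (negbTE nP).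
Qed.

Lemma exec_while1 i (P : cell -> bool) p S S1 S2 t1 t2 : P (ohead (S i)) ->
  exec p S S1 t1 -> exec (While i P p) S1 S2 t2 ->
  exec (While i P p) S S2 (t1 + t2).+1.
Proof.
move=> hP [e1] [e2]; split=> K T m; have r := tmatch_read i m.
have [T1 [t1' [l1 m1 i1]]] := e1 (While i P p :: K) _ (tmatch_stay m).
have [T2 [t2' [l2 m2 i2]]] := e2 K _ m1.
exists T2, (t1' + t2').+1; split=> //; first by rewrite ltnS leq_add.
by rewrite iterSr addnC iterD /cstep/= -/cstep r hP i1.
Qed.

Definition Pop i := Mv i MoveRight.
Definition Push i s := Seq (Mv i MoveLeft) (Wr i s).

Lemma exec_pop i S : exec (Pop i) S (upd S i (behead (S i))) 1.
Proof.
split=> K T m.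
exists (fun j => cmove (if j == i then MoveRight else MoveStay) (tstay T j)), 1.
split=> // j n; rewrite /upd; case: eqP => [->|_]; last exact: tmatch_stay.
have := tmatch_stay m i n.+1; rewrite /tstay /= => ->.
by case: (S i) => //=; rewrite nth_nil.
Qed.

Lemma exec_push i s S : exec (Push i s) S (upd S i (s :: S i)) 3.
Proof.
split=> K T m.
pose T1 : 'I_4 -> ctape := fun j =>
  cmove (if j == i then MoveLeft else MoveStay) (tstay (tstay T) j).
exists (fun j => cwrite (if j == i then Some s else cread (T1 j)) (T1 j)), 3.
split=> // j n; rewrite /upd /T1; case: eqP => [->|_] /=; last first.
  exact: (tmatch_stay (tmatch_stay (tmatch_stay m)) j n).
by case: n => //= n; rewrite -(tmatch_stay (tmatch_stay m)).
Qed.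

(** * Binary trees in prefix notation on the stacks *)

Inductive tree := Leaf | Node of tree & tree.

Definition isnode d := if d is Node _ _ then true else false.
Definition car d := if d is Node a _ then a else Leaf.
Definition cdr d := if d is Node _ b then b else Leaf.

Definition iE : 'I_4 := @Ordinal 4 0 isT.
Definition iM : 'I_4 := @Ordinal 4 1 isT.
Definition iB : 'I_4 := @Ordinal 4 2 isT.
Definition iC : 'I_4 := @Ordinal 4 3 isT.

Definition sN : sym := inr (Some true).
Definition sL : sym := inr (Some false).
Definition sK : sym := inr None.

Fixpoint ser d : seq sym :=
  if d is Node a b then sN :: ser a ++ ser b else [:: sL].

Definition sz d := size (ser d).

Lemma szN a b : sz (Node a b) = (sz a + sz b).+1.
Proof. by rewrite /sz /= size_cat. Qed.

Lemma sz_gt0 d : 0 < sz d. Proof. by case: d. Qed.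

(* Tape E is scratch space, M holds serialized trees, B saved reversed ones
   separated by [sK], and C a unary counter of the pending subtrees. *)
Definition st e m b c : stacks := fun i => nth [::] [:: e; m; b; c] i.

Lemma updE e m b c v : upd (st e m b c) iE v = st v m b c.
Proof. by apply/funext => -[[|[|[|[|]]]] i]. Qed.
Lemma updM e m b c v : upd (st e m b c) iM v = st e v b c.
Proof. by apply/funext => -[[|[|[|[|]]]] i]. Qed.
Lemma updB e m b c v : upd (st e m b c) iB v = st e m v c.
Proof. by apply/funext => -[[|[|[|[|]]]] i]. Qed.
Lemma updC e m b c v : upd (st e m b c) iC v = st e m b v.
Proof. by apply/funext => -[[|[|[|[|]]]] i]. Qed.
Definition updst := (updE, updM, updB, updC).

Lemma popE x e m b c : exec (Pop iE) (st (x :: e) m b c) (st e m b c) 1.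
Proof. by have := exec_pop iE (st (x :: e) m b c); rewrite updst. Qed.
Lemma popM e x m b c : exec (Pop iM) (st e (x :: m) b c) (st e m b c) 1.
Proof. by have := exec_pop iM (st e (x :: m) b c); rewrite updst. Qed.
Lemma popB e m x b c : exec (Pop iB) (st e m (x :: b) c) (st e m b c) 1.
Proof. by have := exec_pop iB (st e m (x :: b) c); rewrite updst. Qed.
Lemma popC e m b x c : exec (Pop iC) (st e m b (x :: c)) (st e m b c) 1.
Proof. by have := exec_pop iC (st e m b (x :: c)); rewrite updst. Qed.
Lemma pushE s e m b c : exec (Push iE s) (st e m b c) (st (s :: e) m b c) 3.
Proof. by have := exec_push iE s (st e m b c); rewrite updst. Qed.
Lemma pushM s e m b c : exec (Push iM s) (st e m b c) (st e (s :: m) b c) 3.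
Proof. by have := exec_push iM s (st e m b c); rewrite updst. Qed.
Lemma pushB s e m b c : exec (Push iB s) (st e m b c) (st e m (s :: b) c) 3.
Proof. by have := exec_push iB s (st e m b c); rewrite updst. Qed.
Lemma pushC s e m b c : exec (Push iC s) (st e m b c) (st e m b (s :: c)) 3.
Proof. by have := exec_push iC s (st e m b c); rewrite updst. Qed.

Definition is_sym (s : sym) : cell -> bool := fun x => x == Some s.
Definition is_tsym : cell -> bool := fun x => (x == Some sN) || (x == Some sL).

Definition emit (tb te : bool) (s : sym) : prog :=
  Seq (if tb then Push iB s else Skip) (if te then Push iE s else Skip).

Lemma exec_emit tb te s e m b c : exec (emit tb te s) (st e m b c)
  (st (if te then s :: e else e) m (if tb then s :: b else b) c) 7.
Proof.
apply: (@exec_seq _ _ _ (st e m (if tb then s :: b else b) c) _ 3 3).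
  by case: tb; [exact: pushB|apply: exec_le (exec_skip _)].
by case: te; [exact: pushE|apply: exec_le (exec_skip _)].
Qed.

(** Prefix notation has no end marker. The counter on C finds the end of the top tree: a node
    replaces one pending subtree by two, a leaf removes one. The flags select which of B and E
    receives a reversed copy. *)
Definition scan_loop tb te : prog :=
  While iC (is_sym sK) (Seq (Pop iC) (If iM (is_sym sN)
    (Seq (Push iC sK) (Seq (Push iC sK) (Seq (emit tb te sN) (Pop iM))))
    (Seq (emit tb te sL) (Pop iM)))).

(** The rest of the loop, with one pending subtree fewer, is a hypothesis with an arbitrary outcome
    [S]; this carries the induction through both subtrees of a node. The constant 30 covers the work
    on one symbol. *)
Lemma exec_scan_loop tb te x e m b c S t :
  exec (scan_loop tb te) (st (if te then catrev (ser x) e else e) m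
     (if tb then catrev (ser x) b else b) c) S t ->
  exec (scan_loop tb te) (st e (ser x ++ m) b (sK :: c)) S (t + 30 * sz x).
Proof.
elim: x e m b c t => [|x1 IH1 x2 IH2] e m b c t /= H.
  apply: exec_le; last first.
    apply: exec_while1 => //.
      apply: (exec_seq (popC _ _ _ _ _)); apply: exec_if => /=.
      exact: (exec_seq (exec_emit _ _ _ _ _ _ _) (popM _ _ _ _ _)).
    by move: H; case: tb; case: te; exact.
  by rewrite /sz /=; lia.
apply: exec_le; last first.
  apply: exec_while1 => //.
    apply: (exec_seq (popC _ _ _ _ _)); apply: exec_if => /=.
    apply: (exec_seq (pushC _ _ _ _ _)); apply: (exec_seq (pushC _ _ _ _ _)).
    exact: (exec_seq (exec_emit _ _ _ _ _ _ _) (popM _ _ _ _ _)).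
  rewrite -catA; apply: IH1; apply: IH2.
  by move: H; case: tb; case: te => /=; rewrite ?catrev_catl; exact.
by rewrite szN; lia.
Qed.

Definition scan tb te : prog := Seq (Push iC sK) (scan_loop tb te).

Lemma exec_scan tb te x e m b : exec (scan tb te) (st e (ser x ++ m) b [::])
  (st (if te then catrev (ser x) e else e) m
      (if tb then catrev (ser x) b else b) [::]) (40 * sz x).
Proof.
apply: exec_le; last first.
  apply: (exec_seq (pushC _ _ _ _ _)); apply: exec_scan_loop.
  by apply: exec_while0.
by have := sz_gt0 x; lia.
Qed.

(** Moving a reversed copy to M puts it in order again. The loop ends at the separator [sK] on B, or
    at the bottom of E. *)
Definition back (i : 'I_4) : prog :=
  While i is_tsym (Seq (If i (is_sym sN) (Push iM sN) (Push iM sL)) (Pop i)).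

Lemma exec_backB s e m b c : all (fun s => is_tsym (Some s)) s ->
  ~~ is_tsym (ohead b) ->
  exec (back iB) (st e m (s ++ b) c) (st e (catrev s m) b c) (10 * size s).+1.
Proof.
move=> sP bP; elim: s m sP => [|a s IHs] m /=.
  by move=> _; apply: exec_while0.
move=> /andP[aP sP]; apply: exec_le; last first.
  apply: exec_while1 => //; last exact: IHs.
  apply: (@exec_seq _ _ _ (st e (a :: m) (a :: s ++ b) c) _ 4 1); last exact: popB.
  apply: exec_if => /=; case/orP: aP => /eqP[->] /=; exact: pushM.
lia.
Qed.

Lemma exec_backE s m b c : all (fun s => is_tsym (Some s)) s ->
  exec (back iE) (st s m b c) (st [::] (catrev s m) b c) (10 * size s).+1.
Proof.
elim: s m => [|a s IHs] m /=.
  by move=> _; apply: exec_while0.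
move=> /andP[aP sP]; apply: exec_le; last first.
  apply: exec_while1 => //; last exact: IHs.
  apply: (@exec_seq _ _ _ (st (a :: s) (a :: m) b c) _ 4 1); last exact: popE.
  apply: exec_if => /=; case/orP: aP => /eqP[->] /=; exact: pushM.
lia.
Qed.

Lemma ser_tsym d : all (fun s => is_tsym (Some s)) (ser d).
Proof. by elim: d => //= a IHa b IHb; rewrite all_cat IHa IHb. Qed.

Lemma rser_tsym d : all (fun s => is_tsym (Some s)) (rev (ser d)).
Proof. by rewrite all_rev ser_tsym. Qed.

Definition dup : prog := Seq (Push iB sK) (Seq (scan true true) (back iE)).

Lemma exec_dup x m b : exec dup (st [::] (ser x ++ m) b [::])
  (st [::] (ser x ++ m) (rev (ser x) ++ sK :: b) [::]) (60 * sz x).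
Proof.
apply: exec_le; last first.
  apply: (exec_seq (pushB _ _ _ _ _)); apply: (exec_seq (exec_scan _ _ _ _ _ _)).
  have := @exec_backE (rev (ser x)) m (catrev (ser x) (sK :: b)) [::] (rser_tsym x).
  by rewrite !catrevE revK cats0; exact.
by rewrite size_rev -/(sz x); have := sz_gt0 x; lia.
Qed.

Definition restore : prog := Seq (back iB) (Pop iB).

Lemma exec_restore x m b : exec restore
  (st [::] m (rev (ser x) ++ sK :: b) [::]) (st [::] (ser x ++ m) b [::])
  (15 * sz x).
Proof.
apply: exec_le; last first.
  have := @exec_backB (rev (ser x)) [::] m (sK :: b) [::] (rser_tsym x) isT.
  by rewrite !catrevE revK => /exec_seq; apply; exact: popB.
by rewrite size_rev -/(sz x); have := sz_gt0 x; lia.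
Qed.

(** * Programs on trees *)

Variant Comp (p : prog) (x y : tree) (t : nat) : Prop := Comput of forall m b,
  exec p (st [::] (ser x ++ m) b [::]) (st [::] (ser y ++ m) b [::]) t.

Lemma Comp_le p x y t u : t <= u -> Comp p x y t -> Comp p x y u.
Proof. by move=> le [H]; split=> m b; exact: exec_le (H m b). Qed.

Lemma Comp_id x : Comp Skip x x 1.
Proof. by split=> m b; exact: exec_skip. Qed.

Lemma Comp_seq p q x y z t1 t2 : Comp p x y t1 -> Comp q y z t2 ->
  Comp (Seq p q) x z (t1 + t2).+1.
Proof. by move=> [H1] [H2]; split=> m b; exact: exec_seq (H1 m b) (H2 m b). Qed.

Fixpoint push_all (s : seq sym) : prog :=
  if s is x :: s' then Seq (push_all s') (Push iM x) else Skip.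

Lemma exec_push_all s e m b c :
  exec (push_all s) (st e m b c) (st e (s ++ m) b c) (4 * size s).+1.
Proof.
elim: s => [|x s IHs] /=; first exact: exec_skip.
by apply: exec_le (exec_seq IHs (pushM _ _ _ _ _)); lia.
Qed.

Definition constP d : prog := Seq (scan false false) (push_all (ser d)).

Lemma Comp_const d x : Comp (constP d) x d (40 * sz x + 4 * sz d + 2).
Proof.
split=> m b; apply: exec_le (exec_seq (exec_scan _ _ _ _ _ _) (exec_push_all _ _ _ _ _)).
by rewrite -/(sz d); lia.
Qed.

Definition carP : prog := If iM (is_sym sN) (Seq (Pop iM) (Seq (scan false true)
  (Seq (scan false false) (back iE)))) Skip.

Lemma Comp_car x : Comp carP x (car x) (60 * sz x).
Proof.
split=> m b; case: x => [|x y].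
  by apply: (@exec_le _ _ _ 2) => //; apply: exec_if; exact: exec_skip.
apply: exec_le; last first.
  apply: exec_if => /=; apply: (exec_seq (popM _ _ _ _ _)); rewrite -catA.
  apply: (exec_seq (exec_scan _ _ _ _ _ _)); apply: (exec_seq (exec_scan _ _ _ _ _ _)).
  have := @exec_backE (rev (ser x)) m b [::] (rser_tsym x).
  by rewrite !catrevE revK cats0; exact.
by rewrite size_rev -/(sz x) szN; have := sz_gt0 x; have := sz_gt0 y; lia.
Qed.

Definition cdrP : prog :=
  If iM (is_sym sN) (Seq (Pop iM) (scan false false)) Skip.

Lemma Comp_cdr x : Comp cdrP x (cdr x) (60 * sz x).
Proof.
split=> m b; case: x => [|x y].
  by apply: (@exec_le _ _ _ 2) => //; apply: exec_if; exact: exec_skip.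
apply: exec_le; last first.
  apply: exec_if => /=; apply: (exec_seq (popM _ _ _ _ _)); rewrite -catA.
  exact: exec_scan.
by rewrite szN; have := sz_gt0 x; have := sz_gt0 y; lia.
Qed.

(** The second component is computed first; the first then lands on top of it, and pushing [sN]
    completes the node without copying. *)
Definition consP p q : prog :=
  Seq dup (Seq q (Seq restore (Seq p (Push iM sN)))).

Lemma Comp_cons p q x y z t1 t2 : Comp p x y t1 -> Comp q x z t2 ->
  Comp (consP p q) x (Node y z) (t1 + t2 + 90 * sz x).
Proof.
move=> [H1] [H2]; split=> m b; apply: exec_le; last first.
  apply: (exec_seq (exec_dup _ _ _)); apply: (exec_seq (H2 _ _)).
  apply: (exec_seq (exec_restore _ _ _)).
  apply: (exec_seq (H1 _ _)); rewrite /= -catA; exact: pushM.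
by have := sz_gt0 x; lia.
Qed.

Definition ifP' p q r : prog := Seq dup (Seq p (If iM (is_sym sN)
  (Seq (scan false false) (Seq restore q)) (Seq (scan false false) (Seq restore r)))).

Lemma Comp_if p q r x y z t1 t2 : Comp p x y t1 ->
  Comp (if isnode y then q else r) x z t2 ->
  Comp (ifP' p q r) x z (t1 + t2 + 90 * sz x + 40 * sz y).
Proof.
move=> [H1] [H2]; split=> m b; apply: exec_le; last first.
  apply: (exec_seq (exec_dup _ _ _)); apply: (exec_seq (H1 _ _)).
  apply: (@exec_if _ _ _ _ _ _ (40 * sz y + (15 * sz x + t2).+1).+1).
  have -> : is_sym sN (ohead (st [::] (ser y ++ m) (rev (ser x) ++ sK :: b) [::] iM))
     = isnode y by case: (y).
  by move: H2; case: ifP => _ H2; apply: (exec_seq (exec_scan _ _ _ _ _ _));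
    apply: (exec_seq (exec_restore _ _ _)); exact: H2.
by have := sz_gt0 x; have := sz_gt0 y; lia.
Qed.

Definition whileP p q : prog := Seq dup (Seq p (Seq
  (While iM (is_sym sN) (Seq (scan false false) (Seq restore (Seq q (Seq dup p)))))
  (Seq (scan false false) restore))).

(** The iterates [X] and the values [F] of the test are supplied in advance, which settles
    termination; uniform bounds on times and sizes give the total. *)
Lemma Comp_while p q (X F : nat -> tree) n t1 t2 s :
  (forall i, i <= n -> Comp p (X i) (F i) t1) ->
  (forall i, i <= n -> isnode (F i) = (i < n)) ->
  (forall i, i < n -> Comp q (X i) (X i.+1) t2) ->
  (forall i, i <= n -> sz (X i) <= s /\ sz (F i) <= s) ->
  Comp (whileP p q) (X 0) (X n) (n.+1 * (t1 + t2 + 200 * s)).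
Proof.
move=> HF Fn HX Hs; split=> m b.
rewrite /whileP; set W := While _ _ _.
have loop k : forall i, i + k = n ->
  exec W (st [::] (ser (F i) ++ m) (rev (ser (X i)) ++ sK :: b) [::])
    (st [::] (ser (F n) ++ m) (rev (ser (X n)) ++ sK :: b) [::])
    (k * (t1 + t2 + 130 * s)).+1.
  elim: k => [|k IHk] i ein.
    rewrite addn0 in ein; subst i; apply: exec_le; last first.
      by apply: exec_while0 => /=; move: (Fn n (leqnn _)); rewrite ltnn; case: (F n).
    by [].
  have ltin : i < n by lia.
  have [sX sF] := Hs i (ltnW ltin); have [sX' _] := Hs i.+1 ltin.
  apply: exec_le; last first.
    apply: exec_while1.
    - by move: (Fn i (ltnW ltin)); rewrite ltin; case: (F i).
    - apply: (exec_seq (exec_scan _ _ _ _ _ _)).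
      apply: (exec_seq (exec_restore _ _ _)).
      have [HXi] := HX _ ltin; apply: (exec_seq (HXi _ _)).
      by apply: (exec_seq (exec_dup _ _ _)); case: (HF i.+1 ltin).
    - by apply: IHk; lia.
  have := sz_gt0 (X i); lia.
have [sX sF] := Hs n (leqnn _); have [sX' _] := Hs 0 (leq0n _).
apply: exec_le; last first.
  apply: (exec_seq (exec_dup _ _ _)); have [H0] := HF _ (leq0n _); apply: (exec_seq (H0 _ _)).
  apply: (exec_seq (loop n 0 (add0n _))).
  apply: exec_seq (exec_restore _ _ _); exact: exec_scan.
have := sz_gt0 (X n); rewrite mulSn; set A := t1 + t2.
have : n * (A + 130 * s) <= n * (A + 200 * s) by rewrite leq_mul2l; apply/orP; right; lia.
lia.
Qed.

(** * Polynomial-time functions on encoded data *)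

(** The encodings below coincide on purpose: [(x, s)] and [x :: s] are the same tree, so are
    [Some x], [[:: x]] and [(x, tt)], and [true] is what [isnode] recognizes. Conversions among them
    are free by [PT_recode]. *)
Structure encType := EncType { enc_sort :> Type; enc_map : enc_sort -> tree }.

Definition enc {T : encType} (x : T) : tree := enc_map x.

Arguments enc {T} x : simpl never.

Canonical unit_encType := EncType (fun _ : unit => Leaf).
Canonical bool_encType := EncType (fun b : bool => if b then Node Leaf Leaf else Leaf).
Canonical option_encType (T : encType) :=
  EncType (fun o : option T => if o is Some x then Node (enc x) Leaf else Leaf).
Canonical prod_encType (T U : encType) :=
  EncType (fun q : T * U => Node (enc q.1) (enc q.2)).
Canonical seq_encType (T : encType) :=
  EncType (foldr (fun (x : T) d => Node (enc x) d) Leaf).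

Definition esz {T : encType} (x : T) : nat := sz (enc x).

Definition is_letter (x : cell) : bool := if x is Some (inl _) then true else false.

Definition case_letter (i : 'I_4) (f : option bool -> prog) : prog :=
  If i (is_sym (inl None)) (f None)
    (If i (is_sym (inl (Some true))) (f (Some true)) (f (Some false))).

Lemma exec_case_letter i f a s S S' t : S i = inl a :: s ->
  exec (f a) S S' t -> exec (case_letter i f) S S' t.+2.
Proof.
case: a => [[]|] Si e; apply: exec_if; rewrite Si //=; last exact: exec_le e.
  by apply: exec_if; rewrite Si.
by apply: exec_if; rewrite Si.
Qed.

(** The first pass reverses the word onto B; the second builds the list on M from its last letter,
    above the leaf that ends it. *)
Definition load : prog := Seq
  (While iE is_letter (Seq (case_letter iE (fun a => Push iB (inl a))) (Pop iE)))
  (Seq (Push iM sL)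
  (While iB is_letter (Seq (case_letter iB
     (fun a => push_all (sN :: ser (enc a)))) (Pop iB)))).

Lemma exec_load (w : seq (option bool)) :
  exec load (st (map inl w) [::] [::] [::]) (st [::] (ser (enc w)) [::] [::])
    (50 * (size w).+1).
Proof.
have e1 b : exec (While iE is_letter (Seq (case_letter iE (fun a => Push iB (inl a))) (Pop iE)))
    (st (map inl w) [::] b [::]) (st [::] [::] (catrev (map inl w) b) [::]) (10 * (size w)).+1.
  elim: w b => [|a w IHw] b /=; first by apply: exec_while0.
  apply: exec_le; last first.
    apply: (exec_while1 _ _ (IHw (inl a :: b))) => //.
    apply: (@exec_seq _ _ _ (st (inl a :: map inl w) [::] (inl a :: b) [::])); last exact: popE.
    by apply: (@exec_case_letter _ _ a (map inl w)) => //; exact: pushB.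
  lia.
have e2 m : exec (While iB is_letter (Seq (case_letter iB
     (fun a => push_all (sN :: ser (enc a)))) (Pop iB)))
    (st [::] m (rev (map inl w)) [::])
    (st [::] (flatten [seq sN :: ser (enc a) | a <- w] ++ m) [::] [::])
    (40 * size w).+1.
  elim/last_ind: w m {e1} => [|w a IHw] m /=; first by apply: exec_while0.
  rewrite map_rcons rev_rcons; apply: exec_le; last first.
    have := IHw ((sN :: ser (enc a)) ++ m); rewrite catA -flatten_rcons -map_rcons => IH.
    apply: (exec_while1 _ _ IH) => //.
    apply: (@exec_seq _ _ _ (st [::] ((sN :: ser (enc a)) ++ m) (inl a :: rev (map inl w)) [::]));
      last exact: popB.
    apply: (@exec_case_letter _ _ a (rev (map inl w))) => //.
    exact: exec_push_all.
  rewrite size_rcons; case: a => [[]|] /=; lia.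
apply: exec_le; last first.
  apply: (exec_seq (e1 [::])); apply: (exec_seq (pushM _ _ _ _ _)).
  rewrite catrevE cats0; have -> : ser (enc w) = flatten [seq sN :: ser (enc a) | a <- w] ++ [:: sL].
    by elim: w {e1 e2} => //= a w IHw; rewrite -catA -IHw.
  exact: e2.
lia.
Qed.

Definition decider (p : prog) : turing_machine :=
  mach (Seq (Seq load p) (If iM (is_sym sN) (Halt true) (Halt false))).

Lemma decider_verdict p (w : seq (option bool)) d t : Comp p (enc w) d t ->
  exists t', t' <= t + 60 * (size w).+1 /\
    tm_verdict (decider p) w t' = Some (isnode d).
Proof.
move=> [Hp].
have m : tmatch (ctape0 w) (st (map inl w) [::] [::] [::]).
  move=> [[|[|[|[|]]]] i] n; rewrite /ctape0 //=.
  by rewrite -map_comp.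
have := Hp [::] [::]; rewrite !cats0 => /(exec_seq (exec_load w))[e].
have [T1 [t1 [l1 m1 i1]]] := e [:: If iM (is_sym sN) (Halt true) (Halt false)] _ (tmatch_stay m).
(* One step unfolds the outer [Seq], one evaluates the final test. *)
exists t1.+2; split; first by lia.
pose K := [:: If iM (is_sym sN) (Halt true) (Halt false)].
have S0 : cstep ([:: Seq (Seq load p) (If iM (is_sym sN) (Halt true) (Halt false))], ctape0 w)
  = (Seq load p :: K, tstay (ctape0 w)) by [].
rewrite mach_verdict iterS iterSr S0 i1 /cstep /= (tmatch_read iM m1) /=.
by case: (d).
Qed.

(** With a base of at least 2, a larger exponent absorbs constants, sums and products, so a single
    [k] describes a polynomial bound. *)
Definition pol (k n : nat) : nat := (n + 2) ^ k.

Lemma pol_gt0 k n : 0 < pol k n. Proof. by rewrite expn_gt0 addn_gt0 orbT. Qed.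

Lemma leq_pol k k' n n' : k <= k' -> n <= n' -> pol k n <= pol k' n'.
Proof.
move=> lk ln; apply: (@leq_trans (pol k n')).
  by case: k lk => // k _; rewrite leq_exp2r ?leq_add2r.
by rewrite leq_exp2l// addn2.
Qed.

Definition pb T (mu g : T -> nat) : Prop := exists k, forall x, g x <= pol k (mu x).

Section polynomial_bounds.
Variables (T : Type) (mu : T -> nat).
Implicit Types f g : T -> nat.

Lemma pb_le f g : (forall x, f x <= g x) -> pb mu g -> pb mu f.
Proof. by move=> le [k H]; exists k => x; exact: leq_trans (H x). Qed.

Lemma pb_const c : pb mu (fun=> c).
Proof.
exists c => x; apply: (leq_trans (ltnW (ltn_expl c (isT : 1 < 2)))).
by case: c => // c; rewrite /pol leq_exp2r ?addn2.
Qed.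

Lemma pb_mu : pb mu mu.
Proof. by exists 1 => x; rewrite /pol expn1 leq_addr. Qed.

Lemma pb_mul f g : pb mu f -> pb mu g -> pb mu (fun x => f x * g x).
Proof. by move=> [k H] [k' H']; exists (k + k') => x; rewrite /pol expnD leq_mul. Qed.

Lemma pb_add f g : pb mu f -> pb mu g -> pb mu (fun x => f x + g x).
Proof.
move=> [k H] [k' H']; exists (k + k').+1 => x.
have := leq_pol (leq_addr k' k) (leqnn (mu x)); have := leq_pol (leq_addl k k') (leqnn (mu x)).
have := H x; have := H' x; have := pol_gt0 (k + k') (mu x).
have -> : pol (k + k').+1 (mu x) = (mu x + 2) * pol (k + k') (mu x) by rewrite /pol expnS.
nia.
Qed.

Lemma pb_S f : pb mu f -> pb mu (fun x => (f x).+1).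
Proof.
move=> H; apply: (@pb_le _ (fun x => f x + 1)); last exact: pb_add (pb_const 1).
by move=> x; rewrite addn1.
Qed.

Lemma pb_pol k g : pb mu g -> pb mu (fun x => pol k (g x)).
Proof.
move=> H; elim: k => [|k IHk]; first exact: (pb_const 1).
apply: (@pb_le _ (fun x => (g x + 2) * pol k (g x))); first by move=> x; rewrite -expnS.
by apply: pb_mul => //; apply: pb_add => //; exact: pb_const.
Qed.

Lemma pb_comp U (nu h : U -> nat) (f : T -> U) : pb nu h ->
  pb mu (fun x => nu (f x)) -> pb mu (fun x => h (f x)).
Proof. by move=> [k H] /(pb_pol k); apply: pb_le => x; exact: H. Qed.

End polynomial_bounds.

Ltac pb1 := match goal with
  | H : pb _ _ |- _ => exact H
  | |- pb _ (fun _ => ?c) => exact (pb_const _ c)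
  | |- pb ?mu (fun x => ?mu x) => exact (pb_mu mu)
  | |- pb _ (fun x => @?f x + @?g x) => apply (@pb_add _ _ f g)
  | |- pb _ (fun x => @?f x * @?g x) => apply (@pb_mul _ _ f g)
  | |- pb _ (fun x => pol ?k (@?f x)) => apply (@pb_pol _ _ k f)
  | |- pb _ (fun x => (@?f x).+1) => apply (@pb_S _ _ f)
  end.
Ltac pb := repeat (cbv beta; pb1).

(** The measure [mu] is free because in the end it also contains [2 ^ l] and [2 ^ (l * m)]. It must
    control the size of the argument, which programs copy, and the size of the result, so that
    compositions stay polynomial. *)
Definition PT (T U : encType) (mu : T -> nat) (f : T -> U) :=
  [/\ pb mu esz, pb mu (fun x => esz (f x)) &
  exists p t, pb mu t /\ forall x, Comp p (enc x) (enc (f x)) (t x)].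

Lemma esz_gt0 {T : encType} (a : T) : 0 < esz a. Proof. exact: sz_gt0. Qed.

Section enc_size.
Variables T U : encType.

Lemma esz_pair (a : T) (b : U) : esz (a, b) = (esz a + esz b).+1.
Proof. exact: szN. Qed.
Lemma esz_nil : esz ([::] : seq T) = 1. Proof. by []. Qed.
Lemma esz_cons (a : T) s : esz (a :: s) = (esz a + esz s).+1.
Proof. exact: szN. Qed.
Lemma esz_bool (b : bool) : esz b <= 3. Proof. by case: b. Qed.

Lemma esz_cat (s s' : seq T) : (esz (s ++ s')).+1 = esz s + esz s'.
Proof. by elim: s => [|a s IHs]; rewrite ?esz_nil ?add1n //= !esz_cons; lia. Qed.

Lemma esz_rev (s : seq T) : esz (rev s) = esz s.
Proof.
elim: s => // a s IHs; rewrite rev_cons -cats1.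
have := esz_cat (rev s) [:: a]; rewrite esz_cons esz_nil esz_cons IHs; lia.
Qed.

Lemma size_esz (s : seq T) : size s < esz s.
Proof. by elim: s => //= a s IHs; rewrite esz_cons; lia. Qed.

Lemma esz_drop i (s : seq T) : esz (drop i s) <= esz s.
Proof.
by have := esz_cat (take i s) (drop i s); rewrite cat_take_drop;
  have := esz_gt0 (take i s); lia.
Qed.

Lemma esz_take i (s : seq T) : esz (take i s) <= esz s.
Proof.
by have := esz_cat (take i s) (drop i s); rewrite cat_take_drop;
  have := esz_gt0 (drop i s); lia.
Qed.

End enc_size.

Lemma esz_nth (T : encType) x0 (s : seq T) i : i < size s -> esz (nth x0 s i) < esz s.
Proof.
elim: s i => // a s IHs [|i] /=; rewrite esz_cons; first by lia.
by move=> /IHs; lia.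
Qed.

Lemma esz_map (T U : encType) (f : T -> U) s B :
  (forall i x0, i < size s -> esz (f (nth x0 s i)) <= B) ->
  esz (map f s) <= 1 + size s * B.+1.
Proof.
elim: s => [|a s IHs] H; first by rewrite esz_nil.
rewrite /= esz_cons; have := H 0 a isT.
by have := IHs (fun i x0 => H i.+1 x0); rewrite /=; lia.
Qed.

Section closure.
Variables T : encType.
Implicit Types mu : T -> nat.

Lemma PT_ext mu (U : encType) (f g : T -> U) : f =1 g -> PT mu f -> PT mu g.
Proof. by move=> /funext ->. Qed.

Lemma PT_recode mu (U U' : encType) (f : T -> U) (g : T -> U') :
  (forall x, enc (f x) = enc (g x)) -> PT mu f -> PT mu g.
Proof.
move=> e [H1 H2 [p [t [ht H3]]]]; split=> //.
  by apply: pb_le H2 => x; rewrite /esz e.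
by exists p, t; split=> // x; rewrite -e.
Qed.

Lemma PT_adq mu (U : encType) (f : T -> U) : PT mu f -> pb mu esz.
Proof. by case. Qed.

Lemma PT_id mu : pb mu esz -> PT mu (fun x => x).
Proof.
by move=> H; split=> //; exists Skip, (fun=> 1); split=> [|x];
  [exact: pb_const|exact: Comp_id].
Qed.

Lemma PT_const mu (U : encType) (c : U) : pb mu esz -> PT mu (fun=> c).
Proof.
move=> H; split=> //; first exact: pb_const.
exists (constP (enc c)), (fun x => 40 * esz x + 4 * esz c + 2); split; first by pb.
by move=> x; exact: Comp_const.
Qed.

(** The outer function is measured by the size of its own argument; the bound on the output of [f]
    turns this into a polynomial in [mu]. *)
Lemma PT_comp mu (U V : encType) (f : T -> U) (g : U -> V) :
  PT mu f -> PT esz g -> PT mu (fun x => g (f x)).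
Proof.
move=> [H1 H2 [p [t [ht H3]]]] [H4 H5 [p' [t' [ht' H6]]]]; split=> //.
  exact: (pb_comp H5 H2).
exists (Seq p p'), (fun x => (t x + t' (f x)).+1); split.
  by pb; exact: (pb_comp ht' H2).
by move=> x; exact: Comp_seq (H3 x) (H6 _).
Qed.

Lemma PT_pair mu (U V : encType) (f : T -> U) (g : T -> V) :
  PT mu f -> PT mu g -> PT mu (fun x => (f x, g x)).
Proof.
move=> [H1 H2 [p [t [ht H3]]]] [_ H5 [p' [t' [ht' H6]]]]; split=> //.
  apply: (@pb_le _ _ _ (fun x => (esz (f x) + esz (g x)).+1)); last by pb.
  by move=> x; rewrite esz_pair.
exists (consP p p'), (fun x => t x + t' x + 90 * esz x); split; first by pb.
by move=> x; exact: Comp_cons.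
Qed.

Lemma PT_cons mu (U : encType) (f : T -> U) (g : T -> seq U) :
  PT mu f -> PT mu g -> PT mu (fun x => f x :: g x).
Proof. by move=> H1 H2; apply: PT_recode (PT_pair H1 H2). Qed.

Lemma PT_Some mu (U : encType) (f : T -> U) :
  PT mu f -> PT mu (fun x => Some (f x)).
Proof. by move=> H; apply: PT_recode (PT_pair H (PT_const (tt : unit) (PT_adq H))). Qed.

Lemma PT_if mu (U : encType) (c : T -> bool) (f g : T -> U) :
  PT mu c -> PT mu f -> PT mu g -> PT mu (fun x => if c x then f x else g x).
Proof.
move=> [H1 H2 [p [t [ht H3]]]] [_ H5 [p' [t' [ht' H6]]]] [_ H8 [p'' [t'' [ht'' H9]]]].
split=> //.
  apply: (@pb_le _ _ _ (fun x => esz (f x) + esz (g x))); last by pb.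
  by move=> x; case: ifP => _; lia.
exists (ifP' p p' p''), (fun x => t x + (t' x + t'' x) + 90 * esz x + 40 * esz (c x)).
split; first by pb.
move=> x; apply: Comp_if (H3 x) _.
have -> : isnode (enc (c x)) = c x by case: (c x).
by case: (c x); [apply: Comp_le (H6 x)|apply: Comp_le (H9 x)]; lia.
Qed.

End closure.

Section closure_basic.
Variables T : encType.
Implicit Types mu : T -> nat.

Lemma PT_car mu (U V : encType) (f : T -> U) (g : T -> V) :
  (forall x, enc (g x) = car (enc (f x))) -> PT mu f -> PT mu g.
Proof.
move=> e [H1 H2 [p [t [ht H3]]]]; split=> //.
  by apply: pb_le H2 => x; rewrite /esz e; case: (enc (f x)) => //= a b; rewrite szN; lia.
exists (Seq p carP), (fun x => (t x + 60 * esz (f x)).+1); split; first by pb.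
by move=> x; rewrite e; apply: Comp_seq (H3 x) (Comp_car _).
Qed.

Lemma PT_cdr mu (U V : encType) (f : T -> U) (g : T -> V) :
  (forall x, enc (g x) = cdr (enc (f x))) -> PT mu f -> PT mu g.
Proof.
move=> e [H1 H2 [p [t [ht H3]]]]; split=> //.
  by apply: pb_le H2 => x; rewrite /esz e; case: (enc (f x)) => //= a b; rewrite szN; lia.
exists (Seq p cdrP), (fun x => (t x + 60 * esz (f x)).+1); split; first by pb.
by move=> x; rewrite e; apply: Comp_seq (H3 x) (Comp_cdr _).
Qed.

Lemma PT_fst mu (U V : encType) (f : T -> U * V) :
  PT mu f -> PT mu (fun x => (f x).1).
Proof. exact: PT_car. Qed.

Lemma PT_snd mu (U V : encType) (f : T -> U * V) :
  PT mu f -> PT mu (fun x => (f x).2).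
Proof. exact: PT_cdr. Qed.

Lemma PT_behead mu (U : encType) (f : T -> seq U) :
  PT mu f -> PT mu (fun x => behead (f x)).
Proof. by apply: PT_cdr => x; case: (f x). Qed.

Lemma PT_nilp mu (U : encType) (f : T -> seq U) :
  PT mu f -> PT mu (fun x => nilp (f x)).
Proof.
move=> [H1 H2 [p [t [ht H3]]]]; split=> //.
  by apply: pb_le (pb_const _ 3) => x; exact: esz_bool.
exists (ifP' p (constP (enc false)) (constP (enc true))),
  (fun x => t x + (40 * esz x + 20) + 90 * esz x + 40 * esz (f x)); split; first by pb.
move=> x; apply: Comp_if (H3 x) _.
have := esz_bool true; have := esz_bool false; rewrite /esz => e1 e2.
by case: (f x) => [|a l] /=; apply: Comp_le (Comp_const _ _); lia.
Qed.

Lemma PT_head mu (U : encType) (x0 : U) (f : T -> seq U) :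
  PT mu f -> PT mu (fun x => head x0 (f x)).
Proof.
move=> H; have [H1 H2 [p [t [ht H3]]]] := H.
have [H4 _ [p' [t' [ht' H6]]]] := PT_nilp H.
split=> //.
  apply: (@pb_le _ _ _ (fun x => esz x0 + esz (f x))); last by pb.
  by move=> x; case: (f x) => [|a l]; rewrite ?esz_cons /=; lia.
exists (ifP' p' (constP (enc x0)) (Seq p carP)),
  (fun x => t' x + (40 * esz x + 4 * esz x0 + 2 + (t x + 60 * esz (f x)).+1)
     + 90 * esz x + 40 * esz (nilp (f x))); split.
  by pb; apply: pb_le (pb_const _ 3) => x; exact: esz_bool.
move=> x; apply: Comp_if (H6 x) _.
have /Comp_seq := H3 x; case E: (f x) => [|a l] /= H7.
  by apply: Comp_le (Comp_const _ _); rewrite /esz; lia.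
by apply: Comp_le (H7 _ _ _ (Comp_car _)); rewrite /esz; lia.
Qed.

Lemma PT_negb mu (c : T -> bool) : PT mu c -> PT mu (fun x => ~~ c x).
Proof.
move=> H; apply: PT_ext (PT_if H (PT_const false (PT_adq H)) (PT_const true (PT_adq H))).
by move=> x; case: (c x).
Qed.

Lemma PT_andb mu (c d : T -> bool) : PT mu c -> PT mu d -> PT mu (fun x => c x && d x).
Proof. by move=> H H'; exact: PT_if H H' (PT_const false (PT_adq H)). Qed.

Lemma PT_orb mu (c d : T -> bool) : PT mu c -> PT mu d -> PT mu (fun x => c x || d x).
Proof. by move=> H H'; exact: PT_if H (PT_const true (PT_adq H)) H'. Qed.

End closure_basic.

Lemma adq_esz (T : encType) : pb (@esz T) (@esz T).
Proof. exact: pb_mu. Qed.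

Lemma PT_app2 (T A B C : encType) (mu : T -> nat) (g : A -> B -> C) (f : T -> A) (h : T -> B) :
  PT esz (fun q : A * B => g q.1 q.2) -> PT mu f -> PT mu h ->
  PT mu (fun x => g (f x) (h x)).
Proof. by move=> Hg Hf Hh; exact: (PT_comp (PT_pair Hf Hh) Hg). Qed.

Lemma PT_app3 (T A B C D : encType) (mu : T -> nat) (g : A -> B -> C -> D)
    (f : T -> A) (h : T -> B) (k : T -> C) :
  PT esz (fun q : A * B * C => g q.1.1 q.1.2 q.2) -> PT mu f -> PT mu h -> PT mu k ->
  PT mu (fun x => g (f x) (h x) (k x)).
Proof. by move=> Hg Hf Hh Hk; exact: (PT_comp (PT_pair (PT_pair Hf Hh) Hk) Hg). Qed.

(** Gives a name to an intermediate result: it joins the argument of [g], is computed once and may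
    be used repeatedly. *)
Lemma PT_let (T A B : encType) (mu : T -> nat) (f : T -> A) (g : T -> A -> B) :
  PT mu f -> PT esz (fun q : T * A => g q.1 q.2) -> PT mu (fun x => g x (f x)).
Proof.
by move=> Hf Hg; exact: (PT_comp (PT_pair (PT_id (PT_adq Hf)) Hf) Hg).
Qed.

Section fold.
Variables T A E : encType.

(** A cheap step may still double the accumulator each time, so the caller must bound the
    accumulators of all prefixes. The loop carries the argument, the accumulator and the remaining
    list, which also serves as the test. *)
Lemma PT_foldl (mu : T -> nat) (l : T -> seq E) (a0 : T -> A) (step : T -> A -> E -> A) :
  PT mu l -> PT mu a0 -> PT esz (fun q : T * A * E => step q.1.1 q.1.2 q.2) ->
  (exists2 B, pb mu B & forall x i, i <= size (l x) ->
     esz (foldl (step x) (a0 x) (take i (l x))) <= B x) ->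
  PT mu (fun x => foldl (step x) (a0 x) (l x)).
Proof.
move=> Hl Ha [_ _ [ps [ts [hts Hs]]]] [B hB HB].
have [hx hl _] := Hl.
have [_ _ [p0 [t0 [ht0 H0]]]] := PT_pair (PT_id hx) (PT_pair Ha Hl).
have [k Hk] := hts.
split=> //.
  by apply: pb_le hB => x; have := HB x _ (leqnn _); rewrite take_size.
pose q := consP carP (consP
  (Seq (consP (consP carP (Seq cdrP carP)) (Seq (Seq cdrP cdrP) carP)) ps)
  (Seq (Seq cdrP cdrP) cdrP)).
(* The size of the whole loop state; it bounds the cost of copying and, through [pol k], the time of
   one step. *)
pose s x := (esz x + (B x + esz (l x)).+1).+1.
exists (Seq (Seq p0 (whileP (Seq cdrP cdrP) q)) (Seq cdrP carP)).
exists (fun x => ((t0 x + (size (l x)).+1 * ((121 * s x) + (2000 * s x + pol k (2 * s x)) + 200 * s x)).+1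
   + 121 * s x).+1).
have hs : pb mu s by rewrite /s; pb.
split.
  by pb; apply: pb_le hl => x; rewrite ltnW// size_esz.
move=> x; set n := size (l x).
pose acc i := foldl (step x) (a0 x) (take i (l x)).
pose X i := Node (enc x) (Node (enc (acc i)) (enc (drop i (l x)))).
have szX i : i <= n -> sz (X i) <= s x.
  move=> lei; rewrite /X /s !szN -!/(esz _).
  by have := HB x i lei; have := esz_drop i (l x); rewrite /acc; lia.
have cd2 y : Comp (Seq cdrP cdrP) y (cdr (cdr y)) (121 * sz y).
  apply: Comp_le (Comp_seq (Comp_cdr _) (Comp_cdr _)).
  have : sz (cdr y) <= sz y by case: (y) => //= *; rewrite szN; lia.
  by have := sz_gt0 y; lia.
have last_car y : Comp (Seq cdrP carP) y (car (cdr y)) (121 * sz y).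
  apply: Comp_le (Comp_seq (Comp_cdr _) (Comp_car _)).
  have : sz (cdr y) <= sz y by case: (y) => //= *; rewrite szN; lia.
  by have := sz_gt0 y; lia.
have W : Comp (whileP (Seq cdrP cdrP) q) (X 0) (X n)
   (n.+1 * ((121 * s x) + (2000 * s x + pol k (2 * s x)) + 200 * s x)).
  apply: (@Comp_while _ _ X (fun i => enc (drop i (l x)))).
  - by move=> i lei; apply: Comp_le (cd2 (X i)); have := szX i lei; lia.
  - move=> i; rewrite leq_eqVlt => /predU1P[->|lti]; first by rewrite drop_size ltnn.
    rewrite lti; have : size (drop i (l x)) > 0 by rewrite size_drop subn_gt0.
    by case: (drop i (l x)).
  - move=> i lti; have e0 : E.
      by move: lti; rewrite /n; case: (l x).
    have dE : drop i (l x) = nth e0 (l x) i :: drop i.+1 (l x) by rewrite -drop_nth.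
    set e := nth e0 (l x) i in dE.
    have aE : acc i.+1 = step x (acc i) e by rewrite /acc (take_nth e0)// foldl_rcons.
    have sX := szX i (ltnW lti).
    have c1 := Comp_car (X i); have c2 := last_car (X i); have c3 := cd2 (X i).
    have c4 : Comp (Seq (Seq cdrP cdrP) carP) (X i) (enc e) (182 * s x).
      apply: Comp_le (Comp_seq c3 _); last first.
        by rewrite /X /= dE; exact: Comp_car.
      have : sz (enc (drop i (l x))) <= sz (X i) by rewrite /X !szN; lia.
      rewrite /= dE -/(enc _); have := sz_gt0 (X i); lia.
    have c5 : Comp (Seq (Seq cdrP cdrP) cdrP) (X i) (enc (drop i.+1 (l x))) (182 * s x).
      apply: Comp_le (Comp_seq c3 _); last first.
        by rewrite /X /= dE; exact: Comp_cdr.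
      have : sz (enc (drop i (l x))) <= sz (X i) by rewrite /X !szN; lia.
      rewrite /= dE -/(enc _); have := sz_gt0 (X i); lia.
    have c6 := Comp_cons (Comp_cons c1 c2) c4.
    have c7 := Comp_seq c6 (Hs (x, acc i, e)).
    have c8 := Comp_cons c1 (Comp_cons c7 c5).
    rewrite /X aE; apply: Comp_le c8; rewrite -/(X i).
    have := Hk (x, acc i, e); rewrite !esz_pair.
    have : pol k (esz x + esz (acc i)).+1 <= pol k (2 * s x) -> True by [].
    move=> _ Hke.
    have le2 : pol k ((esz x + esz (acc i)).+1 + esz e).+1 <= pol k (2 * s x).
      apply: leq_pol => //; have := HB x i (ltnW lti).
      have : esz e < esz (l x) by apply: esz_nth.
      by rewrite /s /acc; lia.
    by have := sz_gt0 (X i); lia.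
  - move=> i lei; split; first exact: szX.
    by apply: leq_trans (szX i lei); rewrite /X !szN; lia.
have -> : enc (foldl (step x) (a0 x) (l x)) = car (cdr (X n)).
  by rewrite /X /acc /= take_size.
apply: Comp_le (Comp_seq (Comp_seq (H0 x) _) (last_car (X n))); last first.
  by have := W; rewrite /X /acc take0 drop0; exact.
by have := szX n (leqnn _); lia.
Qed.

End fold.

Section lists.
Variables T E : encType.
Implicit Types mu : T -> nat.

(** A [foldl] delivers lists in reverse, so reversing onto an accumulator is the primitive from
    which [rev] and [cat] are derived. *)
Lemma foldl_consE (s a : seq E) : foldl (fun acc e => e :: acc) a s = rev s ++ a.
Proof. by elim: s a => //= x s IHs a; rewrite IHs rev_cons cat_rcons. Qed.

Lemma PT_catrev mu (f g : T -> seq E) :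
  PT mu f -> PT mu g -> PT mu (fun x => rev (f x) ++ g x).
Proof.
move=> Hf Hg; have [_ hf _] := Hf; have [_ hg _] := Hg.
apply: (@PT_ext _ mu _ (fun x => foldl (fun acc e => e :: acc) (g x) (f x))).
  by move=> x; rewrite foldl_consE.
apply: (PT_foldl (step := fun _ acc e => e :: acc)) => //.
  exact: PT_cons (PT_snd (PT_id (adq_esz _))) (PT_snd (PT_fst (PT_id (adq_esz _)))).
exists (fun x => esz (f x) + esz (g x)); first by pb.
move=> x i _; rewrite foldl_consE; have := esz_cat (rev (take i (f x))) (g x).
by rewrite esz_rev; have := esz_take i (f x); lia.
Qed.

Lemma PT_rev mu (f : T -> seq E) : PT mu f -> PT mu (fun x => rev (f x)).
Proof.
move=> Hf; apply: PT_ext (PT_catrev Hf (PT_const [::] (PT_adq Hf))).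
by move=> x; rewrite cats0.
Qed.

Lemma PT_cat mu (f g : T -> seq E) :
  PT mu f -> PT mu g -> PT mu (fun x => f x ++ g x).
Proof.
by move=> Hf Hg; apply: PT_ext (PT_catrev (PT_rev Hf) Hg) => x; rewrite revK.
Qed.

End lists.

Section list_predicates.
Variables T E : encType.
Implicit Types mu : T -> nat.

Lemma PT_has mu (p : T -> E -> bool) (f : T -> seq E) :
  PT mu f -> PT esz (fun q : T * E => p q.1 q.2) -> PT mu (fun x => has (p x) (f x)).
Proof.
move=> Hf Hp.
apply: (@PT_ext _ mu _ (fun x => foldl (fun acc e => if acc then true else p x e) false (f x))).
  move=> x; have H s b : foldl (fun acc e => if acc then true else p x e) b s = b || has (p x) s.
    by elim: s b => [|e s IHs] [] //=; rewrite IHs.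
  by rewrite H.
apply: (PT_foldl (step := fun x acc e => if acc then true else p x e)) => //.
- exact: PT_const (PT_adq Hf).
- apply: PT_if (PT_snd (PT_fst (PT_id (adq_esz _)))) (PT_const _ (adq_esz _)) _.
  exact: (PT_comp (PT_pair (PT_fst (PT_fst (PT_id (adq_esz _)))) (PT_snd (PT_id (adq_esz _)))) Hp).
- by exists (fun=> 3) => [|x i _]; [exact: pb_const|exact: esz_bool].
Qed.

Lemma PT_all mu (p : T -> E -> bool) (f : T -> seq E) :
  PT mu f -> PT esz (fun q : T * E => p q.1 q.2) -> PT mu (fun x => all (p x) (f x)).
Proof.
move=> Hf Hp; apply: (@PT_ext _ mu _ (fun x => ~~ has (fun e => ~~ p x e) (f x))).
  by move=> x; rewrite has_predC negbK.
by apply: PT_negb; apply: (PT_has (p := fun x e => ~~ p x e)) => //; exact: PT_negb.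
Qed.

Lemma PT_filter mu (p : T -> E -> bool) (f : T -> seq E) :
  PT mu f -> PT esz (fun q : T * E => p q.1 q.2) -> PT mu (fun x => seq.filter (p x) (f x)).
Proof.
move=> Hf Hp; have [_ hf _] := Hf.
have FE x (s a : seq E) : foldl (fun acc e => if p x e then e :: acc else acc) a s
    = rev (seq.filter (p x) s) ++ a.
  by elim: s a => //= e s IHs a; rewrite IHs; case: ifP; rewrite // rev_cons cat_rcons.
apply: (@PT_ext _ mu _ (fun x => rev (foldl (fun acc e => if p x e then e :: acc else acc) [::] (f x)))).
  by move=> x; rewrite FE cats0 revK.
apply: PT_rev; apply: (PT_foldl (step := fun x acc e => if p x e then e :: acc else acc)) => //.
- exact: PT_const (PT_adq Hf).
- have Ha : PT esz (fun q : T * seq E * E => q.1.2) by exact: PT_snd (PT_fst (PT_id (adq_esz _))).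
  have He : PT esz (fun q : T * seq E * E => q.2) by exact: PT_snd (PT_id (adq_esz _)).
  apply: PT_if (PT_cons He Ha) Ha.
  exact: (PT_comp (PT_pair (PT_fst (PT_fst (PT_id (adq_esz _)))) He) Hp).
- exists (fun x => esz (f x)) => // x i _; rewrite FE cats0 esz_rev.
  apply: leq_trans (esz_take i (f x)).
  by elim: (take i (f x)) => //= e s IHs; case: ifP => _; rewrite !esz_cons; lia.
Qed.

Lemma PT_flatten mu (f : T -> seq (seq E)) : PT mu f -> PT mu (fun x => flatten (f x)).
Proof.
move=> Hf; have [_ hf _] := Hf.
have FE (s : seq (seq E)) a : foldl (fun acc e => rev e ++ acc) a s = rev (flatten s) ++ a.
  by elim: s a => //= e s IHs a; rewrite IHs rev_cat catA.
apply: (@PT_ext _ mu _ (fun x => rev (foldl (fun acc e => rev e ++ acc) [::] (f x)))).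
  by move=> x; rewrite FE cats0 revK.
apply: PT_rev; apply: (PT_foldl (step := fun _ acc e => rev e ++ acc)) => //.
- exact: PT_const (PT_adq Hf).
- exact: PT_catrev (PT_snd (PT_id (adq_esz _))) (PT_snd (PT_fst (PT_id (adq_esz _)))).
- exists (fun x => esz (f x)) => // x i _; rewrite FE cats0 esz_rev.
  apply: leq_trans (esz_take i (f x)).
  elim: (take i (f x)) => //= e s IHs; rewrite esz_cons.
  by have := esz_cat e (flatten s); lia.
Qed.

End list_predicates.

Section maps.
Variables T E F : encType.

Lemma PT_map (mu : T -> nat) (g : T -> E -> F) (f : T -> seq E) :
  PT mu f -> PT esz (fun q : T * E => g q.1 q.2) -> PT mu (fun x => map (g x) (f x)).
Proof.
move=> Hf Hg; have [hx hf _] := Hf; have [_ [k Hk] _] := Hg.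
have FE x (s : seq E) a : foldl (fun acc e => g x e :: acc) a s = rev (map (g x) s) ++ a.
  by elim: s a => //= e s IHs a; rewrite IHs rev_cons cat_rcons.
apply: (@PT_ext _ mu _ (fun x => rev (foldl (fun acc e => g x e :: acc) [::] (f x)))).
  by move=> x; rewrite FE cats0 revK.
apply: PT_rev; apply: (PT_foldl (step := fun x acc e => g x e :: acc)) => //.
- exact: PT_const (PT_adq Hf).
- apply: PT_cons (PT_snd (PT_fst (PT_id (adq_esz _)))).
  exact: (PT_comp (PT_pair (PT_fst (PT_fst (PT_id (adq_esz _)))) (PT_snd (PT_id (adq_esz _)))) Hg).
- exists (fun x => 1 + esz (f x) * (pol k (esz x + esz (f x)).+1).+1); first by pb.
  move=> x i lei; rewrite FE cats0 esz_rev.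
  apply: (@leq_trans (1 + size (take i (f x)) * (pol k (esz x + esz (f x)).+1).+1)); last first.
    by rewrite leq_add2l; apply: leq_mul; rewrite // size_take_min geq_min (ltnW (size_esz _)) orbT.
  apply: esz_map => j x0 ltj; apply: leq_trans (Hk (x, _)) _; apply: leq_pol => //.
  rewrite esz_pair ltnS leq_add2l; apply: leq_trans (esz_take i (f x)).
  exact: ltnW (esz_nth _ _).
Qed.

End maps.

(** Extension point of [pt], redefined whenever further closure lemmas become available. *)
Ltac pt_hook := fail.
Ltac pt1 := cbv beta; first [ exact: adq_esz | assumption
  | exact (PT_snd (PT_id (adq_esz _))) | exact (PT_fst (PT_id (adq_esz _)))
  | match goal with H : PT ?mu _ |- pb ?mu esz => exact (PT_adq H) end
  | simple apply PT_const | simple apply PT_id | simple apply PT_fst | simple apply PT_snd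
  | pt_hook
  | simple apply PT_pair | simple apply PT_cons | simple apply PT_Some
  | simple apply PT_negb | simple apply PT_andb | simple apply PT_orb
  | simple apply PT_behead | simple apply PT_nilp | simple apply PT_head
  | simple apply PT_cat | simple apply PT_rev | simple apply PT_flatten
  | simple apply PT_map | simple apply PT_filter | simple apply PT_has | simple apply PT_all
  | simple apply PT_if ].
Ltac pt := repeat pt1.

(** * Binary arithmetic *)

Ltac elia := cbn [enc_sort bool_encType option_encType prod_encType seq_encType] in *; lia.

Definition bval (s : seq bool) : nat := foldr (fun (b : bool) n => b + n.*2) 0 s.

Lemma bitsS n : 0 < n -> bits n = odd n :: bits n./2.
Proof.
move=> n0; rewrite /bits up_log2S// /mkseq /= expn0 divn1; congr cons.
rewrite -[in LHS](addn0 1) iotaDl -map_comp; apply: eq_map => i /=.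
by rewrite add1n expnS divnMA divn2.
Qed.

Lemma bval_bits n : bval (bits n) = n.
Proof.
elim/ltn_ind: n => -[_|n IHn] //; rewrite bitsS// -[RHS]odd_double_half.
by congr (_ + _.*2); apply: IHn; rewrite -divn2; lia.
Qed.

(** Encodings of numbers have no leading zeros; this is the rule by which a scan from the most
    significant end removes them. *)
Lemma bits_bval_cons b s : bits (bval (b :: s)) =
  if nilp (bits (bval s)) && ~~ b then [::] else b :: bits (bval s).
Proof.
have bits_eq0 n : nilp (bits n) = (n == 0).
  by case: n => // n; rewrite bitsS.
rewrite bits_eq0 /=; case: b => /=; rewrite ?andbF ?andbT.
  by rewrite add1n bitsS//= odd_double uphalf_double.
rewrite add0n; have [->|n0] := posnP; first by [].
by rewrite bitsS ?double_gt0//= odd_double doubleK; case: posnP n0 => // ->.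
Qed.

Definition blen n := size (bits n).

Lemma blenE n : blen n = up_log 2 n.+1. Proof. exact: size_mkseq. Qed.
Lemma blen_lt n : n < 2 ^ blen n. Proof. by rewrite blenE up_logP. Qed.
Lemma blen_min n k : n < 2 ^ k -> blen n <= k.
Proof. by rewrite blenE => ?; apply: up_log_min. Qed.
Lemma leq_blen m n : m <= n -> blen m <= blen n.
Proof. by move=> le; rewrite !blenE leq_up_log. Qed.
Lemma blenn n : blen n <= n. Proof. exact: blen_min (ltn_expl _ _). Qed.
Lemma blenD m n : blen (m + n) <= (maxn (blen m) (blen n)).+1.
Proof.
apply: blen_min; rewrite expnS mul2n -addnn; set k := maxn _ _.
have : m < 2 ^ k by apply: leq_trans (blen_lt m) _; rewrite leq_exp2l// leq_maxl.
have : n < 2 ^ k by apply: leq_trans (blen_lt n) _; rewrite leq_exp2l// leq_maxr.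
lia.
Qed.
Lemma blenM m n : blen (m * n) <= blen m + blen n.
Proof.
apply: blen_min; rewrite expnD; have := blen_lt m; have := blen_lt n.
by set a := 2 ^ _; set b := 2 ^ _; nia.
Qed.

Canonical nat_encType := EncType (fun n : nat => enc (bits n)).

Ltac elia ::= cbn [enc_sort bool_encType option_encType prod_encType seq_encType nat_encType] in *; lia.

Lemma esz_bits (s : seq bool) : esz s <= 1 + 4 * size s.
Proof. by elim: s => // b s IHs; rewrite esz_cons; have := esz_bool b; rewrite /=; lia. Qed.

Lemma esz_nat (n : nat) : esz n <= 1 + 4 * blen n. Proof. exact: esz_bits. Qed.

Lemma blen_esz (n : nat) : blen n < esz n. Proof. exact: (size_esz (bits n)). Qed.

Section bits_pt.
Variable T : encType.
Implicit Types mu : T -> nat.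

Lemma PT_bits mu (f : T -> nat) : PT mu f -> PT mu (fun x => bits (f x)).
Proof. exact: PT_recode. Qed.

Lemma PT_bval mu (f : T -> seq bool) : PT mu f -> PT mu (fun x => bval (f x)).
Proof.
move=> Hf; have [_ hf _] := Hf.
have FE s : foldl (fun acc b => if nilp acc && ~~ b then [::] else b :: acc) [::] (rev s)
    = bits (bval s).
  by rewrite foldl_rev; elim: s => //= b s ->; rewrite -bits_bval_cons.
apply: (@PT_recode _ _ _ _ (fun x => foldl (fun acc b => if nilp acc && ~~ b then [::] else b :: acc) [::] (rev (f x)))).
  by move=> x; rewrite FE.
apply: (PT_foldl (step := fun _ acc b => if nilp acc && ~~ b then [::] else b :: acc)).
- exact: PT_rev.
- exact: PT_const (PT_adq Hf).
- by pt.
exists (fun x => 1 + 4 * esz (f x)); first by pb.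
move=> x i _; apply: leq_trans (esz_bits _) _; rewrite leq_add2l leq_mul2l /=.
have sF (s a : seq bool) : size (foldl (fun acc b => if nilp acc && ~~ b then [::] else b :: acc) a s) <= size s + size a.
  elim: s a => //= b s IHs a; apply: leq_trans (IHs _) _.
  by case: ifP => _ /=; lia.
apply: leq_trans (sF _ _) _; rewrite addn0 size_take_min.
by have := size_esz (f x); rewrite size_rev; elia.
Qed.

End bits_pt.

Definition xor3 (x y c : bool) := if x then (if y then c else ~~ c) else (if y then ~~ c else c).
Definition maj (x y c : bool) := if x then y || c else y && c.
Definition bor (x y c : bool) := if x then y && c else y || c.

(** One scan serves addition and subtraction: the output digit is the parity of three bits in both,
    and only [cf] differs, [maj] for the carry and [bor] for the borrow. *)
Definition dig_step (cf : bool -> bool -> bool -> bool)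
    (s : seq bool * seq bool * bool * seq bool) (_ : bool) :=
  (behead s.1.1.1, behead s.1.1.2,
   cf (head false s.1.1.1) (head false s.1.1.2) s.1.2,
   xor3 (head false s.1.1.1) (head false s.1.1.2) s.1.2 :: s.2).

(** The list [a ++ b] acts as a clock that is long enough to exhaust both numbers. *)
Definition dig_fold cf (a b : seq bool) :=
  foldl (dig_step cf) (a, b, false, [::]) (a ++ b).

Lemma dig_fold_size cf s a b c o : let r := foldl (dig_step cf) (a, b, c, o) s in
  [/\ r.1.1.1 = drop (size s) a, r.1.1.2 = drop (size s) b & size r.2 = size s + size o].
Proof.
elim: s a b c o => [|d s IHs] a b c o; first by rewrite /= !drop0.
have [] := IHs (behead a) (behead b) (cf (head false a) (head false b) c)
  (xor3 (head false a) (head false b) c :: o).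
have db (u : seq bool) : drop (size s) (behead u) = drop (size s).+1 u by case: u.
by rewrite !db /= addnS; split.
Qed.

Lemma bval_behead a : bval a = head false a + (bval (behead a)).*2.
Proof. by case: a. Qed.

Lemma bval_rcons s b : bval (rcons s b) = bval s + b * 2 ^ size s.
Proof.
elim: s => [|a s IHs] /=; first by rewrite expn0 double0 addn0 muln1 add0n.
by rewrite IHs expnS; lia.
Qed.

Lemma bval_lt s : bval s < 2 ^ size s.
Proof. by elim: s => //= b s IHs; rewrite expnS; case: b; lia. Qed.

Lemma dig_fold_add s a b c o : let r := foldl (dig_step maj) (a, b, c, o) s in
  bval (rev r.2) + 2 ^ size r.2 * (bval r.1.1.1 + bval r.1.1.2 + r.1.2) =
  bval (rev o) + 2 ^ size o * (bval a + bval b + c).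
Proof.
elim: s a b c o => [|d s IHs] a b c o; first by rewrite /=; lia.
rewrite [foldl _ _ _]/=.
have := IHs (behead a) (behead b) (maj (head false a) (head false b) c)
  (xor3 (head false a) (head false b) c :: o).
set r := foldl _ _ _; rewrite /= rev_cons bval_rcons size_rev (bval_behead a) (bval_behead b).
rewrite expnS; set X := 2 ^ size r.2; set Y := 2 ^ size o.
by case: (head false a); case: (head false b); case: (c) => /=; lia.
Qed.

(** Negative terms are moved across the equation so that the invariant of subtraction can be stated
    in [nat]. *)
Lemma dig_fold_sub s a b c o : let r := foldl (dig_step bor) (a, b, c, o) s in
  bval (rev o) + 2 ^ size o * bval a + 2 ^ size r.2 * (bval r.1.1.2 + r.1.2) =
  bval (rev r.2) + 2 ^ size r.2 * bval r.1.1.1 + 2 ^ size o * (bval b + c).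
Proof.
elim: s a b c o => [|d s IHs] a b c o; first by rewrite /=; lia.
rewrite [foldl _ _ _]/=.
have := IHs (behead a) (behead b) (bor (head false a) (head false b) c)
  (xor3 (head false a) (head false b) c :: o).
set r := foldl _ _ _; rewrite /= rev_cons bval_rcons size_rev (bval_behead a) (bval_behead b).
rewrite expnS; set X := 2 ^ size r.2; set Y := 2 ^ size o.
by case: (head false a); case: (head false b); case: (c) => /=; lia.
Qed.

Definition add_bits a b := let r := dig_fold maj a b in rev (r.1.2 :: r.2).

Lemma bval_add_bits a b : bval (add_bits a b) = bval a + bval b.
Proof.
rewrite /add_bits /dig_fold; set r := foldl _ _ _.
have [e1 e2 _] := dig_fold_size maj (a ++ b) a b false [::].
have := dig_fold_add (a ++ b) a b false [::]; rewrite -/r /= !e1 !e2.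
rewrite !drop_oversize ?size_cat ?leq_addr ?leq_addl//= mul1n !add0n addn0.
by rewrite rev_cons bval_rcons size_rev mulnC.
Qed.

Definition sub_bits a b := if (dig_fold bor a b).1.2 then [::] else rev (dig_fold bor a b).2.

Lemma dig_fold_borP a b : let r := dig_fold bor a b in
  r.1.2 = (bval a < bval b) /\ bval (sub_bits a b) = bval a - bval b.
Proof.
rewrite /sub_bits /dig_fold; set r := foldl _ _ _ => /=.
have [e1 e2 _] := dig_fold_size bor (a ++ b) a b false [::].
have := dig_fold_sub (a ++ b) a b false [::]; rewrite -/r /= !e1 !e2.
rewrite !drop_oversize ?size_cat ?leq_addr ?leq_addl//=.
have := bval_lt (rev r.2); rewrite size_rev.
case: (r.1.2) => /=; set X := 2 ^ _; set V := bval _ => h1 h2; split; try lia.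
Qed.

Ltac pt_hook ::= first [simple apply PT_bits | simple apply PT_bval].

Lemma PT_dig_fold cf : PT esz (fun q : bool * bool * bool => cf q.1.1 q.1.2 q.2) ->
  PT esz (fun q : seq bool * seq bool => dig_fold cf q.1 q.2).
Proof.
move=> Hc; rewrite /dig_fold.
apply: (PT_foldl (step := fun _ => dig_step cf)
   (a0 := fun q : seq bool * seq bool => (q.1, q.2, false, [::])) (l := fun q => q.1 ++ q.2)).
- by pt.
- by pt.
- rewrite /dig_step /xor3; pt; apply: (PT_app3 (g := cf)) => //; by pt.
exists (fun q => 40 * esz q); first by pb.
move=> [a b] i lei /=; set s := take i _; set r := foldl _ _ _.
have [e1 e2 e3] := dig_fold_size cf s a b false [::].
have -> : esz r = ((esz r.1.1.1 + esz r.1.1.2).+1 + esz r.1.2).+1 + esz r.2 + 1.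
  by case: (r) => -[[u v] w] z; rewrite !esz_pair addn1.
rewrite e1 e2; have := esz_drop (size s) a; have := esz_drop (size s) b.
have := esz_bool r.1.2; have := esz_bits r.2; rewrite e3 addn0 /s size_take_min.
have ha : @size bool a < esz a := size_esz a; have hb : @size bool b < esz b := size_esz b.
rewrite size_cat esz_pair; elia.
Qed.

Section nat_pt.
Variable T : encType.
Implicit Types (mu : T -> nat) (f g : T -> nat).

Lemma PT_addn mu f g : PT mu f -> PT mu g -> PT mu (fun x => f x + g x).
Proof.
move=> Hf Hg; apply: (@PT_ext _ _ _ (fun x => bval (add_bits (bits (f x)) (bits (g x))))).
  by move=> x; rewrite bval_add_bits !bval_bits.
apply: PT_bval; apply: (PT_app2 (g := add_bits)); [|exact: PT_bits|exact: PT_bits].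
have H := PT_dig_fold (cf := maj); rewrite /add_bits /maj in H *; pt.
  by apply: H; pt.
by apply: H; pt.
Qed.

Lemma PT_leq mu f g : PT mu f -> PT mu g -> PT mu (fun x => f x <= g x).
Proof.
move=> Hf Hg; apply: (@PT_ext _ _ _ (fun x => ~~ (dig_fold bor (bits (g x)) (bits (f x))).1.2)).
  by move=> x; have [-> _] := dig_fold_borP (bits (g x)) (bits (f x)); rewrite !bval_bits -leqNgt.
apply: PT_negb; apply: PT_snd; apply: PT_fst.
apply: (PT_app2 (g := dig_fold bor)); [|exact: PT_bits|exact: PT_bits].
by apply: PT_dig_fold; rewrite /bor; pt.
Qed.

Lemma PT_subn mu f g : PT mu f -> PT mu g -> PT mu (fun x => f x - g x).
Proof.
move=> Hf Hg; apply: (@PT_ext _ _ _ (fun x => bval (sub_bits (bits (f x)) (bits (g x))))).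
  by move=> x; have [_ ->] := dig_fold_borP (bits (f x)) (bits (g x)); rewrite !bval_bits.
apply: PT_bval; apply: (PT_app2 (g := sub_bits)); [|exact: PT_bits|exact: PT_bits].
have H := PT_dig_fold (cf := bor); rewrite /sub_bits; pt; apply: H; rewrite /bor; pt.
Qed.

Lemma PT_succ mu f : PT mu f -> PT mu (fun x => (f x).+1).
Proof.
move=> Hf; apply: (@PT_ext _ _ _ (fun x => f x + 1)); first by move=> x; rewrite addn1.
exact: PT_addn (PT_const 1 (PT_adq Hf)).
Qed.

Lemma PT_eqn mu f g : PT mu f -> PT mu g -> PT mu (fun x => f x == g x).
Proof.
move=> Hf Hg; apply: (@PT_ext _ _ _ (fun x => (f x <= g x) && (g x <= f x))).
  by move=> x; rewrite eqn_leq.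
by apply: PT_andb; apply: PT_leq.
Qed.

Lemma PT_odd mu f : PT mu f -> PT mu (fun x => odd (f x)).
Proof.
move=> Hf; apply: (@PT_ext _ _ _ (fun x => head false (bits (f x)))).
  by move=> x; case: (posnP (f x)) => [->|/bitsS ->].
by apply: PT_head; exact: PT_bits.
Qed.

Lemma PT_half mu f : PT mu f -> PT mu (fun x => (f x)./2).
Proof.
move=> Hf; apply: (@PT_ext _ _ _ (fun x => bval (behead (bits (f x))))).
  by move=> x; case: (posnP (f x)) => [->|/bitsS ->] //=; rewrite bval_bits.
by apply: PT_bval; apply: PT_behead; exact: PT_bits.
Qed.

End nat_pt.

Ltac pt_hook ::= first [simple apply PT_bits | simple apply PT_bval
  | simple apply PT_addn | simple apply PT_succ | simple apply PT_leq | simple apply PT_subn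
  | simple apply PT_eqn | simple apply PT_odd | simple apply PT_half].

(** Horner's rule from the most significant digit: multiplication by repeated doubling. *)
Lemma foldl_bits b n (s : seq bool) :
  foldl (fun (acc : nat) (d : bool) => acc + acc + (if d then b else 0)) n s =
  n * 2 ^ size s + bval (rev s) * b.
Proof.
elim: s n => [|d s IHs] n /=; first by rewrite muln1 mul0n addn0.
rewrite IHs rev_cons bval_rcons size_rev expnS; case: d; lia.
Qed.

Lemma bval_drop i s : bval (drop i s) <= bval s.
Proof.
elim: s i => [|b s IHs] [|i] //=; have := IHs i; rewrite -addnn; lia.
Qed.

Lemma PT_muln (T : encType) (mu : T -> nat) (f g : T -> nat) :
  PT mu f -> PT mu g -> PT mu (fun x => f x * g x).
Proof.
apply: PT_app2.
apply: (@PT_ext _ _ _ (fun q : nat * nat => foldl (fun acc d => acc + acc + (if d then q.2 else 0)) 0 (rev (bits q.1)))).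
  by move=> [a b] /=; rewrite foldl_bits mul0n revK bval_bits.
apply: (PT_foldl (step := fun (q : nat * nat) acc (d : bool) => acc + acc + (if d then q.2 else 0))).
- by pt.
- by pt.
- by pt.
exists (fun q => 1 + 4 * esz q); first by pb.
move=> [a b] i _ /=; apply: leq_trans (esz_nat _) _; rewrite leq_add2l leq_mul2l /=.
rewrite foldl_bits mul0n -/(blen _); apply: (@leq_trans (blen (a * b))).
  apply: leq_blen; rewrite leq_mul2r; apply/orP; right.
  by rewrite -[X in _ <= X](bval_bits a) take_rev revK bval_drop.
by apply: leq_trans (blenM _ _) _; have := blen_esz a; have := blen_esz b; rewrite esz_pair; lia.
Qed.

(** Schoolbook division: bring down one binary digit and subtract the divisor if it fits. *)
Definition div_step (d : nat) (s : nat * nat) (b : bool) :=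
  let r := s.2 + s.2 + (if b then 1 else 0) in
  if d <= r then (s.1 + s.1 + 1, r - d) else (s.1 + s.1, r).

Lemma foldl_div d s : 0 < d -> let r := foldl (div_step d) (0, 0) s in
  r.1 * d + r.2 = bval (rev s) /\ r.2 < d.
Proof.
move=> d0; elim/last_ind: s => //= s b [IH1 IH2].
rewrite foldl_rcons rev_rcons /= -IH1; set r := foldl _ _ _ in IH1 IH2 *.
rewrite /div_step; case: ifP => le /=; move: le; case: b; split; nia.
Qed.

Lemma foldl_div_step (d : nat) (s : seq bool) : 0 < d ->
  (foldl (div_step d) (0, 0) s).1 = bval (rev s) %/ d.
Proof.
move=> d0; have [<- h2] := foldl_div s d0.
by rewrite divnMDl// divn_small// addn0.
Qed.

Lemma PT_divn (T : encType) (mu : T -> nat) (f g : T -> nat) :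
  PT mu f -> PT mu g -> PT mu (fun x => f x %/ g x).
Proof.
apply: PT_app2.
apply: (@PT_ext _ _ _ (fun q : nat * nat => (foldl (fun s b =>
   if 0 < q.2 then div_step q.2 s b else (0, 0)) (0, 0) (rev (bits q.1))).1)).
  move=> [a b] /=; case: posnP => [->|b0].
    by rewrite divn0; elim: (rev _).
  by rewrite foldl_div_step// revK bval_bits.
apply: PT_fst; apply: (PT_foldl (step := fun (q : nat * nat) s (b : bool) =>
   if 0 < q.2 then div_step q.2 s b else (0, 0))).
- by pt.
- by pt.
- by rewrite /div_step; pt.
exists (fun q => 3 + 8 * esz q); first by pb.
move=> [a b] i _ /=; case: posnP => [_|b0].
  by set s := take _ _; have -> : foldl (fun _ _ => (0, 0)) (0, 0) s = (0, 0) by elim: (s).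
have [h1 h2] := foldl_div (take i (rev (bits a))) b0.
move: h1 h2; set r := foldl _ _ _; rewrite take_rev revK => h1 h2.
have : bval (drop (size (bits a) - i) (bits a)) <= a.
  by rewrite -[X in _ <= X](bval_bits a) bval_drop.
rewrite -h1 => h3; case: (r) h1 h2 h3 => u v /= h1 h2 h3; rewrite !esz_pair.
have hu : u <= a by nia. have hv : v <= a by lia.
have := esz_nat u; have := esz_nat v; have := leq_blen hu; have := leq_blen hv.
by have := blen_esz a; lia.
Qed.

Canonical int_encType := EncType (fun z : int => enc ((z < 0)%R, `|z|%N)).

Ltac elia ::= cbn [enc_sort bool_encType option_encType prod_encType seq_encType nat_encType
  int_encType] in *; lia.

Definition zmk (s : bool) (n : nat) : int := if s then (- n%:Z)%R else n%:Z.

Lemma zmk_abs z : zmk (z < 0)%R `|z|%N = z.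
Proof. by case: z => n; rewrite /zmk //= NegzE. Qed.

Lemma zmk_lt0 s n : (zmk s n < 0)%R = s && (0 < n).
Proof. by rewrite /zmk; case: s; lia. Qed.

Lemma absz_zmk s n : `|zmk s n|%N = n. Proof. by rewrite /zmk; case: s; lia. Qed.

Ltac pt_hook ::= first [simple apply PT_bits | simple apply PT_bval
  | simple apply PT_addn | simple apply PT_succ | simple apply PT_leq | simple apply PT_subn
  | simple apply PT_eqn | simple apply PT_odd | simple apply PT_half
  | simple apply PT_muln | simple apply PT_divn].

Section int_pt.
Variable T : encType.
Implicit Types (mu : T -> nat) (f g : T -> int).

Lemma PT_zmk mu (s : T -> bool) (n : T -> nat) :
  PT mu s -> PT mu n -> PT mu (fun x => zmk (s x) (n x)).
Proof.
(* Zero must carry the sign [false], as in the canonical encoding. *)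
move=> Hs Hn; apply: (@PT_recode _ _ _ _ (fun x => (s x && (0 < n x), n x))); last by pt.
by move=> x; rewrite [RHS]/enc /= zmk_lt0 absz_zmk.
Qed.

Lemma PT_absz mu f : PT mu f -> PT mu (fun x => `|f x|%N).
Proof. exact: PT_cdr. Qed.

Lemma PT_ltz0 mu f : PT mu f -> PT mu (fun x => (f x < 0)%R).
Proof. exact: PT_car. Qed.

Lemma PT_Posz mu (f : T -> nat) : PT mu f -> PT mu (fun x => (f x)%:Z).
Proof. by move=> Hf; exact: (PT_zmk (PT_const false (PT_adq Hf)) Hf). Qed.

Lemma PT_addz mu f g : PT mu f -> PT mu g -> PT mu (fun x => (f x + g x)%R).
Proof.
move=> Hf Hg; apply: (@PT_ext _ _ _ (fun x =>
  if (if (f x < 0)%R then (g x < 0)%R else ~~ (g x < 0)%R)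
  then zmk (f x < 0)%R (`|f x| + `|g x|)%N
  else if `|g x| <= `|f x| then zmk (f x < 0)%R (`|f x| - `|g x|)%N
  else zmk (g x < 0)%R (`|g x| - `|f x|)%N)).
  by move=> x; rewrite /zmk; case: (f x) => a; case: (g x) => b /=; do ?case: ifP; lia.
have ha := PT_absz Hf; have hb := PT_absz Hg; have hc := PT_ltz0 Hf; have hd := PT_ltz0 Hg.
by repeat first [assumption | simple apply PT_zmk | simple apply PT_addn | simple apply PT_subn
  | simple apply PT_leq | simple apply PT_negb | simple apply PT_if].
Qed.

Lemma PT_mulz mu f g : PT mu f -> PT mu g -> PT mu (fun x => (f x * g x)%R).
Proof.
move=> Hf Hg; apply: (@PT_ext _ _ _ (fun x =>
  zmk (if (f x < 0)%R then ~~ (g x < 0)%R else (g x < 0)%R) (`|f x| * `|g x|)%N)).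
  by move=> x; rewrite /zmk; case: (f x) => a; case: (g x) => b /=; lia.
have ha := PT_absz Hf; have hb := PT_absz Hg; have hc := PT_ltz0 Hf; have hd := PT_ltz0 Hg.
by repeat first [assumption | simple apply PT_zmk | simple apply PT_muln
  | simple apply PT_negb | simple apply PT_if].
Qed.

Lemma PT_oppz mu f : PT mu f -> PT mu (fun x => (- f x)%R).
Proof.
move=> Hf; apply: (@PT_ext _ _ _ (fun x => zmk (~~ (f x < 0)%R) `|f x|%N)).
  by move=> x; rewrite /zmk; case: (f x) => a /=; lia.
have ha := PT_absz Hf; have hc := PT_ltz0 Hf.
by apply: PT_zmk => //; exact: PT_negb.
Qed.

(** Correctness concerns only exact quotients by positive numbers, which [zquoK] identifies. *)
Definition zquo (a b : int) : int := zmk (a < 0)%R (`|a| %/ `|b|)%N.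

Lemma zquoK (a b z : int) : (0 < b)%R -> (b * z = a)%R -> zquo a b = z.
Proof.
move=> b0 <-; rewrite /zquo abszM mulKn; last by rewrite absz_gt0 gt_eqF.
by rewrite pmulr_rlt0// zmk_abs.
Qed.

Lemma PT_zquo mu f g : PT mu f -> PT mu g -> PT mu (fun x => zquo (f x) (g x)).
Proof.
move=> Hf Hg; apply: PT_zmk (PT_ltz0 Hf) _.
by apply: PT_divn; exact: PT_absz.
Qed.

Lemma PT_eqz mu f g : PT mu f -> PT mu g -> PT mu (fun x => f x == g x).
Proof.
move=> Hf Hg; apply: (@PT_ext _ _ _ (fun x => `|(f x + - g x)%R|%N == 0)).
  by move=> x; rewrite absz_eq0 subr_eq0.
apply: PT_eqn; last exact: PT_const (PT_adq Hf).
by apply: PT_absz; apply: PT_addz => //; exact: PT_oppz.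
Qed.

End int_pt.

Lemma esz_int (z : int) : esz z <= 5 + 4 * blen `|z|.
Proof.
have -> : esz z = (esz (z < 0)%R + esz `|z|).+1 by exact: szN.
by have := esz_bool (z < 0)%R; have := esz_nat `|z|; lia.
Qed.

Lemma blen_esz_int (z : int) : blen `|z| < esz z.
Proof.
have -> : esz z = (esz (z < 0)%R + esz `|z|).+1 by exact: szN.
by have := blen_esz `|z|; lia.
Qed.

Lemma blen_sumz (s : seq int) : blen `|(\sum_(z <- s) z)%R| <= esz s.
Proof.
elim: s => [|z s IHs]; first by rewrite big_nil.
rewrite big_cons esz_cons; set S := (\sum_(z <- s) z)%R in IHs *.
have /leq_blen/leq_trans -> // : `|(z + S)%R| <= `|z| + `|S| by lia.
by apply: leq_trans (blenD _ _) _; have := blen_esz_int z; lia.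
Qed.

Section lists_pt.
Variable T : encType.
Implicit Types mu : T -> nat.

Lemma PT_sumz mu (f : T -> seq int) : PT mu f -> PT mu (fun x => (\sum_(z <- f x) z)%R).
Proof.
move=> Hf; have [_ hf _] := Hf.
have FE (s : seq int) : (\sum_(z <- s) z)%R = foldl (fun a z => a + z)%R 0%R s.
  have H a : foldl (fun a z => a + z)%R a s = (a + \sum_(z <- s) z)%R.
    by elim: s a => [|z s IHs] a; rewrite ?big_nil ?addr0 //= big_cons IHs addrA.
  by rewrite H add0r.
apply: (@PT_ext _ _ _ (fun x => foldl (fun a z => a + z)%R 0%R (f x))) => //.
apply: (PT_foldl (step := fun _ (a z : int) => (a + z)%R)) => //.
- exact: PT_const (PT_adq Hf).
- by apply: PT_addz; pt.
exists (fun x => 5 + 4 * esz (f x)); first by pb.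
move=> x i _; rewrite -FE; apply: leq_trans (esz_int _) _.
by have := blen_sumz (take i (f x)); have := esz_take i (f x); elia.
Qed.

Lemma PT_prodn mu (f : T -> seq nat) : PT mu f -> PT mu (fun x => \prod_(z <- f x) z).
Proof.
move=> Hf; have [_ hf _] := Hf.
have FE (s : seq nat) : \prod_(z <- s) z = foldl (fun a z => a * z) 1 s.
  have H a : foldl (fun a z => a * z) a s = a * \prod_(z <- s) z.
    by elim: s a => [|z s IHs] a; rewrite ?big_nil ?muln1 //= big_cons IHs mulnA.
  by rewrite H mul1n.
apply: (@PT_ext _ _ _ (fun x => foldl (fun a z => a * z) 1 (f x))) => //.
apply: (PT_foldl (step := fun _ (a z : nat) => a * z)) => //.
- exact: PT_const (PT_adq Hf).
- by pt.
exists (fun x => 5 + 4 * esz (f x)); first by pb.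
move=> x i _; rewrite -FE; apply: leq_trans (esz_nat _) _.
have : blen (\prod_(z <- take i (f x)) z) <= esz (take i (f x)).
  elim: (take i (f x)) => [|z s IHs]; first by rewrite big_nil.
  rewrite big_cons esz_cons; apply: leq_trans (blenM _ _) _.
  by have := blen_esz z; lia.
by have := esz_take i (f x); elia.
Qed.

Lemma PT_size (E : encType) mu (f : T -> seq E) : PT mu f -> PT mu (fun x => size (f x)).
Proof.
move=> Hf; have [_ hf _] := Hf.
have FE (s : seq E) n : foldl (fun a _ => a.+1) n s = n + size s.
  by elim: s n => [|e s IHs] n /=; rewrite ?addn0// IHs addnS.
apply: (@PT_ext _ _ _ (fun x => foldl (fun a _ => a.+1) 0 (f x))).
  by move=> x; rewrite FE.
apply: (PT_foldl (step := fun _ (a : nat) (_ : E) => a.+1)) => //.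
- exact: PT_const (PT_adq Hf).
- by pt.
exists (fun x => 1 + 4 * esz (f x)); first by pb.
move=> x i _; rewrite FE add0n; apply: leq_trans (esz_nat _) _.
have := blenn (size (take i (f x))); have := size_esz (f x).
by rewrite size_take_min; lia.
Qed.

(** The length is that of a list and not a given number, whose value may be exponential in its
    binary size. *)
Lemma PT_iota (E : encType) mu (f : T -> seq E) :
  PT mu f -> PT mu (fun x => iota 0 (size (f x))).
Proof.
move=> Hf; have [_ hf _] := Hf.
have FE (s : seq E) : foldl (fun a _ => (a.1.+1, a.1 :: a.2)) (0, [::]) s = (size s, rev (iota 0 (size s))).
  elim/last_ind: s => //= s e IHs.
  by rewrite foldl_rcons IHs /= size_rcons -addn1 iotaD rev_cat addn1.
apply: (@PT_ext _ _ _ (fun x => rev (foldl (fun a _ => (a.1.+1, a.1 :: a.2)) (0, [::]) (f x)).2)).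
  by move=> x; rewrite FE revK.
apply: PT_rev; apply: PT_snd.
apply: (PT_foldl (step := fun _ (a : nat * seq nat) (_ : E) => (a.1.+1, a.1 :: a.2))) => //.
- exact: PT_const (PT_adq Hf).
- by pt.
exists (fun x => 3 + 4 * esz (f x) + esz (f x) * (2 + 4 * esz (f x))); first by pb.
move=> x i _; rewrite FE esz_pair esz_rev; set n := size (take i (f x)).
have hn : n <= esz (f x) by rewrite /n size_take_min; have := size_esz (f x); lia.
have := esz_nat n; have := blenn n.
have H k : k <= n -> esz (iota 0 k) <= 1 + k * (2 + 4 * esz (f x)).
  elim: k => [|k IHk] lek; first by rewrite esz_nil.
  rewrite -addn1 iotaD; have := esz_cat (iota 0 k) (iota (0 + k) 1).
  rewrite /= esz_cons esz_nil add0n; have := IHk (ltnW lek).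
  by have := esz_nat k; have := blenn k; nia.
by have := H n (leqnn n); nia.
Qed.

Lemma PT_drop (E : encType) mu (f : T -> nat) (g : T -> seq E) :
  PT mu f -> PT mu g -> PT mu (fun x => drop (f x) (g x)).
Proof.
move=> Hf Hg; have [_ hf _] := Hf; have [_ hg _] := Hg.
(* The list itself is the clock of the countdown; when it is used up, nothing is left to drop. *)
pose stp (a : nat * seq E) (_ : E) := if a.1 == 0 then a else (a.1 - 1, behead a.2).
have FE (s : seq E) n t : foldl stp (n, t) s = (n - size s, drop (minn n (size s)) t).
  elim: s n t => [|e s IHs] n t /=; first by rewrite subn0 minn0 drop0.
  rewrite /stp /= -/stp; case: n => [|n] /=; first by rewrite IHs sub0n min0n.
  by rewrite subSS subn0 IHs subSS minnSS -drop1 drop_drop addn1.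
apply: (@PT_ext _ _ _ (fun x => (foldl stp (f x, g x) (g x)).2)).
  move=> x; rewrite FE /minn; case: ifP => // /negbT; rewrite -leqNgt => h.
  by rewrite !drop_oversize.
apply: PT_snd; apply: (PT_foldl (step := fun _ => stp)) => //.
- exact: PT_pair.
- by rewrite /stp; pt.
exists (fun x => 2 + 4 * esz (f x) + esz (g x)); first by pb.
move=> x i _; rewrite FE esz_pair; have := esz_drop (minn (f x) (size (take i (g x)))) (g x).
have := esz_nat (f x - size (take i (g x))).
have := leq_blen (leq_subr (size (take i (g x))) (f x)); have := blen_esz (f x); lia.
Qed.

Lemma PT_nth (E : encType) (x0 : E) mu (f : T -> nat) (g : T -> seq E) :
  PT mu f -> PT mu g -> PT mu (fun x => nth x0 (g x) (f x)).
Proof.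
move=> Hf Hg; apply: (@PT_ext _ _ _ (fun x => head x0 (drop (f x) (g x)))).
  by move=> x; rewrite -nth0 nth_drop addn0.
by apply: PT_head; exact: PT_drop.
Qed.

End lists_pt.

Ltac pt_hook2 := fail.
Ltac pt_hook ::= first [pt_hook2 | simple apply PT_bits | simple apply PT_bval
  | simple apply PT_addn | simple apply PT_succ | simple apply PT_leq | simple apply PT_subn
  | simple apply PT_eqn | simple apply PT_odd | simple apply PT_half
  | simple apply PT_muln | simple apply PT_divn
  | simple apply PT_zmk | simple apply PT_absz | simple apply PT_ltz0 | simple apply PT_Posz
  | simple apply PT_addz | simple apply PT_mulz | simple apply PT_oppz | simple apply PT_zquo
  | simple apply PT_eqz | simple apply PT_sumz | simple apply PT_prodn | simple apply PT_size
  | simple apply PT_iota | simple apply PT_drop | simple apply PT_nth ].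

(** * Orthogonal projections with integer entries *)

Local Open Scope ring_scope.

Section projection.
Variables (F : realFieldType) (n : nat).
Implicit Types (P D : 'M[F]_n) (v x : 'cV[F]_n).

Local Notation "A ^F" := (map_mx (intr : int -> F) A) (at level 2, format "A ^F").

Lemma sqr_normE v : (v^T *m v) 0 0 = \sum_i v i 0 ^+ 2.
Proof. by rewrite mxE; apply: eq_bigr => i _; rewrite mxE expr2. Qed.

Lemma sqr_norm_ge0 v : 0 <= (v^T *m v) 0 0.
Proof. by rewrite sqr_normE; apply: sumr_ge0 => i _; exact: sqr_ge0. Qed.

Lemma sqr_norm_eq0 v : (v^T *m v) 0 0 = 0 -> v = 0.
Proof.
rewrite sqr_normE => /eqP; rewrite psumr_eq0 => [/allP h|i _]; last exact: sqr_ge0.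
apply/matrixP => i j; rewrite ord1 mxE; apply/eqP; rewrite -sqrf_eq0.
exact: h (mem_index_enum _).
Qed.

Lemma mx11E (A : 'M[F]_1) : A = (A 0 0)%:M.
Proof. exact: mx11_scalar. Qed.

(** Schur complement in the Gram matrix: multiplying by the unipotent [U] clears the upper right
    block and leaves [a P a^T] in the corner. The witness [C] plays the role of the inverse Gram
    matrix times [B]. *)
Lemma schur_det r (B C : 'M[F]_(r, n)) (a : 'rV[F]_n) D P :
  B *m D = B -> a *m D = a -> B *m P = 0 -> D - P = B^T *m C ->
  \det (col_mx B a *m (col_mx B a)^T) = \det (B *m B^T) * (a *m P *m a^T) 0 0.
Proof.
move=> BD aD BP DP; rewrite tr_col_mx mul_col_row.
have GC : B *m B^T *m C = B by rewrite -mulmxA -DP mulmxBr BD BP subr0.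
pose U : 'M[F]_(r + 1) := block_mx 1%:M (- (C *m a^T)) 0 1%:M.
have dU : \det U = 1 by rewrite det_ublock !det1 mulr1.
rewrite -[LHS]mulr1 -dU -det_mulmx mulmx_block !mulmx1 !mulmx0 !addr0.
rewrite !mulmxN !mulmxA GC addNr det_lblock; congr (_ * _).
rewrite -(mulmxA a B^T C) -DP mulmxBr aD mulmxBl opprB subrK.
exact: det_mx11.
Qed.

(** Cramer's rule: [C] solves [(B B^T) C = B], so the Gram determinant clears all denominators of
    the projector. *)
Lemma proj_integral r (B : 'M[int]_(r, n)) (C : 'M[F]_(r, n)) (D0 : 'M[int]_n) P :
  B *m D0 = B -> B^F *m P = 0 -> D0^F - P = B^F^T *m C ->
  (\det (B *m B^T))%:~R *: P =
  (\det (B *m B^T) *: D0 - B^T *m \adj (B *m B^T) *m B)^F.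
Proof.
move=> BD BP DP; pose G := B *m B^T.
have GE : G^F = B^F *m B^F^T by rewrite map_mxM map_trmx.
have GC : G^F *m C = B^F by rewrite GE -mulmxA -DP mulmxBr BP subr0 -map_mxM BD.
have adjE : \adj G^F *m B^F = (\det G)%:~R *: C.
  by rewrite -[in LHS]GC mulmxA mul_adj_mx det_map_mx mul_scalar_mx.
rewrite -/G raddfB /= map_mxZ !map_mxM map_mx_adj -map_trmx -mulmxA adjE.
rewrite -scalemxAr -scalerBr /= -DP.
by rewrite opprB addrC subrK.
Qed.

Definition actD (act : pred 'I_n) : 'M[int]_n := diag_mx (\row_i (act i)%:Z).

Lemma actDE act i j : actD act i j = (act i)%:Z *+ (i == j).
Proof. by rewrite !mxE. Qed.

Lemma actD_tr act : (actD act)^T = actD act.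
Proof. exact: tr_diag_mx. Qed.

Lemma actD_sq act : actD act *m actD act = actD act.
Proof.
apply/matrixP => i j; rewrite mul_diag_mx !mxE.
by case: (act i); rewrite ?mul1r ?mul0r ?mul0rn.
Qed.

(** Invariant of a fraction-free computation: [N / d] is the orthogonal projector onto the common
    kernel of [As] inside the active coordinates. The rows of [B] stand for the independent rows met
    so far; their Gram determinant is the denominator, and the last inequality, of Hadamard type,
    keeps the integers short. *)
Definition pinv (act : pred 'I_n) (As : seq 'rV[int]_n) (N : 'M[int]_n) (d : int) : Prop :=
  let P : 'M[F]_n := (d%:~R)^-1 *: N^F in let D := (actD act)^F in
  exists r (B : 'M[int]_(r, n)) (C : 'M[F]_(r, n)),
  [/\ 0 < d, \det (B *m B^T) = d, B *m actD act = B & D - P = B^F^T *m C] /\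
  [/\ P^T = P, P *m P = P, P *m D = P & B^F *m P = 0] /\
  [/\ {in As, forall a, a^F *m P = 0},
      forall x, D *m x = x -> {in As, forall a, a^F *m x = 0} -> P *m x = x &
      d <= \prod_(a <- As) (1 + (a *m a^T) 0 0)].

Lemma pinv0 act : pinv act [::] (actD act) 1.
Proof.
rewrite /pinv invr1 scale1r; exists 0%N, 0, 0; split; last split.
- by split; rewrite ?det_mx00 ?mul0mx ?subrr ?mulmx0 ?raddf0.
- split; rewrite ?map_mx0 ?mul0mx//.
  + by rewrite map_trmx actD_tr.
  + by rewrite -map_mxM actD_sq.
  + by rewrite -map_mxM actD_sq.
- by split=> //; rewrite big_nil.
Qed.

(** With [v = P a^T] the new projector is [P - v v^T / (a v)], and [q] is [d] times [a v]. By
    [schur_det] this [q] is again a Gram determinant, so by [proj_integral] the division by [d] is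
    exact. If [q = 0] then [v = 0]: the row already vanishes on the range of [P]. *)
Lemma pinv_step act As N d (a : 'rV[int]_n) : pinv act As N d -> a *m actD act = a ->
  let u := N *m a^T in let q := (a *m u) 0 0 in
  if q == 0 then pinv act (rcons As a) N d else
  pinv act (rcons As a) (\matrix_(i, j) zquo (q * N i j - u i 0 * u j 0) d) q.
Proof.
set P : 'M[F]_n := (d%:~R)^-1 *: N^F; set D := (actD act)^F.
move=> [r [B [C]]]; rewrite -/P -/D => -[[d0 dE BD DP] [[PT' PP PD BP] [HA Hx Hd]]] aD u q.
have df0 : (d%:~R : F) != 0 by rewrite intr_eq0 gt_eqF.
have NP : N^F = d%:~R *: P by rewrite /P scalerA divff// scale1r.
have PE : (d%:~R)^-1 *: N^F = P by [].
have mxB (X Y : 'M[F]_1) : (X - Y) 0 0 = X 0 0 - Y 0 0 by rewrite !mxE.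
clearbody P.
have [v v_def] : exists v : 'cV[F]_n, v = P *m a^F^T by eexists.
have uE : u^F = d%:~R *: v by rewrite map_mxM NP -map_trmx -scalemxAl v_def.
have vT : v^T = a^F *m P by rewrite v_def trmx_mul trmxK PT'.
have Pv : P *m v = v by rewrite v_def mulmxA PP.
have vTP : v^T *m P = v^T by rewrite vT -mulmxA PP.
pose al := (a^F *m v) 0 0.
have vTv : v^T *m v = a^F *m v by rewrite vT -mulmxA Pv.
have vv : (v^T *m v) 0 0 = al by rewrite vTv.
have qE : q%:~R = d%:~R * al.
  have : (a *m u)^F 0 0 = d%:~R * al by rewrite map_mxM uE -scalemxAr mxE.
  by rewrite mxE.
have aDf : a^F *m D = a^F by rewrite -map_mxM aD.
have DT : D^T = D by rewrite /D map_trmx actD_tr.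
have DaT : D *m a^F^T = a^F^T by rewrite -[in RHS]aDf trmx_mul DT.
have e1 : (a^F *m a^F^T) 0 0 = ((a *m a^T) 0 0)%:~R by rewrite map_trmx -map_mxM mxE.
(* [a v] is the squared length of the projection of [a], hence at most that of [a]; this is the
   factor by which [d] may grow. *)
have al_le : al <= ((a *m a^T) 0 0)%:~R.
  have := sqr_norm_ge0 (a^F^T - v).
  rewrite [(_ - _)^T]linearB /= trmxK mulmxBl !mulmxBr vTv.
  have -> : v^T *m a^F^T = a^F *m v by rewrite vT -mulmxA -v_def.
  by rewrite subrr subr0 -e1 mxB subr_ge0.
have al0 : 0 <= al by rewrite -vv sqr_norm_ge0.
clearbody q; clearbody u.
case: eqP => [q0|/eqP q0].
  rewrite /pinv PE -/D.
  have al_eq0 : al = 0.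
    by move: qE; rewrite q0 => /esym/eqP; rewrite mulf_eq0 (negbTE df0) => /eqP.
  have v0 : v = 0 by apply: sqr_norm_eq0; rewrite vv.
  exists r, B, C; split=> //; split=> //; split.
  - by move=> b; rewrite mem_rcons inE => /predU1P[->|/HA//]; rewrite -vT v0 trmx0.
  - by move=> x Dx h; apply: Hx => // b bA; apply: h; rewrite mem_rcons inE bA orbT.
  - rewrite -cats1 big_cat big_seq1 /=; apply: (le_trans Hd); apply: ler_peMr.
      exact: le_trans (ltW d0) Hd.
    by rewrite lerDl -(ler_int F); exact: le_trans al0 al_le.
have alN0 : al != 0 by apply: contraNneq q0 => h; rewrite h mulr0 in qE; rewrite -(intr_eq0 F) qE.
have al_gt0 : 0 < al by rewrite lt_neqAle eq_sym alN0.
have q_gt0 : 0 < q by rewrite -(ltr0z F) qE mulr_gt0// ltr0z.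
have avE : a^F *m v = al%:M by rewrite [LHS]mx11E.
clearbody al.
pose P' := P - al^-1 *: (v *m v^T).
pose B' := col_mx B a.
pose C' : 'M[F]_(r + 1, n) := col_mx (C - al^-1 *: (C *m a^F^T *m v^T)) (al^-1 *: v^T).
have B'E : B'^F = col_mx B^F a^F by rewrite map_col_mx.
have Bv : B^F *m v = 0 by rewrite v_def mulmxA BP mul0mx.
have aP' : a^F *m P' = 0.
  by rewrite mulmxBr -scalemxAr mulmxA avE mul_scalar_mx scalerA mulVf// scale1r -vT subrr.
have BP' : B^F *m P' = 0.
  by rewrite mulmxBr -scalemxAr mulmxA Bv mul0mx scaler0 BP subrr.
have B'P : B'^F *m P' = 0 by rewrite B'E mul_col_mx aP' BP' col_mx0.
have vE : v = a^F^T - B^F^T *m C *m a^F^T.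
  by rewrite -DP mulmxBl DaT opprB addrCA subrr addr0.
have DP' : D - P' = B'^F^T *m C'.
  rewrite B'E tr_col_mx mul_row_col mulmxBr -DP -!scalemxAr !mulmxA.
  rewrite -addrA [- _ + _]addrC -scalerBr -mulmxBl -vE /P' opprB.
  by rewrite addrA addrAC.
have dE' : \det (B' *m B'^T) = q.
  apply: (intr_inj (R := F)); rewrite qE -dE -!det_map_mx !map_mxM -!map_trmx B'E.
  rewrite (schur_det _ aDf BP DP); last by rewrite -map_mxM BD.
  by rewrite -(mulmxA _ P) -v_def avE mxE eqxx mulr1n.
have B'D : B' *m actD act = B' by rewrite mul_col_mx BD aD.
have NE : (\matrix_(i, j) zquo (q * N i j - u i 0 * u j 0) d) =
    \det (B' *m B'^T) *: actD act - B'^T *m \adj (B' *m B'^T) *m B'.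
  have := proj_integral B'D B'P DP'; rewrite dE' => /matrixP e.
  apply/matrixP => i j; rewrite [LHS]mxE; apply: zquoK => //.
  have := e i j; rewrite [RHS]mxE => eij.
  apply: (intr_inj (R := F)); rewrite [LHS]rmorphM /= -eij.
  rewrite /P' !mxE rmorphB !rmorphM /= big_ord1 !mxE qE.
  have -> : (N i j)%:~R = d%:~R * P i j by have /matrixP/(_ i j) := NP; rewrite !mxE.
  have uiE k : (u k 0)%:~R = d%:~R * v k 0 by have /matrixP/(_ k 0) := uE; rewrite !mxE.
  by rewrite !uiE; field.
have P'E : (q%:~R)^-1 *: (\matrix_(i, j) zquo (q * N i j - u i 0 * u j 0) d)^F = P'.
  have := proj_integral B'D B'P DP'; rewrite -NE dE' => <-.
  by rewrite scalerA mulVf ?scale1r// qE mulf_neq0.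
rewrite /pinv P'E -/D; exists (r + 1)%N, B', C'; split; first by split.
split.
  split=> //.
  - by rewrite /P' [(_ - _)^T]linearB /= [(_ *: _)^T]linearZ /= trmx_mul trmxK PT'.
  - have Pv' : P' *m v = 0.
      by rewrite mulmxBl -scalemxAl -mulmxA vTv avE mul_mx_scalar scalerA mulVf// scale1r Pv subrr.
    rewrite {2}/P' mulmxBr -scalemxAr mulmxA Pv' mul0mx scaler0 subr0.
    by rewrite /P' mulmxBl PP -scalemxAl -mulmxA vTP.
  - have vTD : v^T *m D = v^T by rewrite vT -mulmxA PD.
    by rewrite mulmxBl PD -scalemxAl -mulmxA vTD.
split.
- move=> b; rewrite mem_rcons inE => /predU1P[->|bA]//.
  by rewrite mulmxBr (HA _ bA) -scalemxAr v_def mulmxA (mulmxA _ P) (HA _ bA) !mul0mx scaler0 subrr.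
- move=> x Dx h.
  have Px : P *m x = x by apply: Hx => // b bA; apply: h; rewrite mem_rcons inE bA orbT.
  have ax : a^F *m x = 0 by apply: h; rewrite mem_rcons mem_head.
  have vTx : v^T *m x = 0 by rewrite vT -mulmxA Px.
  by rewrite mulmxBl Px -scalemxAl -mulmxA vTx mulmx0 scaler0 subr0.
- rewrite -cats1 big_cat big_seq1 /= -(ler_int F) qE rmorphM /=; apply: ler_pM => //.
  + by rewrite ler0z ltW.
  + by rewrite ler_int.
  + by rewrite rmorphD /= (le_trans al_le)// lerDr.
Qed.

(** By symmetry and idempotence [P j j] is the squared norm of column [j], and in particular at
    least its own square. *)
Lemma proj_diag_le P : P^T = P -> P *m P = P -> forall i j,
  P i j ^+ 2 <= P j j /\ 0 <= P j j <= 1.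
Proof.
move=> PT' PP i j; have e : P j j = \sum_k P k j ^+ 2.
  rewrite -[in LHS]PP mxE; apply: eq_bigr => k _.
  by rewrite -[in P j k]PT' mxE expr2.
have le k : P k j ^+ 2 <= P j j.
  by rewrite e (bigD1 k)//= lerDl sumr_ge0// => l _; exact: sqr_ge0.
have ge0 : 0 <= P j j by rewrite e sumr_ge0// => l _; exact: sqr_ge0.
split=> //; rewrite ge0 /=; have := le j; rewrite expr2 => h.
by rewrite leNgt; apply/negP => h1; move: h; rewrite leNgt ltr_pMl ?h1// (lt_trans ltr01).
Qed.

End projection.

(** * Positive kernel vectors by the rescaled perceptron *)

Definition dotz (ix : seq nat) (u v : seq int) : int :=
  \sum_(z <- [seq nth 0 u i * nth 0 v i | i <- ix]) z.

Definition mulmv ix (N : seq (seq int)) (a : seq int) : seq int :=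
  [seq dotz ix (nth [::] N i) a | i <- ix].

Definition scale_row ix (c : seq nat) (a : seq int) : seq int :=
  [seq nth 0 a j * (nth 0%N c j)%:Z | j <- ix].

Definition proj_upd ix (s : seq (seq int) * int) (u : seq int) (q : int) :=
  if q == 0 then s else
  ([seq [seq zquo (q * nth 0 (nth [::] s.1 i) j + - (nth 0 u i * nth 0 u j)) s.2
        | j <- ix] | i <- ix], q).

Definition proj_row ix (s : seq (seq int) * int) (a : seq int) :=
  proj_upd ix s (mulmv ix s.1 a) (dotz ix a (mulmv ix s.1 a)).

Definition proj0 ix (c : seq nat) : seq (seq int) * int :=
  ([seq [seq if (i == j) && (0 < nth 0%N c i)%N then 1 else 0 | j : nat <- ix] | i : nat <- ix], 1).

(* [(N, d)] with [N / d] the orthogonal projector onto the kernel of the rows of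
   [A], with columns scaled by [c], inside the span of the coordinates with [c != 0]. *)
Definition proj ix (A : seq (seq int)) (c : seq nat) :=
  foldl (fun s a => proj_row ix s (scale_row ix c a)) (proj0 ix c) A.

Definition posy (y : seq nat) : seq int := [seq k%:Z | k <- y].

(** The active coordinates at which [P y] is not positive; the denominator is positive, so signs are
    read off [N]. *)
Definition bad ix (c : seq nat) (N : seq (seq int)) (y : seq nat) : seq nat :=
  [seq i <- ix | (0 < nth 0%N c i)%N &&
     ((dotz ix (nth [::] N i) (posy y) < 0) || (dotz ix (nth [::] N i) (posy y) == 0))].

Definition incr ix (y : seq nat) (k : nat) : seq nat :=
  [seq if j == k then (nth 0 y j).+1 else nth 0 y j | j : nat <- ix]%N.

Definition perc_step ix c N y : seq nat :=
  if nilp (bad ix c N y) then y else incr ix y (head 0%N (bad ix c N y)).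

Definition ticks (ix : seq nat) : seq unit :=
  flatten [seq flatten [seq flatten [seq [:: tt; tt; tt; tt] | _ <- ix] | _ <- ix] | _ <- ix].

Definition perc ix c N : seq nat :=
  foldl (fun y _ => perc_step ix c N y) [seq 0%N | _ <- ix] (ticks ix).

Definition argmax ix (y : seq nat) : nat :=
  head 0%N [seq j <- ix | all (fun i => nth 0 y i <= nth 0 y j)%N ix].

(** Halving 1 gives 0, which removes the coordinate for good. *)
Definition halve ix (c : seq nat) (k : nat) : seq nat :=
  [seq if j == k then (nth 0 c j)./2 else nth 0 c j | j : nat <- ix]%N.

Definition outer_step ix A c : seq nat :=
  if nilp (bad ix c (proj ix A c).1 (perc ix c (proj ix A c).1)) then c
  else halve ix c (argmax ix (perc ix c (proj ix A c).1)).

(** Bounds the projector denominators for [A] restricted to any set of coordinates, and through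
    [sol_lower] also positive entries of solutions from below. *)
Definition Delta ix (A : seq (seq int)) : nat :=
  (\prod_(d <- [seq `|(1 + dotz ix a a)%R| | a <- A]) d)%N.

(** A power of two above [Delta]. Scales are integers read relative to it: the [i]-th entry of a
    solution in the unit box is at most [c_i / cap]. *)
Definition cap ix A : nat := foldl (fun k _ => k + k)%N 1%N (bits (Delta ix A)).

(** Each unsuccessful round lowers the bit length of one scale; [n] scales of bit length
    [blen Delta + 1] allow exactly this many. *)
Definition rounds ix A : seq bool := flatten [seq true :: bits (Delta ix A) | _ <- ix].

Definition scaling ix A : seq nat :=
  foldl (fun c _ => outer_step ix A c) [seq cap ix A | _ <- ix] (rounds ix A).

(** The scales that survive mark the largest support of a nonnegative kernel vector, so it remains
    to compare [J] with them. *)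
Definition kerpos ix (A : seq (seq int)) (J : seq bool) : bool :=
  all (fun j => ~~ nth false J j || (0 < nth 0 (scaling ix A) j)%N) ix.

Lemma nth_iota_map (T : Type) (x0 : T) (f : nat -> T) n i : (i < n)%N ->
  nth x0 [seq f j | j <- iota 0 n] i = f i.
Proof. exact: nth_mkseq. Qed.

Lemma dotzE n u v : dotz (iota 0 n) u v = \sum_(i < n) nth 0 u i * nth 0 v i.
Proof.
rewrite /dotz big_map -(big_mkord xpredT (fun i => nth 0 u i * nth 0 v i)).
by rewrite /index_iota subn0.
Qed.

Lemma size_flatten_const (T U : Type) (s : seq T) (l : seq U) :
  size (flatten [seq s | _ <- l]) = (size l * size s)%N.
Proof. by elim: l => //= _ l IHl; rewrite size_cat IHl mulSn. Qed.

Section correctness.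
Variables (F : realFieldType) (n : nat) (A : seq (seq int)).
Local Notation "A ^F" := (map_mx (intr : int -> F) A) (at level 2, format "A ^F").
Let ix := iota 0 n.

Definition mxl (N : seq (seq int)) : 'M[int]_n := \matrix_(i, j) nth 0 (nth [::] N i) j.
Definition rvl (a : seq int) : 'rV[int]_n := \row_j nth 0 a j.
Definition actc (c : seq nat) : pred 'I_n := fun i => (0 < nth 0 c i)%N.
Definition cvl (y : seq nat) : 'cV[F]_n := \col_i (nth 0%N y i)%:R.

Lemma rvl_scale c a (j : 'I_n) : rvl (scale_row ix c a) 0 j = rvl a 0 j * (nth 0%N c j)%:Z.
Proof. by rewrite !mxE nth_iota_map. Qed.

Lemma rvl_act c a : rvl (scale_row ix c a) *m actD (actc c) = rvl (scale_row ix c a).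
Proof.
apply/matrixP => i j; rewrite ord1 mul_mx_diag !mxE nth_iota_map// /actc.
by case: posnP => [->|_]; rewrite ?mulr0 ?mul0r ?mulr1.
Qed.

Lemma mulmvE N a (i : 'I_n) : nth 0 (mulmv ix N a) i = (mxl N *m (rvl a)^T) i 0.
Proof.
rewrite nth_iota_map// dotzE mxE; apply: eq_bigr => j _.
by rewrite !mxE.
Qed.

Lemma dotz_mulmv N a : dotz ix a (mulmv ix N a) = (rvl a *m (mxl N *m (rvl a)^T)) 0 0.
Proof.
rewrite dotzE [RHS]mxE; apply: eq_bigr => j _.
by rewrite mulmvE [rvl a 0 j]mxE.
Qed.

Lemma proj_ok B c : pinv F (actc c) [seq rvl (scale_row ix c a) | a <- B]
  (mxl (proj ix B c).1) (proj ix B c).2.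
Proof.
elim/last_ind: B => [|B a IHB].
  rewrite /proj /=; have -> : mxl (proj0 ix c).1 = actD (actc c); last exact: pinv0.
  apply/matrixP => i j; rewrite mxE !nth_iota_map// actDE /actc val_eqE.
  by case: (i == j); case: (0 < _)%N.
rewrite map_rcons /proj foldl_rcons -/(proj ix B c); set s := proj ix B c in IHB *.
have := pinv_step IHB (rvl_act c a); rewrite /= -dotz_mulmv /proj_row /proj_upd.
set b := scale_row ix c a; case: eqP => // _; congr pinv.
apply/matrixP => i j; rewrite [LHS]mxE [RHS]mxE (nth_iota_map [::])// nth_iota_map//.
by rewrite -!mulmvE [mxl _ _ _]mxE.
Qed.

Lemma size_ticks : size (ticks ix) = (4 * n ^ 3)%N.
Proof. by rewrite /ticks !size_flatten_const size_iota /=; lia. Qed.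

Definition sol (x : 'cV[F]_n) : Prop :=
  (forall i, 0 <= x i 0) /\ {in A, forall a, (rvl a)^F *m x = 0}.

Section fixed_scaling.
Variable c : seq nat.
Let N := (proj ix A c).1.
Let d := (proj ix A c).2.

Lemma projP : exists P : 'M[F]_n,
  [/\ P^T = P, P *m P = P, 0 < d & N = N] /\
  [/\ N = N, (mxl N)^F = d%:~R *: P,
      (forall i j, ~~ actc c i -> P i j = 0) &
      {in A, forall a, (rvl (scale_row ix c a))^F *m P = 0}] /\
  [/\ forall x : 'cV[F]_n, (forall i, ~~ actc c i -> x i 0 = 0) ->
      {in A, forall a, (rvl (scale_row ix c a))^F *m x = 0} -> P *m x = x &
      d <= \prod_(a <- A) (1 + dotz ix (scale_row ix c a) (scale_row ix c a))].
Proof.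
have := proj_ok A c; rewrite -/N -/d; set P : 'M[F]_n := (d%:~R)^-1 *: (mxl N)^F.
move=> [r [B [C]]]; rewrite -/P => -[[d0 _ _ _] [[PT' PP PD _] [HA Hx Hd]]].
have df0 : (d%:~R : F) != 0 by rewrite intr_eq0 gt_eqF.
have DT : ((actD (actc c))^F)^T = (actD (actc c))^F by rewrite map_trmx actD_tr.
exists P; split=> //; split; split=> //.
- by rewrite scalerA divff// scale1r.
- move=> i j ni; have : (actD (actc c))^F *m P = P by rewrite -[LHS]trmxK trmx_mul DT PT' PD PT'.
  move=> /matrixP/(_ i j) <-; rewrite mxE big1// => k _.
  by rewrite !mxE (negbTE ni) mul0rn mul0r.
- by move=> a aA; apply: HA; apply: map_f.
- move=> x sx h; apply: Hx; last by move=> _ /mapP[a aA ->]; exact: h.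
  apply/matrixP => i j; rewrite ord1 mxE (bigD1 i)//= big1 => [|k /negbTE nk].
    rewrite addr0 !mxE eqxx mulr1n; case ai: (actc c i); first by rewrite mul1r.
    by rewrite sx ?ai// mulr0.
  by rewrite !mxE eq_sym nk mulr0n mul0r.
- move: Hd; rewrite big_map; congr (_ <= _); apply: eq_bigr => a _; congr (1 + _).
  rewrite dotzE mxE; apply: eq_bigr => j _.
  by rewrite [X in _ * X = _]mxE !mxE.
Qed.

Lemma dotz_posy (P : 'M[F]_n) y (i : 'I_n) : (mxl N)^F = d%:~R *: P ->
  (dotz ix (nth [::] N i) (posy y))%:~R = d%:~R * (P *m cvl y) i 0.
Proof.
move=> NP; have -> : d%:~R * (P *m cvl y) i 0 = ((mxl N)^F *m cvl y) i 0.
  by rewrite NP -scalemxAl [RHS]mxE.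
rewrite dotzE rmorph_sum /= mxE; apply: eq_bigr => j _.
rewrite rmorphM /= !mxE; congr (_ * _); rewrite /posy.
have [lt|ge] := ltnP j (size y); first by rewrite (nth_map 0%N).
by rewrite !nth_default// size_map.
Qed.

Lemma badP (P : 'M[F]_n) y : 0 < d -> (mxl N)^F = d%:~R *: P ->
  forall i : 'I_n, ((i : nat) \in bad ix c N y) = actc c i && ((P *m cvl y) i 0 <= 0).
Proof.
move=> d0 NP i; rewrite mem_filter.
have -> : ((i : nat) \in ix) = true by rewrite mem_iota leq0n add0n ltn_ord.
rewrite andbT /actc; congr (_ && _).
rewrite orbC -le_eqVlt -(ler_int F) (dotz_posy _ _ NP) pmulr_rle0//.
by rewrite ltr0z.
Qed.

Lemma bad_lt y i : i \in bad ix c N y -> (i < n)%N.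
Proof. by rewrite mem_filter mem_iota => /andP[_]. Qed.

Lemma head_bad y : ~~ nilp (bad ix c N y) -> head 0%N (bad ix c N y) \in bad ix c N y.
Proof. by case: (bad ix c N y) => //= a l _; rewrite mem_head. Qed.

Lemma nth_incr y k (i : 'I_n) : nth 0%N (incr ix y k) i = ((nth 0 y i) + (val i == k))%N.
Proof. by rewrite nth_iota_map//; case: eqP => _; rewrite ?addn1 ?addn0. Qed.

(** The perceptron estimate: raising [y] at [k] adds [2 (P y)_k + P k k] to [y^T P y], at most 1
    when [(P y)_k <= 0]. The sum of [y] meanwhile grows by exactly 1. *)
Definition perc_inv (P : 'M[F]_n) (t : nat) (y : seq nat) : Prop :=
  [/\ nilp (bad ix c N y) \/ (\sum_(i < n) nth 0 y i = t)%N /\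
        ((cvl y)^T *m P *m cvl y) 0 0 <= t%:R,
      forall i : 'I_n, ~~ actc c i -> nth 0%N y i = 0%N &
      forall i : 'I_n, (nth 0 y i <= t)%N].

Lemma perc_invP P s : P^T = P -> P *m P = P -> 0 < d -> (mxl N)^F = d%:~R *: P ->
  perc_inv P (size s) (foldl (fun y (_ : unit) => perc_step ix c N y) [seq 0%N | _ <- ix] s).
Proof.
move=> PT' PP d0 NP; elim/last_ind: s => [|s a].
  have y0 (i : 'I_n) : nth 0%N [seq 0%N | _ <- ix] i = 0%N by rewrite nth_iota_map.
  split=> /= [|i _|i]; rewrite ?y0//; right; split; first by rewrite big1.
  rewrite -mulmxA mxE big1// => i _; by rewrite !mxE y0 mul0r.
rewrite foldl_rcons size_rcons; set y := foldl _ _ _ => -[H1 H2 H3].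
rewrite /perc_step; case: ifP => [nb|/negbT nb].
  by split=> // [|i]; [left|exact: leqW].
case: H1 => [|[H1 H4]]; first by rewrite (negbTE nb).
have hb := head_bad nb; set k := head _ _ in hb *.
pose k' := Ordinal (bad_lt hb).
have := badP y d0 NP k'; rewrite hb => /esym/andP[ak Pk].
split; last 2 first.
- move=> i ni; rewrite nth_incr H2// add0n; case: eqP => //= e.
  by move: ni; rewrite (_ : i = k') ?ak//; exact/val_inj.
- by move=> i; rewrite nth_incr; have := H3 i; case: eqP => _; lia.
right; split.
  under eq_bigr do rewrite nth_incr; rewrite big_split /= H1 -addn1; congr addn.
  rewrite (bigD1 k')//= eqxx big1 ?addn0// => i ne; apply/eqP; rewrite eqb0.
  by apply: contra ne => /eqP e; apply/eqP/val_inj.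
have -> : cvl (incr ix y k) = cvl y + delta_mx k' 0.
  apply/matrixP => i j; rewrite ord1 !mxE nth_incr natrD eqxx andbT.
  by rewrite -val_eqE.
set e := delta_mx k' 0; rewrite [(_ + _)^T]linearD /= !mulmxDl !mulmxDr.
have mxD (X Y : 'M[F]_1) : (X + Y) 0 0 = X 0 0 + Y 0 0 by rewrite mxE.
have e1 : (e^T *m P *m cvl y) 0 0 = (P *m cvl y) k' 0.
  by rewrite -mulmxA /e trmx_delta -rowE mxE.
have e2 : ((cvl y)^T *m P *m e) 0 0 = (P *m cvl y) k' 0.
  have tr00 (X : 'M[F]_1) : X 0 0 = X^T 0 0 by rewrite mxE.
  by rewrite -e1 tr00 !trmx_mul trmxK PT' mulmxA.
have e3 : (e^T *m P *m e) 0 0 = P k' k' by rewrite /e trmx_delta -rowE -colE !mxE.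
rewrite !mxD e1 e2 e3; have [_ /andP[_ le1]] := proj_diag_le PT' PP k' k'.
rewrite -natr1; lra.
Qed.

(* A failed perceptron run certifies [x_j <= 1/2] for the rescaled solutions. *)
Lemma perc_cut (x : 'cV[F]_n) (y := perc ix c N) : ~~ nilp (bad ix c N y) ->
  (forall i, 0 <= x i 0 <= 1) -> (forall i, ~~ actc c i -> x i 0 = 0) ->
  {in A, forall a, (rvl (scale_row ix c a))^F *m x = 0} ->
  exists j : 'I_n, [/\ argmax ix y = j, actc c j & x j 0 <= 2^-1].
Proof.
have [P [[PT' PP d0 _] [[_ NP P0 PA] [Pfix _]]]] := projP.
move=> nb x01 xs xA; have [] := perc_invP (ticks ix) PT' PP d0 NP.
rewrite -/(perc ix c N) -/y size_ticks => -[|[ysum yP] ys _]; first by rewrite (negbTE nb).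
have n0 : (0 < n)%N by apply: leq_ltn_trans (bad_lt (head_bad nb)).
pose i0 := Ordinal n0.
pose j : 'I_n := [arg max_(i > i0) nth 0%N y i].
have jP i : (nth 0 y i <= nth 0 y j)%N \/ (n <= i)%N.
  have [lti|] := ltnP i n; last by right.
  by left; rewrite /j; case: arg_maxnP => // k _ /(_ (Ordinal lti) isT).
have am_in : (j : nat) \in [seq j <- ix | all (fun i => nth 0 y i <= nth 0 y j)%N ix].
  rewrite mem_filter mem_iota /= add0n ltn_ord andbT; apply/allP => i.
  by rewrite mem_iota add0n => /andP[_ lti]; have [//|] := jP i; rewrite leqNgt lti.
have am : argmax ix y \in [seq j <- ix | all (fun i => nth 0 y i <= nth 0 y j)%N ix].
  by move: am_in; rewrite /argmax; case: [seq _ <- _ | _] => //= a l _; rewrite mem_head.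
move: am; rewrite mem_filter mem_iota add0n => /andP[/allP amax /andP[_ lta]].
pose k := Ordinal lta.
have kmax (i : 'I_n) : (nth 0 y i <= nth 0 y k)%N by apply: amax; rewrite mem_iota /=.
(* The [n] entries of [y] sum to [4 n^3]. The rest of the proof is [y_k x_k <= y x = z x <= |z| |x|
   <= sqrt (4 n^3) sqrt n = 2 n^2], by Cauchy-Schwarz, so [x_k] is at most [2 n^2 / (4 n^2)]. *)
have ybig : (4 * n ^ 2 <= nth 0 y k)%N.
  have : (\sum_(i < n) nth 0 y i <= \sum_(i < n) nth 0 y k)%N by apply: leq_sum.
  rewrite ysum sum_nat_const card_ord expnS mulnCA leq_pmul2l//.
exists k; split=> //.
  by apply: contraTT ybig => nk; rewrite ys// -ltnNge muln_gt0 expn_gt0 n0.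
have Px := Pfix x xs xA.
pose z := P *m cvl y.
have zz : (z^T *m z) 0 0 <= (4 * n ^ 3)%:R.
  by apply: le_trans yP; rewrite /z trmx_mul PT' mulmxA -(mulmxA _ P P) PP.
have xx : (x^T *m x) 0 0 <= n%:R.
  rewrite sqr_normE; apply: (@le_trans _ _ (\sum_(i < n) 1)).
    by apply: ler_sum => i _; apply: exprn_ile1; have /andP[] := x01 i.
  by rewrite sumr_const card_ord.
have yx : (nth 0%N y k)%:R * x k 0 <= (z^T *m x) 0 0.
  rewrite /z trmx_mul PT' -mulmxA Px mxE (bigD1 k)//= !mxE lerDl.
  apply: sumr_ge0 => i _; rewrite !mxE mulr_ge0//.
  by have /andP[] := x01 i.
have CS : (z^T *m x) 0 0 ^+ 2 <= (z^T *m z) 0 0 * (x^T *m x) 0 0.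
  rewrite !sqr_normE mxE.
  have -> : \sum_j z^T 0 j * x j 0 = \sum_j z j 0 * x j 0 by apply: eq_bigr => i _; rewrite mxE.
  rewrite -subr_ge0; set a := \sum_i z i 0 ^+ 2; set b := \sum_i x i 0 ^+ 2; set e := \sum_j _.
  have b0 : 0 <= b by apply: sumr_ge0 => i _; exact: sqr_ge0.
  have [b_eq0|bN0] := eqVneq b 0.
    have x0 i : x i 0 = 0.
      apply/eqP; rewrite -sqrf_eq0; move/eqP: b_eq0; rewrite psumr_eq0 => [/allP h|l _].
        exact: h (mem_index_enum _).
      exact: sqr_ge0.
    by rewrite /e big1 ?expr0n /= ?subr0 ?b_eq0 ?mulr0// => i _; rewrite x0 mulr0.
  have : 0 <= \sum_i (b * z i 0 - e * x i 0) ^+ 2 by apply: sumr_ge0 => i _; exact: sqr_ge0.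
  have -> : \sum_i (b * z i 0 - e * x i 0) ^+ 2 = b * (a * b - e ^+ 2).
    transitivity (b ^+ 2 * a - (2 * b * e) * e + e ^+ 2 * b); last by ring.
    have -> : b ^+ 2 * a - (2 * b * e) * e + e ^+ 2 * b = \sum_i (b ^+ 2 * z i 0 ^+ 2 -
        2 * b * e * (z i 0 * x i 0) + e ^+ 2 * x i 0 ^+ 2).
      by rewrite big_split sumrB -!mulr_sumr.
    by apply: eq_bigr => i _; ring.
  by rewrite pmulr_rge0// lt_neqAle eq_sym bN0.
have nf : 0 < (n%:R : F) by rewrite ltr0n.
have yf : 4 * n%:R ^+ 2 <= (nth 0%N y k)%:R :> F by rewrite -natrX -natrM ler_nat.
have /andP[xk0 _] := x01 k.
have h1 : 4 * n%:R ^+ 2 * x k 0 <= (z^T *m x) 0 0.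
  by apply: le_trans yx; rewrite ler_wpM2r.
have h2 : (4 * n%:R ^+ 2 * x k 0) ^+ 2 <= 4 * n%:R ^+ 3 * n%:R.
  apply: le_trans (_ : (z^T *m x) 0 0 ^+ 2 <= _).
    by rewrite ler_pXn2r// nnegrE ?mulr_ge0 ?exprn_ge0 ?ler0n// (le_trans _ h1)// ?mulr_ge0 ?exprn_ge0 ?ler0n.
  apply: le_trans CS _; rewrite natrM natrX in zz; apply: ler_pM => //.
    by rewrite sqr_norm_ge0.
  by rewrite sqr_norm_ge0.
rewrite leNgt; apply/negP => xk; move: h2; rewrite leNgt => /negP; apply.
have -> : 4 * n%:R ^+ 3 * n%:R = (2 * n%:R ^+ 2) ^+ 2 :> F by ring.
rewrite ltr_pXn2r// ?nnegrE ?mulr_ge0 ?exprn_ge0 ?ler0n//.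
have : 0 < n%:R ^+ 2 :> F by rewrite exprn_gt0.
by set m := n%:R ^+ 2 => m0; nra.
Qed.

Lemma bad_nil_sol : nilp (bad ix c N (perc ix c N)) ->
  exists x, sol x /\ forall i, (0 < x i 0) = actc c i.
Proof.
have [P [[PT' PP d0 _] [[_ NP P0 PA] [Pfix _]]]] := projP.
set y := perc ix c N => /nilP nb.
pose z := P *m cvl y.
have zpos i : actc c i -> 0 < z i 0.
  by move=> ai; have := badP y d0 NP i; rewrite nb in_nil ai /= ltNge => <-.
have z0 i : ~~ actc c i -> z i 0 = 0.
  by move=> ni; rewrite mxE big1// => j _; rewrite P0// mul0r.
(* Undoes the column scaling. *)
exists (\col_i ((nth 0%N c i)%:R * z i 0)); split; last first.
  move=> i; rewrite mxE; have [ai|ni] := boolP (actc c i).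
    by rewrite mulr_gt0 ?zpos// ltr0n.
  by rewrite z0// mulr0 ltxx.
split.
  move=> i; rewrite mxE; have [ai|ni] := boolP (actc c i).
    by rewrite mulr_ge0 ?ler0n// ltW// zpos.
  by rewrite z0// mulr0.
move=> a aA; have := PA a aA => /(congr1 (fun X => X *m cvl y)).
rewrite mul0mx -mulmxA -/z => <-; apply/matrixP => i j; rewrite !ord1 !mxE.
by apply: eq_bigr => k _; rewrite mxE [in RHS]mxE rvl_scale !mxE rmorphM /= mulrA.
Qed.

End fixed_scaling.

Lemma capE : cap ix A = (2 ^ blen (Delta ix A))%N.
Proof.
have H (s : seq bool) k : foldl (fun k _ => k + k)%N k s = (k * 2 ^ size s)%N.
  by elim: s k => [|b s IHs] k /=; rewrite ?muln1// IHs expnS; lia.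
by rewrite /cap H mul1n.
Qed.

Lemma DeltaE : (Delta ix A)%:R = \prod_(a <- A) (1 + dotz ix a a)%:~R :> F.
Proof.
rewrite /Delta big_map natr_prod; apply: eq_bigr => a _.
rewrite pmulrn gez0_abs// addr_ge0// dotzE sumr_ge0// => i _.
by rewrite -expr2 sqr_ge0.
Qed.

Lemma sol_scale x (k : F) : 0 <= k -> sol x -> sol (k *: x).
Proof.
move=> k0 [x0 xA]; split=> [i|a aA]; first by rewrite mxE mulr_ge0.
by rewrite -scalemxAr xA// scaler0.
Qed.

(** Induction on the support of [x]. The projection [p] of the [j]-th unit vector onto the kernel
    within that support has [p_j >= 1 / Delta], since [d P] is integral and [d <= Delta]. If [p] is
    nonnegative, scaling its largest entry to 1 gives [x']; that entry squared is at most [P j j].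
    Otherwise [x] is moved along [p] until a coordinate reaches 0, which never lowers [x_j] and
    shrinks the support. *)
Lemma sol_lower x (j : 'I_n) : sol x -> 0 < x j 0 -> exists x',
  [/\ sol x', forall i, x' i 0 <= 1 & 1 <= (Delta ix A)%:R * x' j 0 ^+ 2].
Proof.
have [m] := ubnP #|[set i | x i 0 != 0]|; elim: m x => // m IHm x lem solx xj.
have [x0 xA] := solx.
(* The scaling by 0 and 1 that restricts to the support of [x]. *)
pose c := [seq (x i 0 != 0 : nat) | i <- enum 'I_n].
have cE (i : 'I_n) : nth 0%N c i = (x i 0 != 0).
  by rewrite (nth_map i) ?size_enum_ord// nth_ord_enum.
have actE (i : 'I_n) : actc c i = (x i 0 != 0) by rewrite /actc cE; case: (_ != _).
have [P [[PT' PP d0 _] [[_ NP P0 PA] [Pfix dle]]]] := projP c.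
have PS i k : P i k = P k i by have /matrixP/(_ k i) := PT'; rewrite mxE.
set d := (proj ix A c).2 in d0 NP dle *.
have scE (v : 'cV[F]_n) : (forall i, ~~ actc c i -> v i 0 = 0) -> forall a,
    (rvl (scale_row ix c a))^F *m v = (rvl a)^F *m v.
  move=> vs a; apply/matrixP => i k; rewrite !ord1 !mxE; apply: eq_bigr => l _.
  rewrite mxE rvl_scale [in RHS]mxE; have [al|nl] := boolP (actc c l).
    by move: al; rewrite actE cE => ->; rewrite mulr1.
  by rewrite vs// !mulr0.
have xs i : ~~ actc c i -> x i 0 = 0 by rewrite actE negbK => /eqP.
have Px : P *m x = x by apply: Pfix => // a aA; rewrite scE// xA.
have diag i k := proj_diag_le PT' PP i k.
have Pjj : 0 < P j j.
  have [_ /andP[ge0 _]] := diag j j; rewrite lt_neqAle ge0 andbT eq_sym.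
  apply: contraTneq xj => Pj; rewrite -Px mxE big1 ?ltxx// => k _.
  have [le _] := diag k j; rewrite Pj in le.
  have /eqP : P k j ^+ 2 = 0 by apply/eqP; rewrite eq_le le sqr_ge0.
  by rewrite sqrf_eq0 PS => /eqP ->; rewrite mul0r.
have df : 0 < (d%:~R : F) by rewrite ltr0z.
have Pjj_ge : 1 <= (Delta ix A)%:R * P j j.
  have h1 : 1 <= d%:~R * P j j.
    have /matrixP/(_ j j) := NP; rewrite [RHS]mxE [LHS]mxE => e; rewrite -e.
    have : 0 < d%:~R * P j j by rewrite mulr_gt0.
    by rewrite -e ltr0z => h; rewrite -[1]/(1%:~R) ler_int -gtz0_ge1.
  apply: le_trans h1 _; rewrite ler_wpM2r ?(ltW Pjj)//.
  have : d%:~R <= (\prod_(a <- A) (1 + dotz ix (scale_row ix c a) (scale_row ix c a)))%:~R :> F.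
    by rewrite ler_int.
  move=> /le_trans; apply; rewrite DeltaE rmorph_prod /=.
  apply: ler_prod => a _; rewrite ler0z ler_int; apply/andP; split.
    by rewrite addr_ge0// dotzE sumr_ge0// => i _; rewrite -expr2 sqr_ge0.
  rewrite lerD2l !dotzE ler_sum// => i _; rewrite -!expr2.
  rewrite nth_iota_map// cE; case: (_ != _); rewrite ?mulr1//.
  by rewrite mulr0 expr0n sqr_ge0.
pose p : 'cV[F]_n := col j P.
have pE i : p i 0 = P i j by rewrite mxE.
have ps i : ~~ actc c i -> p i 0 = 0 by move=> ni; rewrite pE P0.
have pA : {in A, forall a, (rvl a)^F *m p = 0}.
  move=> a aA; rewrite -scE// /p colE mulmxA PA// mul0mx//.
have [pos|/forallPn[k0]] := boolP [forall k, 0 <= p k 0].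
  have solp : sol p by split=> //; apply/forallP.
  pose k := [arg max_(i > j) p i 0]%O.
  have kmax i : p i 0 <= p k 0 by rewrite /k; case: Order.TotalTheory.arg_maxP => // l _; apply.
  have pk0 : 0 < p k 0 by apply: lt_le_trans (kmax j); rewrite pE.
  exists ((p k 0)^-1 *: p); split.
  - by apply: sol_scale => //; rewrite invr_ge0 ltW.
  - by move=> i; rewrite mxE mulrC ler_pdivrMr// mul1r.
  - have [le _] := diag k j; rewrite -pE in le.
    have -> : ((p k 0)^-1 *: p) j 0 = P j j / p k 0 by rewrite [LHS]mxE (pE j) mulrC.
    have pkN : p k 0 != 0 by rewrite gt_eqF.
    have -> : (Delta ix A)%:R * (P j j / p k 0) ^+ 2 =
       ((Delta ix A)%:R * P j j) * (P j j / p k 0 ^+ 2) by field.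
    by apply: mulr_ege1 => //; rewrite ler_pdivlMr ?exprn_gt0// mul1r.
rewrite -ltNge => pk0.
pose Q := [pred i | p i 0 < 0].
pose k := [arg min_(i < k0 | p i 0 < 0) (x i 0 / - p i 0)]%O.
have [pk kmin] : p k 0 < 0 /\ forall i, p i 0 < 0 -> x k 0 / - p k 0 <= x i 0 / - p i 0.
  by rewrite /k; case: Order.TotalTheory.arg_minP => // l h1 h2; split.
(* Ratio test: the longest step along [p] that keeps [x] nonnegative. *)
pose th := x k 0 / - p k 0.
have th0 : 0 <= th by rewrite divr_ge0// oppr_ge0 ltW.
pose x' := x + th *: p.
have x'E i : x' i 0 = x i 0 + th * p i 0 by rewrite !mxE.
have ak : actc c k by apply: contraTT pk => /ps ->; rewrite ltxx.
apply: (IHm x').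
- apply: (@leq_trans #|[set i | x i 0 != 0]|); last by rewrite -ltnS.
  apply: proper_card; apply/properP; split.
    apply/fintype.subsetP => i; rewrite !inE; apply: contra => /eqP xi.
    by rewrite x'E xi add0r ps ?mulr0// actE xi eqxx.
  exists k; first by rewrite inE -actE.
  rewrite inE negbK x'E /th mulrAC -mulrA; apply/eqP; have pkN : p k 0 != 0 by rewrite lt_eqF.
  by field.
- split=> [i|a aA]; last by rewrite mulmxDr xA// -scalemxAr pA// scaler0 addr0.
  rewrite x'E; have [pi|pi] := ltP (p i 0) 0; last by rewrite addr_ge0// mulr_ge0.
  have := kmin i pi; rewrite -/th ler_pdivlMr ?oppr_gt0// mulrN.
  by rewrite -subr_ge0 opprK.
- by rewrite x'E ltr_wpDr// mulr_ge0// pE ltW.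
Qed.

Definition scal_inv (c : seq nat) : Prop :=
  (forall x, sol x -> (forall i, x i 0 <= 1) ->
    forall i : 'I_n, (cap ix A)%:R * x i 0 <= (nth 0%N c i)%:R) /\
  (forall i : 'I_n, nth 0 c i = 0 \/ exists e, nth 0 c i = 2 ^ e)%N.

(** Halving is justified by [perc_cut]. The delicate case is a scale 1 that becomes 0: the
    coordinate must then vanish in every solution. *)
Lemma outer_step_inv c : scal_inv c ->
  ~~ nilp (bad ix c (proj ix A c).1 (perc ix c (proj ix A c).1)) ->
  scal_inv (outer_step ix A c) /\
  (\sum_(i < n) blen (nth 0 (outer_step ix A c) i) < \sum_(i < n) blen (nth 0 c i))%N.
Proof.
move=> [cx c2] nb; rewrite /outer_step (negbTE nb).
set N := (proj ix A c).1 in nb *; set y := perc ix c N in nb *.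
have cap0 : (0 < cap ix A)%N by rewrite capE expn_gt0.
have capf : 0 < (cap ix A)%:R :> F by rewrite ltr0n.
have cut x : sol x -> (forall i, x i 0 <= 1) -> exists j : 'I_n,
    [/\ argmax ix y = j, actc c j & (cap ix A)%:R * x j 0 * 2 <= (nth 0%N c j)%:R].
  move=> solx x1; have [x0 xA] := solx.
  pose x' : 'cV[F]_n := \col_i ((cap ix A)%:R * x i 0 / (nth 0%N c i)%:R).
  have x'c (i : 'I_n) : (nth 0%N c i)%:R * x' i 0 = (cap ix A)%:R * x i 0.
    rewrite mxE; have [ai|] := boolP (actc c i).
      by rewrite mulrC divfK// pnatr_eq0 -lt0n.
    rewrite /actc -leqNgt leqn0 => /eqP c0; rewrite c0 mul0r.
    apply/esym/eqP; rewrite eq_le mulr_ge0 ?ler0n// andbT.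
    by have := cx x solx x1 i; rewrite c0.
  have [] := @perc_cut c x' nb.
  - move=> i; rewrite mxE divr_ge0 ?mulr_ge0 ?ler0n//=.
    have [ai|] := boolP (actc c i); first by rewrite ler_pdivrMr ?ltr0n// mul1r cx.
    by rewrite /actc -leqNgt leqn0 => /eqP ->; rewrite invr0 mulr0.
  - by move=> i; rewrite /actc -leqNgt leqn0 mxE => /eqP ->; rewrite invr0 mulr0.
  - move=> a aA; have := xA a aA => /(congr1 (fun X => (cap ix A)%:R *: X)).
    rewrite scaler0 => <-; apply/matrixP => i j; rewrite !ord1 [LHS]mxE [RHS]mxE [in RHS]mxE.
    rewrite mulr_sumr; apply: eq_bigr => l _; rewrite mxE rvl_scale rmorphM /= -mulrA.
    have -> : ((nth 0%N c l)%:Z)%:~R = (nth 0%N c l)%:R :> F by [].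
    by rewrite x'c [(rvl a)^F 0 l]mxE mulrCA.
  move=> j [am aj le]; exists j; split=> //.
  rewrite -x'c; have c0 : 0 <= (nth 0%N c j)%:R :> F by rewrite ler0n.
  by nra.
(* The chosen index is the same for all solutions; the zero vector, always a solution, produces
   it. *)
have [j [am aj _]] : exists j : 'I_n,
    [/\ argmax ix y = j, actc c j & (cap ix A)%:R * (0 : 'cV[F]_n) j 0 * 2 <= (nth 0%N c j)%:R].
  by apply: cut; [split=> [i|a _]; rewrite ?mxE ?mulmx0|move=> i; rewrite mxE ler01].
have hE (i : 'I_n) : nth 0%N (halve ix c (argmax ix y)) i =
    if i == j then (nth 0%N c i)./2 else nth 0%N c i.
  by rewrite nth_iota_map// am val_eqE.
split; last first.
  rewrite (bigD1 j)//= [X in (_ < X)%N](bigD1 j)//= hE eqxx.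
  rewrite (eq_bigr (fun i : 'I_n => blen (nth 0%N c i))) => [|i /negbTE ni].
    by rewrite ltn_add2r /blen [X in (_ < size X)%N]bitsS.
  by rewrite hE ni.
split; last first.
  move=> i; rewrite hE; case: eqP => [->|_]; last exact: c2.
  have [->|[e ->]] := c2 j; first by left.
  case: e => [|e]; first by left.
  by right; exists e; rewrite expnS mul2n doubleK.
move=> x solx x1 i; rewrite hE; case: eqP => [->|_]; last exact: cx.
have [j' [am' _]] := cut x solx x1.
have -> : j' = j by apply/val_inj; rewrite /= -am' am.
have [c0|[[|e] ce]] := c2 j; first by move: aj; rewrite /actc c0.
- rewrite ce => le; have [solx0 _] := solx.
  suff -> : x j 0 = 0 by rewrite mulr0.
  apply/eqP; rewrite eq_le solx0 andbT leNgt; apply/negP => xj.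
  (* A positive [x_j] would yield a solution in the unit box with [Delta x'_j^2 >= 1], while the cut
     gives [cap x'_j <= 1/2] and [cap^2 >= Delta]. *)
  have [x' [solx' x'1 x'j]] := sol_lower solx xj.
  have [j2 [am2 _]] := cut x' solx' x'1.
  have -> : j2 = j by apply/val_inj; rewrite /= -am2 am.
  rewrite ce => le'; have [x'0 _] := solx'; have x'j0 := x'0 j.
  have h1 : (Delta ix A)%:R <= (cap ix A)%:R ^+ 2 :> F.
    rewrite -natrX ler_nat capE; apply: (leq_trans (ltnW (blen_lt _))).
    by rewrite -expnM leq_exp2l// leq_pmulr.
  have h2 : ((cap ix A)%:R * x' j 0) ^+ 2 <= 2^-1 ^+ 2.
    rewrite ler_pXn2r// ?nnegrE ?mulr_ge0 ?ler0n ?invr_ge0//; lra.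
  have : 1 <= ((cap ix A)%:R * x' j 0) ^+ 2.
    by apply: le_trans x'j _; rewrite exprMn ler_wpM2r// sqr_ge0.
  lra.
- by rewrite ce expnS natrM mul2n doubleK; lra.
Qed.

(** Either some round succeeds, after which the scales stay fixed, or the total bit length runs down
    to 0; then no coordinate is active and success is vacuous. *)
Lemma scalingP : scal_inv (scaling ix A) /\
  nilp (bad ix (scaling ix A) (proj ix A (scaling ix A)).1
     (perc ix (scaling ix A) (proj ix A (scaling ix A)).1)).
Proof.
pose c0 := [seq cap ix A | _ <- ix].
pose good c := nilp (bad ix c (proj ix A c).1 (perc ix c (proj ix A c).1)).
have c0E (i : 'I_n) : nth 0%N c0 i = cap ix A by rewrite nth_iota_map.
pose phi c := (\sum_(i < n) blen (nth 0 c i))%N.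
have H (s : seq bool) : let c := foldl (fun c _ => outer_step ix A c) c0 s in
    scal_inv c /\ (good c \/ (phi c + size s <= phi c0)%N).
  elim/last_ind: s => [|s b].
    split; last by right; rewrite addn0.
    split=> [x _ x1 i|i]; rewrite c0E.
      by rewrite ler_piMr.
    by right; exists (blen (Delta ix A)); exact: capE.
  rewrite foldl_rcons size_rcons; set c := foldl _ _ _ => -[ic gc].
  have [g|ng] := boolP (good c).
    by rewrite /outer_step -/(good c) g; split=> //; left.
  have [h1 h2] := outer_step_inv ic ng; split=> //; right.
  case: gc => [|gc]; first by rewrite (negbTE ng).
  by move: h2 gc; rewrite -/(phi _) -/(phi _); lia.
have [h1 h2] := H (rounds ix A); split=> //.
case: h2 => // h2; set c := foldl _ _ _ in h2.
have szr : size (rounds ix A) = (n * (blen (Delta ix A)).+1)%N.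
  by rewrite /rounds size_flatten_const size_iota.
have p0 : phi c0 = (n * (blen (Delta ix A)).+1)%N.
  rewrite /phi; under eq_bigr do rewrite c0E capE.
  rewrite sum_nat_const card_ord; congr (_ * _)%N.
  by rewrite blenE (@up_log_eq 2 (blen (Delta ix A)))// ltnS leqnn /= expnS; have := expn_gt0 2 (blen (Delta ix A)); lia.
have : (phi c == 0)%N by move: h2; rewrite szr p0; lia.
rewrite sum_nat_eq0 => /forallP c_eq0.
have -> : scaling ix A = c by [].
rewrite /nilp /bad size_filter.
rewrite eqn0Ngt -has_count; apply/hasPn => i; rewrite mem_iota add0n => /andP[_ lti].
have := c_eq0 (Ordinal lti); rewrite /= => /eqP b0.
have : (nth 0 c i < 2 ^ blen (nth 0 c i))%N by exact: blen_lt.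
by rewrite b0 expn0 ltnS leqn0 => /eqP ->.
Qed.

(** The field [F] is arbitrary while the test is an integer computation, so the answer is the same
    over the rationals and over the reals. *)
Lemma kerposP J : kerpos ix A J <->
  exists x, sol x /\ forall i : 'I_n, nth false J i -> 0 < x i 0.
Proof.
have [[ix1 _] /bad_nil_sol[x [solx xpos]]] := scalingP; split.
  move=> /allP H; exists x; split=> // i Ji; rewrite xpos.
  by have := H i; rewrite mem_iota leq0n add0n ltn_ord Ji; apply.
move=> [z [solz zpos]]; apply/allP => j; rewrite mem_iota add0n => /andP[_ ltj].
rewrite -implybE; apply/implyP => Jj; have zj := zpos (Ordinal ltj) Jj.
have [z0 _] := solz.
(* Brings [z] into the unit box, where the scales bound every solution. *)
pose k := (1 + \sum_i z i 0)^-1.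
have s0 : 0 <= \sum_i z i 0 by apply: sumr_ge0.
have k0 : 0 < k by rewrite invr_gt0 ltr_wpDr.
have := ix1 (k *: z) (sol_scale (ltW k0) solz) _ (Ordinal ltj).
rewrite mxE => h; rewrite -(ltr0n F); apply: lt_le_trans (h _).
  by rewrite !mulr_gt0// ltr0n capE expn_gt0.
move=> i; rewrite mxE mulrC ler_pdivrMr ?ltr_wpDr// mul1r (bigD1 i)//=.
by rewrite addrCA lerDl addr_ge0// sumr_ge0.
Qed.

End correctness.

(** * The running time of the kernel algorithm *)

Local Open Scope nat_scope.

Lemma esz_seq_le (T : encType) (s : seq T) B :
  (forall x0 i, i < size s -> esz (nth x0 s i) <= B) -> esz s <= 1 + size s * B.+1.
Proof.
by move=> H; have := @esz_map _ _ id s B; rewrite map_id; apply => i x0; exact: H.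
Qed.

Section kerpos_pt.
Variables (T : encType) (mu : T -> nat).

Lemma PT_dotz (f : T -> seq nat) (g h : T -> seq int) :
  PT mu f -> PT mu g -> PT mu h -> PT mu (fun x => dotz (f x) (g x) (h x)).
Proof. by apply: PT_app3; rewrite /dotz; pt. Qed.

Lemma PT_scale_row (f : T -> seq nat) (g : T -> seq nat) (h : T -> seq int) :
  PT mu f -> PT mu g -> PT mu h -> PT mu (fun x => scale_row (f x) (g x) (h x)).
Proof. by apply: PT_app3; rewrite /scale_row; pt. Qed.

End kerpos_pt.

Lemma PT_mulmv (T : encType) (mu : T -> nat) (f : T -> seq nat) (g : T -> seq (seq int)) (h : T -> seq int) :
  PT mu f -> PT mu g -> PT mu h -> PT mu (fun x => mulmv (f x) (g x) (h x)).
Proof.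
by apply: PT_app3; rewrite /mulmv; pt; apply: PT_dotz; pt.
Qed.

Lemma PT_proj_row (T : encType) (mu : T -> nat) (f : T -> seq nat)
    (g : T -> seq (seq int) * int) (h : T -> seq int) :
  PT mu f -> PT mu g -> PT mu h -> PT mu (fun x => proj_row (f x) (g x) (h x)).
Proof.
apply: PT_app3; rewrite /proj_row.
apply: (PT_let (f := fun q : seq nat * (seq (seq int) * int) * seq int => mulmv q.1.1 q.1.2.1 q.2)
  (g := fun q u => proj_upd q.1.1 q.1.2 u (dotz q.1.1 q.2 u))).
  by apply: PT_mulmv; pt.
apply: (PT_let (f := fun q : seq nat * (seq (seq int) * int) * seq int * seq int => dotz q.1.1.1 q.1.2 q.2)
  (g := fun q z => proj_upd q.1.1.1 q.1.1.2 q.2 z)).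
  by apply: PT_dotz; pt.
by rewrite /proj_upd; pt.
Qed.

Lemma proj_shape ix A c : exists f : nat -> nat -> int,
  (proj ix A c).1 = [seq [seq f i j | j <- ix] | i <- ix].
Proof.
elim/last_ind: A => [|A a [f IH]]; first by eexists.
rewrite /proj foldl_rcons -/(proj ix A c) /proj_row /proj_upd; case: ifP => _.
  by exists f.
by eexists.
Qed.

(** Entries of a projector have absolute value at most 1, so the denominator bounds the whole
    integer matrix. *)
Lemma proj_le n A c i j (s := proj (iota 0 n) A c) : i < n -> j < n ->
  [/\ `|nth 0%R (nth [::] s.1 i) j| <= `|s.2| &
   `|s.2| <= \prod_(d <- [seq `|(1 + dotz (iota 0 n) (scale_row (iota 0 n) c a)
      (scale_row (iota 0 n) c a))%R| | a <- A]) d].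
Proof.
move=> lti ltj; have [P [[PT' PP d0 _] [[_ NP _ _] [_ dle]]]] := projP rat n A c.
split.
  have /matrixP/(_ (Ordinal lti) (Ordinal ltj)) := NP; rewrite !mxE /= => e.
  have [h1 /andP[_ h2]] := proj_diag_le PT' PP (Ordinal lti) (Ordinal ltj).
  have h : (`|P (Ordinal lti) (Ordinal ltj)| <= 1 :> rat)%R.
    by rewrite -(@ler_pXn2r _ 2)// ?nnegrE// expr1n real_normK ?num_real// (le_trans h1).
  rewrite -lez_nat !abszE -(ler_int rat) !intr_norm e normrM.
  by rewrite ler_piMr.
rewrite -lez_nat abszE gtr0_norm//; apply: le_trans dle _.
rewrite big_map; elim: A {s d0 NP} => [|a A IHA]; first by rewrite !big_nil.
rewrite !big_cons PoszM abszE; apply: ler_pM => //; last exact: ler_norm.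
- by rewrite addr_ge0// dotzE sumr_ge0// => k _; rewrite -expr2 sqr_ge0.
- apply: prodr_ge0 => b _.
  by rewrite addr_ge0// dotzE sumr_ge0// => k _; rewrite -expr2 sqr_ge0.
Qed.

Lemma blen_prod (s : seq nat) : blen (\prod_(d <- s) d) <= esz s.
Proof.
elim: s => [|z s IHs]; first by rewrite big_nil.
rewrite big_cons esz_cons; apply: leq_trans (blenM _ _) _.
by have := blen_esz z; elia.
Qed.

Lemma esz_proj n A c : esz (proj (iota 0 n) A c) <= 10 + 4 * esz [seq `|(1 + dotz (iota 0 n)
    (scale_row (iota 0 n) c a) (scale_row (iota 0 n) c a))%R| | a <- A]
  + n * (2 + n * (6 + 4 * esz [seq `|(1 + dotz (iota 0 n)
    (scale_row (iota 0 n) c a) (scale_row (iota 0 n) c a))%R| | a <- A])).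
Proof.
set L := [seq _ | a <- A]; set s := proj _ _ _.
have hd : blen `|s.2| <= esz L.
  case: n @L @s => [|n] L s; last first.
    have [_ h] := @proj_le n.+1 A c 0 0 isT isT.
    exact: leq_trans (leq_blen h) (blen_prod L).
  (* With no coordinates every [q] is an empty sum, so the denominator stays 1. *)
  suff -> : s.2 = 1%R by apply: leq_trans (esz_gt0 L).
  rewrite /s /proj; elim/last_ind: (A) => // B b IH.
  rewrite foldl_rcons /proj_row /proj_upd; set t := foldl _ _ _ in IH *.
  by rewrite {1}/dotz /= big_nil eqxx.
have [f fE] := proj_shape (iota 0 n) A c.
have hN : esz s.1 <= 1 + n * (2 + n * (6 + 4 * esz L)).
  have row i : i < n -> esz [seq f i j | j <- iota 0 n] <= 1 + n * (6 + 4 * esz L).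
    move=> lti; apply: leq_trans (@esz_map _ _ (f i) _ (5 + 4 * esz L) _) _; last first.
      by rewrite size_iota.
    move=> j x0; rewrite size_iota => ltj; rewrite nth_iota// add0n.
    have [h _] := @proj_le n A c i j lti ltj; rewrite fE in h.
    rewrite (nth_iota_map [::]) ?nth_iota_map// in h.
    by apply: leq_trans (esz_int _) _; have := leq_blen h; have := hd; rewrite /s; lia.
  rewrite /s fE; apply: leq_trans (@esz_map _ _ _ _ (1 + n * (6 + 4 * esz L)) _) _; last first.
    by rewrite size_iota.
  by move=> i x0; rewrite size_iota => lti; rewrite nth_iota// add0n; exact: row.
have -> : esz s = (esz s.1 + esz s.2).+1 by case: (s) => u v; rewrite esz_pair.
by have := esz_int s.2; lia.
Qed.

Lemma PT_proj (T : encType) (mu : T -> nat) (f : T -> seq bool) (g : T -> seq (seq int)) (h : T -> seq nat) :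
  PT mu f -> PT mu g -> PT mu h ->
  PT mu (fun x => proj (iota 0 (size (f x))) (g x) (h x)).
Proof.
apply: (PT_app3 (g := fun l A c => proj (iota 0 (size l)) A c)); rewrite /proj.
have HL : PT esz (fun q : seq bool * seq (seq int) * seq nat => [seq `|(1 + dotz (iota 0 (size q.1.1))
    (scale_row (iota 0 (size q.1.1)) q.2 a) (scale_row (iota 0 (size q.1.1)) q.2 a))%R| | a <- q.1.2]).
  by pt; apply: PT_dotz; pt; apply: PT_scale_row; pt.
apply: (PT_foldl (step := fun q s a => proj_row (iota 0 (size q.1.1)) s (scale_row (iota 0 (size q.1.1)) q.2 a))
  (a0 := fun q : seq bool * seq (seq int) * seq nat => proj0 (iota 0 (size q.1.1)) q.2)).
- by pt.
- by rewrite /proj0; pt.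
- by apply: PT_proj_row; pt; apply: PT_scale_row; pt.
have [_ hL _] := HL.
have hs : pb esz (fun q : seq bool * seq (seq int) * seq nat => size q.1.1).
  apply: (@pb_le _ _ _ esz) => [[[l A] c]|]; last exact: adq_esz.
  by rewrite /= !esz_pair; have := size_esz l; elia.
set L := (fun q => esz _) in hL.
exists (fun q => 10 + 4 * L q + size q.1.1 * (2 + size q.1.1 * (6 + 4 * L q))); first by pb.
move=> [[l A] c] i _ /=; rewrite -/(proj _ _ _).
apply: leq_trans (esz_proj _ _ _) _.
have hl : esz [seq `|(1 + dotz (iota 0 (size l)) (scale_row (iota 0 (size l)) c a)
    (scale_row (iota 0 (size l)) c a))%R| | a <- take i A] <= L (l, A, c).
  by rewrite map_take; exact: esz_take.
by rewrite leq_add// ?leq_add2l ?leq_mul2l// !(leq_add2l, leq_mul2l) hl !orbT.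
Qed.

Lemma PT_bad (T : encType) (mu : T -> nat) (f c : T -> seq nat) (N : T -> seq (seq int)) (y : T -> seq nat) :
  PT mu f -> PT mu c -> PT mu N -> PT mu y ->
  PT mu (fun x => bad (f x) (c x) (N x) (y x)).
Proof.
move=> Hf Hc HN Hy.
apply: (PT_app2 (g := fun u v => bad u.1 u.2 v.1 v.2) (f := fun x => (f x, c x)) (h := fun x => (N x, y x))).
- rewrite /bad /posy; pt; apply: PT_dotz; pt.
- by pt.
- by pt.
Qed.

Ltac pt_hook2 ::= first [simple apply PT_dotz | simple apply PT_bad | simple apply PT_scale_row | simple apply PT_proj].

Definition bounded n B (y : seq nat) := size y = n /\ forall i, nth 0 y i <= B.

Lemma esz_bounded n B y : bounded n B y -> esz y <= 1 + n * (2 + 4 * blen B).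
Proof.
move=> [<- h]; apply: leq_trans (@esz_seq_le _ _ (1 + 4 * blen B) _) _ => //.
move=> x0 i lti; apply: leq_trans (esz_nat _) _.
by rewrite leq_add2l leq_mul2l /=; apply: leq_blen; rewrite (set_nth_default 0).
Qed.

Lemma bounded_map n B (f : nat -> nat) : (forall i, f i <= B) -> bounded n B [seq f i | i <- iota 0 n].
Proof.
move=> h; split=> [|i]; first by rewrite size_map size_iota.
have [lti|gei] := ltnP i n; first by rewrite nth_iota_map.
by rewrite nth_default// size_map size_iota.
Qed.

(** Each step raises one entry by at most 1. As in [proj_le], the bound holds for arbitrary data,
    because [PT] speaks of all inputs. *)
Lemma bounded_perc n c N s : bounded n (size s)
  (foldl (fun y (_ : unit) => perc_step (iota 0 n) c N y) [seq 0 | _ <- iota 0 n] s).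
Proof.
elim/last_ind: s => [|s a]; first exact: (@bounded_map n 0 (fun=> 0)).
rewrite foldl_rcons size_rcons; set y := foldl _ _ _ => -[h1 h2].
rewrite /perc_step; case: ifP => _; first by split=> // i; exact: leqW.
by apply: bounded_map => i; case: ifP => _; rewrite ?ltnS// leqW.
Qed.

Lemma pb_blen_sq T (mu s : T -> nat) : pb mu s -> pb mu (fun x => 1 + s x * (2 + 4 * (4 * s x ^ 3))).
Proof.
move=> h; apply: (@pb_le _ _ _ (fun x => 1 + s x * (2 + 4 * (4 * (s x * (s x * s x)))))); last by pb.
by move=> x; rewrite !expnS expn0 muln1.
Qed.

Lemma PT_perc (T : encType) (mu : T -> nat) (f : T -> seq bool) (c : T -> seq nat) (N : T -> seq (seq int)) :
  PT mu f -> PT mu c -> PT mu N ->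
  PT mu (fun x => perc (iota 0 (size (f x))) (c x) (N x)).
Proof.
apply: (PT_app3 (g := fun l c N => perc (iota 0 (size l)) c N)); rewrite /perc.
apply: (PT_foldl (step := fun (q : seq bool * seq nat * seq (seq int)) y (_ : unit) =>
    perc_step (iota 0 (size q.1.1)) q.1.2 q.2 y)
  (a0 := fun q : seq bool * seq nat * seq (seq int) => [seq 0 | _ <- iota 0 (size q.1.1)])
  (l := fun q => ticks (iota 0 (size q.1.1)))).
- by rewrite /ticks; pt.
- by pt.
- by rewrite /perc_step /incr; pt.
exists (fun q => 1 + size q.1.1 * (2 + 4 * (4 * size q.1.1 ^ 3))).
  apply: pb_blen_sq; apply: (@pb_le _ _ _ esz) => [[[l A] d]|]; last exact: adq_esz.
  by rewrite /= !esz_pair; have := size_esz l; elia.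
move=> [[l d] A] i lei /=; apply: leq_trans (esz_bounded (bounded_perc _ _ _ _)) _.
rewrite leq_add2l leq_mul2l leq_add2l leq_mul2l /=; apply/orP; right.
apply: (leq_trans (blenn _)); move: lei; rewrite /= size_ticks => lei.
by rewrite size_take_min geq_min size_ticks leqnn orbT.
Qed.

Lemma PT_outer_step (T : encType) (mu : T -> nat) (f : T -> seq bool) (A : T -> seq (seq int)) (c : T -> seq nat) :
  PT mu f -> PT mu A -> PT mu c ->
  PT mu (fun x => outer_step (iota 0 (size (f x))) (A x) (c x)).
Proof.
apply: (PT_app3 (g := fun l A c => outer_step (iota 0 (size l)) A c)); rewrite /outer_step.
pose X := (seq bool * seq (seq int) * seq nat)%type.
apply: (PT_let (f := fun q : X => (proj (iota 0 (size q.1.1)) q.1.2 q.2).1)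
  (g := fun q N => if nilp (bad (iota 0 (size q.1.1)) q.2 N (perc (iota 0 (size q.1.1)) q.2 N)) then q.2
    else halve (iota 0 (size q.1.1)) q.2 (argmax (iota 0 (size q.1.1)) (perc (iota 0 (size q.1.1)) q.2 N)))).
  by apply: PT_fst; apply: PT_proj; pt.
apply: (PT_let (f := fun q : X * seq (seq int) => perc (iota 0 (size q.1.1.1)) q.1.2 q.2)
  (g := fun q y => if nilp (bad (iota 0 (size q.1.1.1)) q.1.2 q.2 y) then q.1.2
    else halve (iota 0 (size q.1.1.1)) q.1.2 (argmax (iota 0 (size q.1.1.1)) y))).
  by apply: PT_perc; pt.
by rewrite /halve /argmax; pt.
Qed.

Lemma bounded_scaling n A s : bounded n (cap (iota 0 n) A)
  (foldl (fun c (_ : bool) => outer_step (iota 0 n) A c) [seq cap (iota 0 n) A | _ <- iota 0 n] s).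
Proof.
elim/last_ind: s => [|s a].
  by apply: (@bounded_map n _ (fun=> cap (iota 0 n) A)).
rewrite foldl_rcons; set c := foldl _ _ _ => -[h1 h2].
rewrite /outer_step; case: ifP => _; first by split.
apply: bounded_map => i; case: ifP => _ //.
by apply: leq_trans (h2 i); rewrite -divn2 leq_div.
Qed.

Lemma PT_Delta (T : encType) (mu : T -> nat) (f : T -> seq nat) (A : T -> seq (seq int)) :
  PT mu f -> PT mu A -> PT mu (fun x => Delta (f x) (A x)).
Proof.
apply: PT_app2; rewrite /Delta; pt; apply: PT_dotz; pt.
Qed.

Lemma blen_exp2 k : blen (2 ^ k) <= k.+1.
Proof. by apply: blen_min; rewrite ltn_exp2l. Qed.

Lemma PT_cap (T : encType) (mu : T -> nat) (f : T -> seq nat) (A : T -> seq (seq int)) :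
  PT mu f -> PT mu A -> PT mu (fun x => cap (f x) (A x)).
Proof.
apply: PT_app2; rewrite /cap.
have HD : PT esz (fun q : seq nat * seq (seq int) => bits (Delta q.1 q.2)).
  by apply: PT_bits; apply: PT_Delta; pt.
have [_ hD _] := HD.
apply: (PT_foldl (step := fun _ k (_ : bool) => k + k) (a0 := fun=> 1) HD).
- by pt.
- by pt.
exists (fun q => 5 + 4 * esz (bits (Delta q.1 q.2))); first by pb.
move=> q i _; set s := take _ _.
have -> : foldl (fun k (_ : bool) => k + k) 1 s = 2 ^ size s.
  have H k : foldl (fun k (_ : bool) => k + k) k s = k * 2 ^ size s.
    by elim: (s) k => [|b t IHt] k /=; rewrite ?muln1// IHt expnS mulnA addnn muln2.
  by rewrite H mul1n.
apply: leq_trans (esz_nat _) _; have := blen_exp2 (size s).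
have := size_esz (bits (Delta q.1 q.2)).
by rewrite /s size_take_min; elia.
Qed.

Lemma PT_kerpos (T : encType) (mu : T -> nat) (A : T -> seq (seq int)) (J : T -> seq bool) :
  PT mu A -> PT mu J -> PT mu (fun x => kerpos (iota 0 (size (J x))) (A x) (J x)).
Proof.
apply: (PT_app2 (g := fun A J => kerpos (iota 0 (size J)) A J)); rewrite /kerpos.
pose X := (seq (seq int) * seq bool)%type.
apply: (PT_let (f := fun q : X => scaling (iota 0 (size q.2)) q.1)
  (g := fun q s => all (fun j => ~~ nth false q.2 j || (0 < nth 0 s j)) (iota 0 (size q.2)))); last by pt.
rewrite /scaling.
have Hc : PT esz (fun q : X => cap (iota 0 (size q.2)) q.1) by apply: PT_cap; pt.
have [_ hc _] := Hc.
apply: (PT_foldl (step := fun (q : X) c (_ : bool) => outer_step (iota 0 (size q.2)) q.1 c)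
  (a0 := fun q : X => [seq cap (iota 0 (size q.2)) q.1 | _ <- iota 0 (size q.2)])
  (l := fun q : X => rounds (iota 0 (size q.2)) q.1)).
- by rewrite /rounds; pt; apply: PT_Delta; pt.
- apply: (PT_let (g := fun (q : X) c => [seq c | _ <- iota 0 (size q.2)]) Hc); by pt.
- by apply: PT_outer_step; pt.
exists (fun q => 1 + size q.2 * (2 + 4 * esz (cap (iota 0 (size q.2)) q.1))).
  have hs : pb esz (fun q : X => size q.2); last by pb.
  apply: (@pb_le _ _ _ esz) => [[B l]|]; last exact: adq_esz.
  by rewrite /= !esz_pair; have := size_esz l; elia.
move=> [B l] i _ /=; apply: leq_trans (esz_bounded (bounded_scaling _ _ _)) _.
rewrite leq_add2l leq_mul2l leq_add2l leq_mul2l /=; apply/orP; right.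
exact: ltnW (blen_esz _).
Qed.

Import numFieldNormedType.Exports.

(** * Reachability probabilities and flows *)

Local Open Scope ring_scope.

(** * Farkas' lemma *)

Section farkas.
Variables (R : realFieldType) (m : nat).
Implicit Types (a b w : 'rV[R]_m) (u : 'cV[R]_m).

Definition pair w u : R := (w *m u) 0 0.

Lemma pairBl w w' u : pair (w - w') u = pair w u - pair w' u.
Proof. by rewrite /pair mulmxBl !mxE. Qed.
Lemma pairZl k w u : pair (k *: w) u = k * pair w u.
Proof. by rewrite /pair -scalemxAl mxE. Qed.
Lemma pairBr w u u' : pair w (u - u') = pair w u - pair w u'.
Proof. by rewrite /pair mulmxBr !mxE. Qed.
Lemma pairZr k w u : pair w (k *: u) = k * pair w u.
Proof. by rewrite /pair -scalemxAr mxE. Qed.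

Fixpoint incone (s : seq 'rV[R]_m) b : Prop :=
  if s is a :: s' then exists2 t, 0 <= t & incone s' (b - t *: a) else b = 0.

Lemma incone_shift (tau : 'rV[R]_m -> R) a s w : {in s, forall c, 0 <= tau c} ->
  incone [seq c + tau c *: a | c <- s] w -> exists2 t, 0 <= t & incone s (w - t *: a).
Proof.
elim: s w => [|c s IHs] w h /=; first by move=> ->; exists 0 => //; rewrite scale0r subrr.
move=> [x x0 /IHs[|t t0 H]].
  by move=> d ds; apply: h; rewrite inE ds orbT.
exists (x * tau c + t); first by rewrite addr_ge0 ?mulr_ge0 ?h ?mem_head.
exists x => //; move: H; congr incone.
rewrite scalerDr scalerDl scalerA !opprD !addrA.
by rewrite [RHS]addrAC [w - _ - x *: c]addrAC.
Qed.

(** If the separator [u] of the other generators is negative on [a], every vector is sheared along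
    [a] into the hyperplane orthogonal to [u], and the induction hypothesis is used again there.
    [incone_shift] and the corrected separator [u2] translate the two outcomes back. *)
Lemma farkas_seq n s b : size s = n ->
  incone s b \/ exists2 u, {in s, forall a, 0 <= pair a u} & pair b u < 0.
Proof.
elim: n s b => [|n IHn] [|a s] b //= => [_|[sn]].
  have [->|b0] := eqVneq b 0; first by left.
  right; exists (- b^T) => //; rewrite /pair mulmxN mxE oppr_lt0.
  have := sqr_norm_ge0 b^T; rewrite trmxK le_eqVlt => /predU1P[e|//].
  by have := sqr_norm_eq0 (v := b^T); rewrite trmxK -e => /(_ erefl)/eqP; rewrite trmx_eq0 (negbTE b0).
have [H|[u us ub]] := IHn s b sn.
  by left; exists 0 => //; rewrite scale0r subr0.
have [au|au] := leP 0 (pair a u).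
  by right; exists u => // c; rewrite inE => /predU1P[->|/us].
pose tau c := - (pair c u / pair a u).
pose b' := b + tau b *: a.
have [H|[u' us' ub']] := IHn [seq c + tau c *: a | c <- s] b' (etrans (size_map _ _) sn).
  have [c cs|t t0 Ht] := incone_shift _ H.
    by rewrite /tau -mulrN -invrN mulr_ge0 ?us// invr_ge0 oppr_ge0 ltW.
  left; exists (t - tau b).
    by rewrite /tau opprK addr_ge0// mulr_le0 ?invr_le0 ?ltW.
  by move: Ht; congr incone; rewrite /b' scalerBl opprB addrA.
right; pose u2 := u' - (pair a u' / pair a u) *: u.
have aN0 : pair a u != 0 by rewrite lt_eqF.
have u2E w : pair w u2 = pair (w + tau w *: a) u'.
  have -> : w + tau w *: a = w - (- tau w) *: a by rewrite scaleNr opprK.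
  by rewrite pairBl pairZl pairBr pairZr /tau opprK; congr (_ - _); field.
exists u2; last by rewrite u2E.
move=> c; rewrite inE => /predU1P[->|cs]; last by rewrite u2E; apply: us'; exact: map_f.
by rewrite u2E /tau divff// scaleN1r subrr /pair mul0mx mxE.
Qed.

End farkas.

Lemma farkas (R : realFieldType) (I J : finType) (A : I -> J -> R) (b : I -> R) :
  (exists2 x : J -> R, (forall j, 0 <= x j) & forall i, \sum_j A i j * x j = b i) \/
  (exists2 u : I -> R, (forall j, 0 <= \sum_i u i * A i j) & \sum_i u i * b i < 0).
Proof.
pose vec (f : I -> R) : 'rV[R]_#|I| := \row_k f (enum_val k).
pose col j := vec (A^~ j).
have pairE (f : I -> R) (u : 'cV[R]_#|I|) :
    pair (vec f) u = \sum_i u (enum_rank i) 0 * f i.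
  rewrite /pair mxE (reindex enum_rank) /=; last by apply: onW_bij; exact: enum_rank_bij.
  by apply: eq_bigr => i _; rewrite mxE enum_rankK mulrC.
have [H|[u us ub]] := farkas_seq (vec b) (erefl (size [seq col j | j <- enum J])).
  left.
  have K s w : uniq s -> incone [seq col j | j <- s] w -> exists2 x : J -> R,
      (forall j, 0 <= x j) & w = \sum_(j <- s) x j *: col j.
    elim: s w => [|j s IHs] w /=.
      by move=> _ ->; exists (fun=> 0) => //; rewrite big_nil.
    move=> /andP[js us] [t t0 /(IHs _ us)[x x0 e]].
    exists (fun k => if k == j then t else x k); first by move=> k; case: ifP.
    rewrite big_cons eqxx -[LHS](subrK (t *: col j)) e addrC; congr (_ + _).
    rewrite big_seq [RHS]big_seq; apply: eq_bigr => k ks.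
    by case: eqP => // kj; rewrite -kj ks in js.
  have [x x0 e] := K _ _ (enum_uniq _) H.
  exists x => // i; have /rowP/(_ (enum_rank i)) := e; rewrite mxE enum_rankK => ->.
  rewrite summxE big_enum /=; apply: eq_bigr => j _.
  by rewrite !mxE enum_rankK mulrC.
right; exists (fun i => u (enum_rank i) 0); last by rewrite -pairE.
by move=> j; rewrite -(pairE (A^~ j)); apply: us; apply/mapP; exists j; rewrite ?mem_enum.
Qed.

(** * Expectations, flows and schedulers on the unfolding *)

Section unfolding.
Variables (R : realType) (M : mdp) (G : finType) (T : G -> {set state M}).

Definition ustate : finType := (state M * {set G})%type.
Definition uinit (s : state M) : ustate := (s, [set g | s \in T g]).
Definition unext (u : ustate) (s : state M) : ustate := (s, u.2 :|: [set g | s \in T g]).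
Definition uhist (s : state M) (h : history M) : ustate :=
  foldl (fun u p => unext u p.2) (uinit s) h.

Lemma uhist_rcons s h a s' : uhist s (rcons h (a, s')) = unext (uhist s h) s'.
Proof. by rewrite /uhist foldl_rcons. Qed.

Lemma uhist1 s h : (uhist s h).1 = last_state s h.
Proof.
elim/last_ind: h => // h [a s'] _.
by rewrite uhist_rcons /last_state /unzip2 map_rcons last_rcons.
Qed.

Lemma is_path_rcons (t : state M) h a s' :
  is_path t (rcons h (a, s')) = is_path t h && (0 < trans (last_state t h) a s').
Proof. by elim: h t => [|[a1 s1] h IHh] t /=; rewrite ?andbT// IHh andbA. Qed.

Definition trR (t : state M) a t' : R := ratr (trans t a t').

Lemma trR_ge0 t a t' : 0 <= trR t a t'.
Proof. by rewrite /trR ler0q; have /andP[] := trans_itv t a t'. Qed.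

Lemma trR_gt0 t a t' : (0 < trR t a t') = (0 < trans t a t').
Proof. exact: ltr0q. Qed.

Lemma trR_sum t a : enabled t a -> \sum_t' trR t a t' = 1.
Proof. by move=> /eqP e; rewrite -raddf_sum /= e rmorph1. Qed.

Lemma trR_sum0 t a : ~~ enabled t a -> forall t', trR t a t' = 0.
Proof.
rewrite /enabled; have [->|e] := trans_sum t a; first by rewrite eqxx.
move=> _ t'; rewrite /trR; have /eqP := e; rewrite psumr_eq0 => [/allP h|i _].
  by have /eqP -> := h t' (mem_index_enum _); rewrite rmorph0.
by have /andP[] := trans_itv t a i.
Qed.

Section scheduler.
Variables (sigma : scheduler R M) (s : state M).

(** Expectation of [f] over the extensions of [h] by [N] steps as a finite recursion, which keeps
    measure theory out of most arguments. *)
Fixpoint ex (N : nat) (h : history M) (f : history M -> R) : R :=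
  if N is N'.+1 then
    \sum_a sigma s h a * \sum_s' trR (last_state s h) a s' * ex N' (rcons h (a, s')) f
  else f h.

Lemma ex_le N h (f g : history M -> R) : is_path s h ->
  (forall h, is_path s h -> f h <= g h) -> ex N h f <= ex N h g.
Proof.
move=> hP fg; elim: N h hP => [|N IHN] h hP /=; first exact: fg.
apply: ler_sum => a _; apply: ler_wpM2l; first exact: (sched_ge0 sigma hP).
apply: ler_sum => s' _; have [->|p0] := eqVneq (trR (last_state s h) a s') 0.
  by rewrite !mul0r.
apply: ler_wpM2l; first exact: trR_ge0.
by apply: IHN; rewrite is_path_rcons hP -trR_gt0 lt_neqAle eq_sym p0 trR_ge0.
Qed.

Lemma exD N h f g : ex N h (fun h => f h + g h) = ex N h f + ex N h g.
Proof.
elim: N h => [|N IHN] h //=; rewrite -big_split /=; apply: eq_bigr => a _.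
rewrite -mulrDr -big_split /=; congr (_ * _); apply: eq_bigr => s' _.
by rewrite IHN mulrDr.
Qed.

Lemma exZ N h k f : ex N h (fun h => k * f h) = k * ex N h f.
Proof.
elim: N h => [|N IHN] h //=; rewrite mulr_sumr; apply: eq_bigr => a _.
rewrite [RHS]mulrCA; congr (_ * _); rewrite mulr_sumr; apply: eq_bigr => s' _.
by rewrite IHN mulrCA.
Qed.

Lemma ex_sum (I : finType) N h (f : I -> history M -> R) :
  ex N h (fun h => \sum_i f i h) = \sum_i ex N h (f i).
Proof.
have ex0 : ex N h (fun=> 0) = 0 by have := exZ N h 0 (fun=> 0); rewrite !mul0r.
elim: (index_enum I) => [|i l IHl].
  by rewrite big_nil -[RHS]ex0; congr ex; apply/funext => k; rewrite big_nil.
rewrite big_cons -IHl -exD; congr ex; apply/funext => k.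
by rewrite big_cons.
Qed.

Lemma ex_cst N h k : is_path s h -> ex N h (fun=> k) = k.
Proof.
elim: N h => [|N IHN] h hP //=.
transitivity (\sum_a sigma s h a * k); last by rewrite -mulr_suml (sched_sum1 sigma hP) mul1r.
apply: eq_bigr => a _.
have [->|sa] := eqVneq (sigma s h a) 0; first by rewrite !mul0r.
congr (_ * _); transitivity (\sum_s' trR (last_state s h) a s' * k).
  apply: eq_bigr => s' _; have [->|p0] := eqVneq (trR (last_state s h) a s') 0.
    by rewrite !mul0r.
  by rewrite IHN// is_path_rcons hP -trR_gt0 lt_neqAle eq_sym p0 trR_ge0.
by rewrite -mulr_suml (trR_sum (sched_enabled hP sa)) mul1r.
Qed.

(** A supermartingale with drift: [phi] loses at least [lam] on average in each step, and the losses
    telescope. *)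
Lemma ex_super N h (phi lam : ustate -> R) : is_path s h ->
  (forall u a, enabled u.1 a ->
     \sum_s' trR u.1 a s' * phi (unext u s') <= phi u - lam u) ->
  ex N h (phi \o uhist s) + \sum_(k < N) ex k h (lam \o uhist s) <= phi (uhist s h).
Proof.
move=> hP sup; elim: N h hP => [|N IHN] h hP; first by rewrite big_ord0 addr0.
rewrite big_ord_recl /= addrCA -lerBrDl.
have -> : \sum_(i < N) \sum_a sigma s h a *
    (\sum_s' trR (last_state s h) a s' * ex i (rcons h (a, s')) (lam \o uhist s)) =
  \sum_a sigma s h a * (\sum_s' trR (last_state s h) a s' *
     \sum_(i < N) ex i (rcons h (a, s')) (lam \o uhist s)).
  rewrite exchange_big /=; apply: eq_bigr => a _; rewrite -mulr_sumr exchange_big /=.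
  by congr (_ * _); apply: eq_bigr => s' _; rewrite mulr_sumr.
rewrite -big_split /=.
apply: (@le_trans _ _ (\sum_a sigma s h a * (phi (uhist s h) - lam (uhist s h)))); last first.
  by rewrite -mulr_suml (sched_sum1 sigma hP) mul1r.
apply: ler_sum => a _; rewrite -mulrDr -big_split /=.
have [->|sa] := eqVneq (sigma s h a) 0; first by rewrite !mul0r.
apply: ler_wpM2l; first exact: (sched_ge0 sigma hP).
have ena := sched_enabled hP sa; rewrite -uhist1 in ena *.
apply: le_trans (sup _ _ ena); apply: ler_sum => s' _; rewrite -mulrDr.
have [->|p0] := eqVneq (trR (uhist s h).1 a s') 0; first by rewrite !mul0r.
apply: ler_wpM2l; first exact: trR_ge0.
rewrite -(uhist_rcons s h a); apply: IHN.
by rewrite is_path_rcons hP -uhist1 -trR_gt0 lt_neqAle eq_sym p0 trR_ge0.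
Qed.

Lemma path_prob_rcons h a s' : path_prob sigma s (rcons h (a, s')) =
  path_prob sigma s h * (sigma s h a * trR (last_state s h) a s').
Proof.
rewrite /path_prob; have H past : path_prob_from sigma s past (rcons h (a, s')) =
  path_prob_from sigma s past h *
    (sigma s (past ++ h) a * trR (last_state s (past ++ h)) a s').
  elim: h past => [|[a1 s1] h IHh] past /=; first by rewrite cats0 mulr1 mul1r.
  by rewrite IHh cat_rcons !mulrA.
exact: H.
Qed.

Definition whist (w : run M) n : history M :=
  mkseq (fun i => ((w i).2, (w i.+1).1)) n.

Lemma measurable_cylinder t h : measurable (cylinder t h : set (run_space M)).
Proof. by apply: sub_sigma_algebra; exists t, h. Qed.

Local Open Scope classical_set_scope.

(** The bridge to the path measure. The event splits into finitely many disjoint pieces, one for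
    each next action and state; measurability is proved along because additivity asks for it. *)
Lemma path_measure_ex N h (Q : history M -> bool) :
  measurable (cylinder s h `&` [set w | Q (whist w (size h + N))] : set (run_space M)) /\
  path_measure sigma s (cylinder s h `&` [set w | Q (whist w (size h + N))]) =
    (path_prob sigma s h * ex N h (fun h => (Q h)%:R))%:E.
Proof.
elim: N h => [|N IHN] h.
  have -> : cylinder s h `&` [set w | Q (whist w (size h + 0))] =
      if Q h then cylinder s h else set0.
    apply/seteqP; split=> w.
      by move=> [[w0 wh]]; rewrite addn0 /= /whist wh => ->.
    by case: ifP => // Qh [w0 wh]; split=> //=; rewrite addn0 /whist wh.
  case: ifP => Qh; last by split=> //=; rewrite Qh mulr0 measure0.
  split; first exact: measurable_cylinder.
  by rewrite /= Qh mulr1 (path_measureP sigma s) eqxx.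
pose F (p : act M * state M) := cylinder s (rcons h p) `&`
  [set w | Q (whist w (size (rcons h p) + N))].
have -> : cylinder s h `&` [set w | Q (whist w (size h + N.+1))] =
    \bigcup_(p in [set` index_enum (act M * state M)%type]) F p.
  apply/seteqP; split=> w.
    move=> [[w0 wh] Qw]; exists ((w (size h)).2, (w (size h).+1).1); first exact: mem_index_enum.
    split; last by rewrite size_rcons /= addSnnS.
    by split=> //; rewrite size_rcons mkseqS wh.
  move=> [p _ [[w0]]]; rewrite size_rcons mkseqS addSnnS => /rcons_inj[wh _] Qw.
  by split.
have mF p : measurable (F p : set (run_space M)) by have [] := IHN (rcons h p).
split; first by apply: fin_bigcup_measurable.
rewrite measure_fin_bigcup//; last first.
  move=> p q _ _ [w [[[_ wp] _] [[_ wq] _]]].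
  by move: wp wq; rewrite !size_rcons !mkseqS => /rcons_inj[_ <-] /rcons_inj[_ <-].
rewrite -fsbig_seq ?index_enum_uniq//.
rewrite (eq_bigr (fun p => (path_prob sigma s (rcons h p) * ex N (rcons h p) (fun h => (Q h)%:R))%:E)).
  rewrite sumEFin; congr _%:E; rewrite /= mulr_sumr.
  pose f a s' := path_prob sigma s (rcons h (a, s')) * ex N (rcons h (a, s')) (fun h => (Q h)%:R).
  rewrite (eq_bigr (fun p => f p.1 p.2)) => [|[a s'] _]//; rewrite -(pair_bigA _ f) /f.
  apply: eq_bigr => a _; rewrite mulrA mulr_sumr; apply: eq_bigr => s' _.
  by rewrite path_prob_rcons !mulrA.
by move=> p _; exact: (IHN (rcons h p)).2.
Qed.

Lemma whistS w n : whist w n.+1 = rcons (whist w n) ((w n).2, (w n.+1).1).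
Proof. exact: mkseqS. Qed.

Lemma uhist_visit w g N : (w 0%N).1 = s ->
  (g \in (uhist s (whist w N)).2) <-> exists2 i, (i <= N)%N & (w i).1 \in T g.
Proof.
move=> w0; elim: N => [|N IHN].
  rewrite /= inE; split=> [sT|[i]]; first by exists 0%N => //; rewrite w0.
  by rewrite leqn0 => /eqP ->; rewrite w0.
rewrite whistS uhist_rcons /= !inE; split.
  move=> /orP[/IHN[i le iT]|iT]; last by exists N.+1.
  by exists i => //; exact: leqW.
move=> [i]; rewrite leq_eqVlt => /predU1P[->|lt] iT; first by rewrite iT orbT.
by apply/orP; left; apply/IHN; exists i.
Qed.

(** Continuity from below: the events of a visit within [N] steps increase to the reachability
    event, up to the null set of runs that start elsewhere. *)
Lemma reach_ex g e : 0 < e -> exists N0, forall N, (N0 <= N)%N ->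
  `|reach_prob sigma s (T g) - ex N [::] (fun h => (g \in (uhist s h).2)%:R)| < e.
Proof.
move=> e0; pose mu := path_measure sigma s.
pose E N : set (run_space M) := cylinder s [::] `&` [set w | g \in (uhist s (whist w (0 + N))).2].
have mE N : measurable (E N) by have [] := path_measure_ex N [::] (fun h => g \in (uhist s h).2).
have muE N : mu (E N) = (ex N [::] (fun h => (g \in (uhist s h).2)%:R))%:E.
  have [_ ->] := path_measure_ex N [::] (fun h => g \in (uhist s h).2).
  by rewrite /path_prob /= mul1r.
pose C : set (run_space M) := cylinder s [::].
have mC : measurable C by exact: measurable_cylinder.
have mev := measurable_eventually (T g).
have UE : \bigcup_N E N = Defs.eventually (T g) `&` C.
  apply/seteqP; split=> w.
    move=> [N _ [[w0 _] /= /(uhist_visit g N w0)[i _ iT]]].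
    by split; [exists i|split].
  move=> [[i iT] [w0 _]]; exists i => //; split=> //=.
  by apply/(uhist_visit g i w0); exists i.
have homoE : {homo E : n m / (n <= m)%N >-> (n <= m)%O}.
  move=> n m le; rewrite subsetEset => w [[w0 w1] /= /(uhist_visit g _ w0)[i lei iT]].
  by split=> //=; apply/(uhist_visit g _ w0); exists i => //; exact: leq_trans le.
have mUE : measurable (\bigcup_N E N) by apply: bigcupT_measurable.
have cv := nondecreasing_cvg_mu mE mUE homoE (mu := mu).
have muC : mu C = 1%E by rewrite /mu (path_measureP sigma s) eqxx.
have evE : mu (Defs.eventually (T g)) = mu (\bigcup_N E N).
  rewrite UE (measureDI mu mev mC) -[RHS]add0e; congr (_ + _)%E.
  apply/eqP; rewrite eq_le measure_ge0 andbT.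
  apply: (@le_trans _ _ (mu (~` C))).
    by apply: le_measure; rewrite ?inE; [exact: measurableD|exact: measurableC|move=> w []].
  by rewrite probability_setC// muC subee.
have fin : mu (Defs.eventually (T g)) \is a fin_num by exact: fin_num_measure.
have cv2 : (mu \o E) x @[x --> \oo] --> (fine (mu (Defs.eventually (T g))))%:E.
  by rewrite fineK// evE; exact: cv.
have cv3 : (fine \o (mu \o E)) x @[x --> \oo] --> fine (mu (Defs.eventually (T g))).
  exact: fine_cvg cv2.
move/cvgrPdist_lt: cv3 => /(_ e e0)[N0 _ H].
exists N0 => N le; have := H N le; rewrite /= muE /=.
by [].
Qed.

End scheduler.

Lemma ex_sched_ext (sigma sigma' : scheduler R M) s N h f :
  (forall h a, sigma s h a = sigma' s h a) -> ex sigma s N h f = ex sigma' s N h f.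
Proof.
move=> e; elim: N h => //= N IHN h; apply: eq_bigr => a _; rewrite e.
by congr (_ * _); apply: eq_bigr => s' _; rewrite IHN.
Qed.

Lemma lim_unique (f : nat -> R) (a b : R) :
  (forall e, 0 < e -> exists N0, forall N, (N0 <= N)%N -> `|a - f N| < e) ->
  (forall e, 0 < e -> exists N0, forall N, (N0 <= N)%N -> `|b - f N| < e) -> a = b.
Proof.
move=> ha hb; apply/eqP; rewrite -subr_eq0 -normr_eq0; apply/negPn/negP => n0.
have e0 : 0 < `|a - b| / 2 by rewrite divr_gt0// lt_neqAle eq_sym n0 normr_ge0.
have [N1 H1] := ha _ e0; have [N2 H2] := hb _ e0.
have := H1 _ (leq_maxl N1 N2); have := H2 _ (leq_maxr N1 N2).
set x := f _ => h2 h1.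
have : `|a - b| <= `|a - x| + `|b - x|.
  by rewrite [`|b - x|]distrC; apply: le_trans (ler_normD _ _); rewrite addrA subrK.
lra.
Qed.

Lemma reach_prob_ext (sigma sigma' : scheduler R M) s g :
  (forall h a, sigma s h a = sigma' s h a) ->
  reach_prob sigma s (T g) = reach_prob sigma' s (T g).
Proof.
move=> e; apply: (@lim_unique (fun N => ex sigma s N [::] (fun h => (g \in (uhist s h).2)%:R))).
  by move=> d d0; exact: reach_ex.
move=> d d0; have [N0 H] := reach_ex sigma' s g d0; exists N0 => N le.
by rewrite (ex_sched_ext _ _ _ e); exact: H.
Qed.

Definition enR (t : state M) a : R := \sum_t' trR t a t'.
(** Balance matrix: a unit of an enabled action [a] at [u] counts 1 for leaving [u] and minus the
    probability of moving to [v]. A disabled action contributes 0 everywhere. *)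
Definition kap (u : ustate) a (v : ustate) : R :=
  \sum_s' trR u.1 a s' * ((u == v)%:R - (unext u s' == v)%:R).

Lemma enR_cases t a : enR t a = 1 /\ enabled t a \/ enR t a = 0 /\ forall t', trR t a t' = 0.
Proof.
have [en|nen] := boolP (enabled t a); first by left; rewrite /enR trR_sum.
by right; split; [rewrite /enR big1// => i _|]; exact: trR_sum0.
Qed.

(** The bound on [y u] is the linear form of the condition that [c] leaves every state at which [y]
    is positive; [enR] discounts disabled actions. *)
Definition flow_sol s (x c : ustate -> act M -> R) (y : ustate -> R) : Prop :=
  [/\ forall u a, 0 <= x u a, forall u a, 0 <= c u a, forall u, 0 <= y u &
      forall u, y u <= \sum_a c u a * enR u.1 a] /\
  (forall v, \sum_u \sum_a x u a * kap u a v + y v = (v == uinit s)%:R) /\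
  (forall v, \sum_u \sum_a c u a * kap u a v = 0).

Lemma sum_delta (K : finType) (f : K -> R) v : \sum_w (w == v)%:R * f w = f v.
Proof.
rewrite (bigD1 v)//= eqxx mul1r big1 ?addr0// => w /negbTE ->.
by rewrite mul0r.
Qed.

Lemma sum_deltar (K : finType) (f : K -> R) v : \sum_w f w * (v == w)%:R = f v.
Proof. by rewrite -[RHS]sum_delta; apply: eq_bigr => w _; rewrite mulrC eq_sym. Qed.

Lemma sum_kap (f : ustate -> R) u a : \sum_v f v * kap u a v =
  \sum_s' trR u.1 a s' * (f u - f (unext u s')).
Proof.
rewrite /kap; under eq_bigr do rewrite mulr_sumr.
rewrite exchange_big /=; apply: eq_bigr => s' _.
under eq_bigr do rewrite mulrCA mulrBr.
by rewrite -mulr_sumr sumrB !sum_deltar.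
Qed.

(** Otherwise Farkas' lemma yields weights [w], potentials [hp] and [gp] and some [lam >= 0]: [hp]
    is superharmonic, [gp] drops by [lam] on average, [hp + lam] plus the weights of the visited
    targets is nonnegative, and [hp] at the start plus the weighted reachability values is negative.
    The drop of [gp] makes the expectations of [lam] summable, whereas the other facts keep them
    away from 0. *)
Lemma sched_flow (sigma : scheduler R M) s : exists x c y, flow_sol s x c y /\
  forall g, reach_prob sigma s (T g) = \sum_(u : ustate) (g \in u.2)%:R * y u.
Proof.
pose I := ((ustate + ustate) + (ustate + G))%type.
pose J := (((ustate * act M) + (ustate * act M)) + (ustate + ustate))%type.
pose A (i : I) (j : J) : R := match i, j with
  | inl (inl v), inl (inl p) => kap p.1 p.2 v
  | inl (inl v), inr (inl w) => (w == v)%:R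
  | inl (inr v), inl (inr p) => kap p.1 p.2 v
  | inr (inl v), inl (inr p) => - ((p.1 == v)%:R * enR p.1.1 p.2)
  | inr (inl v), inr (inl w) => (w == v)%:R
  | inr (inl v), inr (inr w) => (w == v)%:R
  | inr (inr g), inr (inl w) => (g \in w.2)%:R
  | _, _ => 0
  end.
pose b (i : I) : R := match i with
  | inl (inl v) => (v == uinit s)%:R
  | inr (inr g) => reach_prob sigma s (T g)
  | _ => 0
  end.
have z1 (K : finType) (f : K -> R) : \sum_k 0 * f k = 0.
  by rewrite big1// => k _; rewrite mul0r.
have z2 (K : finType) (f : K -> R) : \sum_k f k * 0 = 0.
  by rewrite big1// => k _; rewrite mulr0.
have [[z z0 zE]|[u uA ub]] := farkas A b.
  exists (fun u a => z (inl (inl (u, a)))), (fun u a => z (inl (inr (u, a)))), (fun u => z (inr (inl u))).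
  have pe (f : ustate -> act M -> R) : \sum_(p : ustate * act M) f p.1 p.2 = \sum_u \sum_a f u a.
    by rewrite -(pair_bigA _ f).
  split; last first.
    by move=> g; have := zE (inr (inr g)); rewrite !big_sumType /= !z1 !add0r !addr0 => <-.
  split; last split.
  - split=> // u; have := zE (inr (inl u)).
    rewrite !big_sumType /= !z1 !add0r !sum_delta.
    under eq_bigr do rewrite mulNr -mulrA; rewrite sumrN.
    pose f (w : ustate) a := (w == u)%:R * (enR w.1 a * z (inl (inr (w, a)))).
    rewrite (eq_bigr (fun p : ustate * act M => f p.1 p.2)).
      have -> : \sum_(p : ustate * act M) f p.1 p.2 = \sum_a enR u.1 a * z (inl (inr (u, a))).
        rewrite (pe f) -(sum_delta (fun w : ustate => \sum_a (enR w.1 a * z (inl (inr (w, a))))) u).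
        by apply: eq_bigr => w _; rewrite mulr_sumr.
      move=> e.
      have -> : \sum_a z (inl (inr (u, a))) * enR u.1 a = \sum_a enR u.1 a * z (inl (inr (u, a))).
        by apply: eq_bigr => a _; rewrite mulrC.
      have := z0 (inr (inr u)); move: e; set S := \sum_a _; lra.
    by move=> [w a] _.
  - move=> v; have := zE (inl (inl v)); rewrite !big_sumType /= !z1 !addr0 sum_delta => <-.
    congr (_ + _); rewrite -(pe (fun u a => z (inl (inl (u, a))) * kap u a v)).
    by apply: eq_bigr => -[w a] _; rewrite mulrC.
  - move=> v; have := zE (inl (inr v)); rewrite !big_sumType /= !z1 !addr0 !add0r => e.
    rewrite -(pe (fun u a => z (inl (inr (u, a))) * kap u a v)) -[RHS]e.
    by apply: eq_bigr => -[w a] _; rewrite mulrC.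
exfalso.
pose hp v := u (inl (inl v)); pose gp v := u (inl (inr v)).
pose lam v := u (inr (inl v)); pose w g := u (inr (inr g)).
have lam0 v : 0 <= lam v.
  by have := uA (inr (inr v)); rewrite !big_sumType /= !z2 !add0r !addr0 sum_deltar.
have kE (f : ustate -> R) v a : enabled v.1 a -> \sum_w f w * kap v a w =
    f v - \sum_s' trR v.1 a s' * f (unext v s').
  move=> en; rewrite sum_kap.
  rewrite (eq_bigr (fun s' => trR v.1 a s' * f v - trR v.1 a s' * f (unext v s'))).
    by rewrite sumrB -mulr_suml trR_sum// mul1r.
  by move=> s' _; rewrite mulrBr.
have hsup v a : enabled v.1 a -> \sum_s' trR v.1 a s' * hp (unext v s') <= hp v - 0.
  move=> en; have := uA (inl (inl (v, a))); rewrite !big_sumType /= !z2 !addr0.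
  by rewrite (kE hp v a en) subr0 subr_ge0.
have gsup v a : enabled v.1 a -> \sum_s' trR v.1 a s' * gp (unext v s') <= gp v - lam v.
  move=> en; have := uA (inl (inr (v, a))); rewrite !big_sumType /= !z2 !addr0 !add0r.
  rewrite (kE gp v a en).
  have -> : \sum_i u (inr (inl i)) * - ((v == i)%:R * enR v.1 a) = - lam v.
    rewrite -(sum_deltar lam v) -sumrN; apply: eq_bigr => i _.
    by rewrite /enR trR_sum// mulr1 mulrN.
  by set S := \sum_s' _; lra.
have yge v : 0 <= hp v + lam v + \sum_g w g * (g \in v.2)%:R.
  have := uA (inr (inl v)); rewrite !big_sumType /= !z2 ?addr0 ?add0r !sum_deltar.
  by rewrite ?addrA.
have ubE : hp (uinit s) + \sum_g w g * reach_prob sigma s (T g) < 0.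
  by move: ub; rewrite !big_sumType /= !z2 !addr0 !add0r; under eq_bigr do rewrite eq_sym; rewrite sum_deltar.
set V := hp (uinit s) + _ in ubE.
have exh N : ex sigma s N [::] (hp \o uhist s) <= hp (uinit s).
  have := @ex_super sigma s N [::] hp (fun=> 0) isT hsup; rewrite big1 ?addr0// => k _.
  exact: ex_cst.
(* There are finitely many unfolded states, so [gp] is bounded and the total loss is at most [B]. *)
pose B := gp (uinit s) + \sum_v `|gp v|.
have exg N : \sum_(k < N) ex sigma s k [::] (lam \o uhist s) <= B.
  have := @ex_super sigma s N [::] gp lam isT gsup.
  have : - \sum_v `|gp v| <= ex sigma s N [::] (gp \o uhist s).
    rewrite -(@ex_cst sigma s N [::] (- \sum_v `|gp v|) isT); apply: ex_le => // h _ /=.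
    rewrite lerNl; apply: le_trans (ler_norm _) _; rewrite normrN (bigD1 (uhist s h))//= lerDl.
    exact: sumr_ge0.
  by rewrite /B /uhist /=; set S := \sum_(k < N) _; set S' := \sum_v _; lra.
have exlam N : - hp (uinit s) - \sum_g w g * ex sigma s N [::] (fun h => (g \in (uhist s h).2)%:R)
    <= ex sigma s N [::] (lam \o uhist s).
  have : 0 <= ex sigma s N [::] (fun h => (hp \o uhist s) h + (lam \o uhist s) h +
      \sum_g w g * (g \in (uhist s h).2)%:R).
    have := @ex_le sigma s N [::] (fun=> 0) _ isT (fun h _ => yge (uhist s h)).
    by rewrite ex_cst.
  rewrite !exD ex_sum; under eq_bigr do rewrite exZ.
  by have := exh N; set S := \sum_g _; lra.
(* Half of [- V], the lower bound on the expectation of [lam] in the limit. *)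
pose del := - V / 2.
have del0 : 0 < del by rewrite /del divr_gt0// oppr_gt0.
have [N0 HN0] : exists N0, forall N, (N0 <= N)%N -> del <= ex sigma s N [::] (lam \o uhist s).
  pose W := 1 + \sum_g `|w g|.
  have W0 : 0 < W by rewrite /W ltr_wpDr// sumr_ge0.
  have eps0 : 0 < del / W by rewrite divr_gt0.
  have /choice[Nf Hf] g := reach_ex sigma s g eps0.
  exists (\max_g Nf g)%N => N le; apply: le_trans (exlam N).
  have -> : - hp (uinit s) = \sum_g w g * reach_prob sigma s (T g) - V by rewrite /V; ring.
  rewrite addrAC -sumrB.
  have : `|\sum_g (w g * reach_prob sigma s (T g) -
      w g * ex sigma s N [::] (fun h => (g \in (uhist s h).2)%:R))| <= del.
    apply: le_trans (ler_norm_sum _ _ _) _.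
    apply: (@le_trans _ _ (\sum_g `|w g| * (del / W))).
      apply: ler_sum => g _; rewrite -mulrBr normrM ler_wpM2l// ltW//; apply: Hf.
      by apply: leq_trans le; exact: leq_bigmax.
    rewrite -mulr_suml mulrA ler_pdivrMr// mulrC ler_pM2l// /W lerDr//.
  rewrite ler_norml => /andP[h _]; move: h; rewrite /del; set S := \sum_g _; lra.
(* More than [B / del] terms of size at least [del] exceed [B]. *)
have := exg (N0 + (Num.truncn (B / del)).+1)%N.
rewrite big_split_ord /= leNgt => /negP; apply.
apply: (@lt_le_trans _ _ (\sum_(i < (Num.truncn (B / del)).+1) del)).
  rewrite sumr_const card_ord -mulr_natl -ltr_pdivrMr//; exact: truncnS_gt.
rewrite -[X in X <= _]add0r; apply: lerD; last by apply: ler_sum => i _; apply: HN0; rewrite leq_addr.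
apply: sumr_ge0 => i _; rewrite -(@ex_cst sigma s i [::] 0 isT).
by apply: ex_le => // h _ /=.
Qed.

Lemma enRM t a : enR t a * enR t a = enR t a.
Proof. by have [[-> _]|[-> _]] := enR_cases t a; rewrite ?mulr1 ?mulr0. Qed.

Lemma enR_ge0 t a : 0 <= enR t a.
Proof. by rewrite sumr_ge0// => i _; exact: trR_ge0. Qed.

(** Summation by parts: the balance equations tested against a function [f]. The facts below about
    supports and values come from suitable choices of [f]. *)
Lemma flow_test (x : ustate -> act M -> R) (b : ustate -> R) f :
  (forall v, \sum_u \sum_a x u a * kap u a v = b v) ->
  \sum_u (\sum_a x u a * enR u.1 a) * f u =
  \sum_u (\sum_a x u a * enR u.1 a * \sum_s' trR u.1 a s' * f (unext u s'))
    + \sum_v b v * f v.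
Proof.
move=> H.
have -> : \sum_v b v * f v = \sum_u \sum_a x u a * \sum_v f v * kap u a v.
  rewrite (eq_bigr (fun v => \sum_u \sum_a x u a * (f v * kap u a v))).
    rewrite exchange_big /=; apply: eq_bigr => u _.
    by rewrite exchange_big /=; apply: eq_bigr => a _; rewrite mulr_sumr.
  move=> v _; rewrite -H mulr_suml; apply: eq_bigr => u _.
  by rewrite mulr_suml; apply: eq_bigr => a _; rewrite -mulrA [f v * _]mulrC.
rewrite -big_split /=; apply: eq_bigr => u _; rewrite mulr_suml -big_split /=.
apply: eq_bigr => a _; rewrite sum_kap.
have -> : \sum_s' trR u.1 a s' * (f u - f (unext u s')) =
    enR u.1 a * f u - \sum_s' trR u.1 a s' * f (unext u s').
  by rewrite /enR mulr_suml -sumrB; apply: eq_bigr => s' _; rewrite mulrBr.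
have [[-> _]|[-> t0]] := enR_cases u.1 a.
  by rewrite mulr1 mul1r -mulrDr addrC subrK.
by rewrite big1 ?subr0 ?mul0r ?mulr0 ?mul0r ?addr0// => s' _; rewrite t0 mul0r.
Qed.

(** One step of the policy proportional to [w u]; where [W u = 0], the convention for the inverse
    gives 0. *)
Definition wstep (w : ustate -> act M -> R) (W : ustate -> R) f u : R :=
  \sum_a w u a / W u * \sum_s' trR u.1 a s' * f (unext u s').

(** If [r] differed from [v], the partial sums would grow linearly. A telescoping identity thus
    determines a limit without any rate of convergence. *)
Lemma bounded_sum_lim (a : nat -> R) (r v B : R) :
  (forall e, 0 < e -> exists N0, forall N, (N0 <= N)%N -> `|r - a N| < e) ->
  (forall K, `|\sum_(N < K) (a N - v)| <= B) -> r = v.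
Proof.
move=> lim bnd; apply/eqP; rewrite -subr_eq0 -normr_eq0; apply/negPn/negP => n0.
pose d := `|r - v| / 2.
have d0 : 0 < d by rewrite divr_gt0// lt_neqAle eq_sym n0 normr_ge0.
have [N0 H] := lim _ d0.
pose K := (Num.truncn (2 * B / d)).+1.
have := truncnS_gt (2 * B / d); rewrite -/K ltr_pdivrMr// ltNge => /negP; apply.
have := bnd N0; have := bnd (N0 + K)%N; rewrite big_split_ord /=.
set S0 := \sum_(i < N0) _; set S := \sum_(i < K) _.
have SE : S = K%:R * (r - v) - \sum_(i < K) (r - a (N0 + i)%N).
  rewrite mulr_natl -[X in _ *+ X]card_ord -sumr_const -sumrB.
  by apply: eq_bigr => i _; ring.
have h1 : `|\sum_(i < K) (r - a (N0 + i)%N)| <= K%:R * d.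
  apply: le_trans (ler_norm_sum _ _ _) _.
  rewrite mulr_natl -[X in _ *+ X]card_ord -sumr_const; apply: ler_sum => i _.
  by apply/ltW/H; rewrite leq_addr.
have h2 : K%:R * d *+ 2 <= `|S| + `|\sum_(i < K) (r - a (N0 + i)%N)|.
  have -> : K%:R * d *+ 2 = `|K%:R * (r - v)| by rewrite normrM normr_nat /d; field.
  by apply: le_trans (ler_normD _ _); rewrite SE subrK.
have h3 : `|S| <= `|S0 + S| + `|S0|.
  by rewrite -[`|S0|]normrN; apply: le_trans (ler_normD _ _); rewrite addrAC subrr add0r.
move: h1 h2 h3; set A := `|S|; set D := `|\sum_(i < K) _|; set E := `|S0|; set F := `|S0 + S|.
rewrite mulr2n; lra.
Qed.

Lemma neq0M (a b : R) : a * b != 0 -> a != 0 /\ b != 0.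
Proof. by rewrite mulf_eq0 negb_or => /andP[]. Qed.

(** * From a flow to a scheduler *)

Section flow_sched.
Variables (s0 : state M) (x c : ustate -> act M -> R) (y : ustate -> R).
Hypothesis xcy : flow_sol s0 x c y.

Let x0 : forall u a, 0 <= x u a. Proof. by case: xcy => -[]. Qed.
Let c0 : forall u a, 0 <= c u a. Proof. by case: xcy => -[]. Qed.
Let y0 : forall u, 0 <= y u. Proof. by case: xcy => -[]. Qed.

Let xe (u : ustate) a := x u a * enR u.1 a.
Let ce (u : ustate) a := c u a * enR u.1 a.
Let X u := \sum_a xe u a + y u.
Let C u := \sum_a ce u a.

Let xe0 u a : 0 <= xe u a. Proof. by rewrite mulr_ge0 ?enR_ge0. Qed.
Let ce0 u a : 0 <= ce u a. Proof. by rewrite mulr_ge0 ?enR_ge0. Qed.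
Let C0 u : 0 <= C u. Proof. by rewrite sumr_ge0. Qed.
Let X0 u : 0 <= X u. Proof. by rewrite addr_ge0 ?sumr_ge0. Qed.
Let yC u : y u <= C u. Proof. by case: xcy => -[]. Qed.

Let ce_enR u a : ce u a * enR u.1 a = ce u a. Proof. by rewrite /ce -mulrA enRM. Qed.
Let xe_enR u a : xe u a * enR u.1 a = xe u a. Proof. by rewrite /xe -mulrA enRM. Qed.

Let ceC u a : C u = 0 -> ce u a = 0.
Proof. by move=> /eqP; rewrite psumr_eq0// => /allP/(_ a (mem_index_enum _))/eqP. Qed.

Let XE u : X u = 0 -> y u = 0 /\ forall a, xe u a = 0.
Proof.
move=> /eqP; rewrite paddr_eq0 ?sumr_ge0// => /andP[+ /eqP ->].
by rewrite psumr_eq0// => /allP h; split=> // a; have /eqP := h a (mem_index_enum _).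
Qed.

Let XK u z : (X u = 0 -> z = 0) -> X u * (z / X u) = z.
Proof.
have [e|n] := eqVneq (X u) 0; last by rewrite mulrC divfK.
by move=> /(_ e) ->; rewrite mul0r mulr0.
Qed.

Let CK u z : (C u = 0 -> z = 0) -> C u * (z / C u) = z.
Proof.
have [e|n] := eqVneq (C u) 0; last by rewrite mulrC divfK.
by move=> /(_ e) ->; rewrite mul0r mulr0.
Qed.

Let P := wstep xe X.
Let Q := wstep ce C.

Let X_test f : \sum_u X u * f u = f (uinit s0) + \sum_u X u * P f u.
Proof.
have H v : \sum_u \sum_a x u a * kap u a v = (v == uinit s0)%:R - y v.
  by case: xcy => _ [/(_ v) <- _]; rewrite addrK.
rewrite (eq_bigr (fun u => (\sum_a x u a * enR u.1 a) * f u + y u * f u)); last first.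
  by move=> u _; rewrite /X mulrDl.
rewrite big_split /= (flow_test f H).
rewrite (eq_bigr (fun u => (u == uinit s0)%:R * f u - y u * f u)
  (r := index_enum ustate) (F1 := fun v => ((v == uinit s0)%:R - y v) * f v)); last first.
  by move=> u _; rewrite mulrBl.
rewrite sumrB sum_delta -addrA subrK addrC; congr (_ + _).
apply: eq_bigr => u _; rewrite /P /wstep mulr_sumr; apply: eq_bigr => a _.
by rewrite mulrA XK// => /XE[_].
Qed.

Let C_test f : \sum_u C u * f u = \sum_u C u * Q f u.
Proof.
have [_ [_ H]] := xcy; rewrite /C (flow_test f H).
rewrite [X in _ + X]big1 ?addr0 => [|v _]; last by rewrite mul0r.
apply: eq_bigr => u _; rewrite -/(C u) /Q /wstep mulr_sumr; apply: eq_bigr => a _.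
by rewrite mulrA CK// => /ceC.
Qed.

(** For [f] the indicator of [C = 0], the left side of [C_test] vanishes, so no mass flows into that
    set. [X_closed] argues in the same way with [X_test]. *)
Let C_closed u a s' : ce u a != 0 -> trR u.1 a s' != 0 -> C (unext u s') != 0.
Proof.
move=> n1 n2; apply/negP => e.
have := C_test (fun v => (C v == 0)%:R).
rewrite big1 => [|v _]; last by case: eqP => [->|]; rewrite ?mul0r ?mulr0.
move/esym/eqP; rewrite psumr_eq0 => [/allP/(_ u (mem_index_enum _))/=|v _]; last first.
  apply: mulr_ge0 => //; apply: sumr_ge0 => b _; rewrite mulr_ge0 ?divr_ge0//.
  by apply: sumr_ge0 => t _; rewrite mulr_ge0 ?trR_ge0.
rewrite mulf_eq0 => /orP[/eqP/(ceC a)/eqP|]; first by rewrite (negbTE n1).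
rewrite psumr_eq0 => [/allP/(_ a (mem_index_enum _))/=|b _]; last first.
  rewrite mulr_ge0 ?divr_ge0//.
  by apply: sumr_ge0 => t _; rewrite mulr_ge0 ?trR_ge0.
have Cn : C u != 0 by apply/eqP => /(ceC a)/eqP; rewrite (negbTE n1).
have nz : ce u a / C u != 0 by rewrite mulf_neq0 ?invr_neq0.
rewrite mulf_eq0 (negbTE nz) /=.
rewrite psumr_eq0 => [/allP/(_ s' (mem_index_enum _))/=|t _]; last by rewrite mulr_ge0 ?trR_ge0.
by rewrite mulf_eq0 (negbTE n2) e oner_eq0.
Qed.

Let X_closed u a s' : xe u a != 0 -> trR u.1 a s' != 0 -> X (unext u s') != 0.
Proof.
move=> n1 n2; apply/negP => e.
have := X_test (fun v => (X v == 0)%:R).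
rewrite big1 => [|v _]; last by case: eqP => [->|]; rewrite ?mul0r ?mulr0.
have S0 : 0 <= \sum_v X v * P (fun v => (X v == 0)%:R) v.
  apply: sumr_ge0 => v _; apply: mulr_ge0 => //; apply: sumr_ge0 => b _; rewrite mulr_ge0 ?divr_ge0//.
  by apply: sumr_ge0 => t _; rewrite mulr_ge0 ?trR_ge0.
move/esym/eqP; rewrite paddr_eq0// => /andP[_].
rewrite psumr_eq0 => [/allP/(_ u (mem_index_enum _))/=|v _]; last first.
  apply: mulr_ge0 => //; apply: sumr_ge0 => b _; rewrite mulr_ge0 ?divr_ge0//.
  by apply: sumr_ge0 => t _; rewrite mulr_ge0 ?trR_ge0.
rewrite mulf_eq0 => /orP[/eqP/XE[_ /(_ a)/eqP]|]; first by rewrite (negbTE n1).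
rewrite psumr_eq0 => [/allP/(_ a (mem_index_enum _))/=|b _]; last first.
  rewrite mulr_ge0 ?divr_ge0//.
  by apply: sumr_ge0 => t _; rewrite mulr_ge0 ?trR_ge0.
have Xn : X u != 0 by apply/eqP => /XE[_ /(_ a)/eqP]; rewrite (negbTE n1).
have nz : xe u a / X u != 0 by rewrite mulf_neq0 ?invr_neq0.
rewrite mulf_eq0 (negbTE nz) /=.
rewrite psumr_eq0 => [/allP/(_ s' (mem_index_enum _))/=|t _]; last by rewrite mulr_ge0 ?trR_ge0.
by rewrite mulf_eq0 (negbTE n2) e oner_eq0.
Qed.

(** The gains weighted by [C] are nonnegative and sum to 0 by [C_test], so a quantity that never
    decreases is constant along the circulation. Applied to the membership of a target in the
    visited set, it says that no new target is met. *)
Let Q_mono (phi : ustate -> R) u : (forall u s', phi u <= phi (unext u s')) ->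
  C u != 0 -> Q phi u = phi u.
Proof.
move=> mono Cu; have key v : 0 <= C v * (Q phi v - phi v).
  have [->|Cv] := eqVneq (C v) 0; first by rewrite mul0r.
  apply: mulr_ge0 => //; rewrite subr_ge0.
  have {1}-> : phi v = \sum_a ce v a / C v * \sum_s' trR v.1 a s' * phi v.
    rewrite (eq_bigr (fun a => ce v a / C v * phi v)) => [|a _].
      by rewrite -mulr_suml -mulr_suml -/(C v) divff// mul1r.
    by rewrite -mulr_suml -/(enR v.1 a) mulrA; congr (_ * _); rewrite mulrAC ce_enR.
  apply: ler_sum => a _; rewrite ler_wpM2l ?divr_ge0//; apply: ler_sum => s' _.
  by rewrite ler_wpM2l ?trR_ge0.
have : \sum_v C v * (Q phi v - phi v) == 0.
  rewrite (eq_bigr (fun v => C v * Q phi v - C v * phi v)) => [|v _]; last by rewrite mulrBr.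
  by rewrite sumrB -C_test subrr.
rewrite psumr_eq0// => /allP/(_ u (mem_index_enum _))/=.
by rewrite mulf_eq0 (negbTE Cu) subr_eq0 => /eqP.
Qed.

(* A run first follows [x] and, at [u], is stopped with probability [y u / X u];
   it then follows the circulation [c], which keeps the visited targets.  The
   two weights are the probabilities of being still running and stopped. *)
Let wnext (st : ustate * R * R) (p : act M * state M) : ustate * R * R :=
  let: (u, r, q) := st in
  (unext u p.2, r * (xe u p.1 / X u) * trR u.1 p.1 p.2,
   (q + r * (y u / X u)) * (ce u p.1 / C u) * trR u.1 p.1 p.2).
Let ws h := foldl wnext (uinit s0, 1, 0) h.
Let rw h := (ws h).1.2.
Let qw h := (ws h).2.
Let U := uhist s0.
Let qy h := qw h + rw h * (y (U h) / X (U h)).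
Let dw h a := rw h * (xe (U h) a / X (U h)) + qy h * (ce (U h) a / C (U h)).

Let wsU h : (ws h).1.1 = U h.
Proof.
elim/last_ind: h => // h [a s'] IH; rewrite /U uhist_rcons -/(U h) -IH /ws foldl_rcons /wnext.
by case: (foldl _ _ h) => -[].
Qed.

Let ws_rcons h a s' : rw (rcons h (a, s')) = rw h * (xe (U h) a / X (U h)) * trR (U h).1 a s' /\
  qw (rcons h (a, s')) = qy h * (ce (U h) a / C (U h)) * trR (U h).1 a s'.
Proof.
rewrite /qy /rw /qw -!wsU /ws foldl_rcons /wnext.
by case: (foldl _ _ h) => -[].
Qed.

Let X_init : X (uinit s0) != 0.
Proof.
have := X_test (fun v => (v == uinit s0)%:R).
rewrite (eq_bigr (fun v => (v == uinit s0)%:R * X v)) => [|v _]; last by rewrite mulrC.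
rewrite sum_delta eqxx => ->; rewrite gt_eqF// ltr_wpDr//.
apply: sumr_ge0 => v _; apply: mulr_ge0 => //; apply: sumr_ge0 => b _; rewrite mulr_ge0 ?divr_ge0//.
by apply: sumr_ge0 => t _; rewrite mulr_ge0 ?trR_ge0.
Qed.

Let ws_inv h : [/\ 0 <= rw h, 0 <= qw h, rw h != 0 -> X (U h) != 0 & qw h != 0 -> C (U h) != 0].
Proof.
elim/last_ind: h => [|h [a s'] [r0 q0 rX qC]]; first by split=> //; rewrite /qw /= eqxx.
have [-> ->] := ws_rcons h a s'; rewrite /U uhist_rcons -/(U h); split.
- by rewrite mulr_ge0 ?trR_ge0// mulr_ge0 ?divr_ge0.
- by rewrite mulr_ge0 ?trR_ge0// mulr_ge0 ?divr_ge0// addr_ge0// mulr_ge0// divr_ge0.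
- move=> /neq0M[/neq0M[_ /neq0M[n1 _]] n2]; exact: X_closed n1 n2.
- move=> /neq0M[/neq0M[_ /neq0M[n1 _]] n2]; exact: C_closed n1 n2.
Qed.

Let qy_C h : qy h != 0 -> C (U h) != 0.
Proof.
move=> n; apply/eqP => e; move/eqP: n; apply; rewrite /qy.
have -> : y (U h) = 0 by apply/eqP; rewrite eq_le y0 andbT -e yC.
rewrite mul0r mulr0 addr0; apply/eqP/negPn/negP => q.
by have [_ _ _ /(_ q)] := ws_inv h; rewrite e eqxx.
Qed.

Let qy0 h : 0 <= qy h.
Proof. by have [r0 q0 _ _] := ws_inv h; rewrite addr_ge0// mulr_ge0// divr_ge0. Qed.

Let dw0 h a : 0 <= dw h a.
Proof. by have [r0 _ _ _] := ws_inv h; rewrite addr_ge0// mulr_ge0 ?divr_ge0. Qed.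

Let dw_sum h : \sum_a dw h a = rw h + qw h.
Proof.
rewrite /dw big_split /= -!mulr_sumr -!mulr_suml -/(C (U h)).
have -> : qy h * (C (U h) / C (U h)) = qy h.
  by have [->|/qy_C n] := eqVneq (qy h) 0; [rewrite mul0r|rewrite divff// mulr1].
have [r0 _ rX _] := ws_inv h; rewrite /qy addrCA -mulrDr -mulrDl addrC; congr (_ + _).
have [->|/rX n] := eqVneq (rw h) 0; first by rewrite mul0r.
by rewrite -/(X (U h)) divff// mulr1.
Qed.

Let dw_en h a : dw h a != 0 -> enabled (U h).1 a.
Proof.
have [[_ //]|[e _]] := enR_cases (U h).1 a.
by rewrite /dw /xe /ce e !mulr0 !mul0r !mulr0 addr0 eqxx.
Qed.

Let dfl t : act M := projT1 (cid (trans_enabled (m := M) t)).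

(** Whether the run is already stopped is hidden from a scheduler, so it is averaged out: [rw h] and
    [qw h] weigh the two cases jointly with the history, [dw h a] adds the next action. Histories of
    weight 0 and other initial states get a default enabled action. *)
Let sf s h a : R := if (s == s0) && (rw h + qw h != 0) then dw h a / (rw h + qw h)
  else (a == dfl (last_state s h))%:R.

Let sf_ge0 s h : is_path s h -> forall a, 0 <= sf s h a.
Proof.
move=> _ a; rewrite /sf; case: ifP => // _; have [r0 q0 _ _] := ws_inv h.
exact: divr_ge0 (dw0 h a) (addr_ge0 r0 q0).
Qed.

Let sf_sum1 s h : is_path s h -> \sum_a sf s h a = 1.
Proof.
move=> _; case: (boolP ((s == s0) && (rw h + qw h != 0))) => [b|/negbTE b].
  rewrite (eq_bigr (fun a => dw h a / (rw h + qw h))) => [|a _]; last by rewrite /sf b.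
  by rewrite -mulr_suml dw_sum divff//; case/andP: b.
rewrite (eq_bigr (fun a => (a == dfl (last_state s h))%:R * 1)) => [|a _]; last by rewrite /sf b mulr1.
by rewrite (sum_delta (fun=> 1)).
Qed.

Let sf_en s h : is_path s h -> forall a, sf s h a != 0 -> enabled (last_state s h) a.
Proof.
move=> _ a; rewrite /sf; case: ifP => [/andP[/eqP -> _] /neq0M[/dw_en]|_].
  by rewrite uhist1.
have [-> _|_] := eqVneq a (dfl (last_state s h)); last by rewrite eqxx.
by rewrite /dfl; case: cid => b /= /eqP.
Qed.

Definition flow_scheduler : scheduler R M := Scheduler sf_ge0 sf_sum1 sf_en.
Let sigma := flow_scheduler.

(** Expected [phi] after [N] steps for a run that has not been stopped; from the moment of stopping,
    [Q_mono] freezes [phi]. *)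
Let al (phi : ustate -> R) N := iter N (fun f u => P f u + y u / X u * phi u) phi.

Let ex_al phi N h : (forall u s', phi u <= phi (unext u s')) ->
  (rw h + qw h) * ex sigma s0 N h (phi \o U) = rw h * al phi N (U h) + qw h * phi (U h).
Proof.
move=> mono; elim: N h => [|N IHN] h; first by rewrite /= mulrDl.
have [r0 q0 _ _] := ws_inv h.
have [z|nz] := eqVneq (rw h + qw h) 0.
  have := z => /eqP; rewrite paddr_eq0// => /andP[/eqP er /eqP eq].
  by rewrite er eq addr0 !mul0r addr0.
transitivity (\sum_a \sum_s' (rw (rcons h (a, s')) * al phi N (U (rcons h (a, s'))) +
    qw (rcons h (a, s')) * phi (U (rcons h (a, s'))))).
  rewrite [ex _ _ _ _ _]/= mulr_sumr; apply: eq_bigr => a _.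
  have -> : sf s0 h a = dw h a / (rw h + qw h) by rewrite /sf eqxx nz.
  rewrite mulrA mulrCA divff// mulr1 mulr_sumr; apply: eq_bigr => s' _.
  rewrite -IHN mulrA; congr (_ * _); have [-> ->] := ws_rcons h a s'.
  by rewrite -mulrDl -/(dw h a) uhist1.
transitivity (rw h * P (al phi N) (U h) + qy h * Q phi (U h)).
  rewrite /P /Q /wstep !mulr_sumr -big_split /=; apply: eq_bigr => a _.
  rewrite big_split /=; congr (_ + _); rewrite [RHS]mulrA [RHS]mulr_sumr;
    apply: eq_bigr => s' _; have [e1 e2] := ws_rcons h a s'.
    by rewrite e1 /U uhist_rcons -/(U h) [RHS]mulrA.
  by rewrite e2 /U uhist_rcons -/(U h) [RHS]mulrA.
have -> : qy h * Q phi (U h) = qy h * phi (U h).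
  by have [->|/qy_C n] := eqVneq (qy h) 0; [rewrite !mul0r|rewrite Q_mono].
by rewrite /qy mulrDl addrCA /= mulrDr addrC !mulrA.
Qed.

Let al_bnd phi N u : (forall u, 0 <= phi u <= 1) -> 0 <= al phi N u <= 1.
Proof.
move=> b; elim: N u => [|N IHN] u; first exact: b.
have /andP[p0 p1] := b u; rewrite /al iterS -/(al phi N); apply/andP; split.
  apply: addr_ge0; last by rewrite mulr_ge0 ?divr_ge0.
  apply: sumr_ge0 => a _; rewrite mulr_ge0 ?divr_ge0//.
  by apply: sumr_ge0 => s' _; rewrite mulr_ge0 ?trR_ge0//; have /andP[] := IHN (unext u s').
apply: (@le_trans _ _ (\sum_a xe u a / X u + y u / X u)).
  apply: lerD; last by rewrite ler_piMr ?divr_ge0.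
  apply: ler_sum => a _.
  apply: (@le_trans _ _ (xe u a / X u * enR u.1 a)); last by rewrite mulrAC xe_enR.
  rewrite ler_wpM2l ?divr_ge0//; apply: ler_sum => s' _.
  by rewrite ler_piMr ?trR_ge0//; have /andP[] := IHN (unext u s').
rewrite -mulr_suml -mulrDl -/(X u).
by have [->|n] := eqVneq (X u) 0; [rewrite mul0r ler01|rewrite divff].
Qed.

Lemma flow_scheduler_reach g :
  reach_prob sigma s0 (T g) = \sum_(u : ustate) (g \in u.2)%:R * y u.
Proof.
pose phi (u : ustate) : R := (g \in u.2)%:R.
have mono u s' : phi u <= phi (unext u s').
  by rewrite /phi ler_nat !inE; case: (g \in u.2).
have bnd u : 0 <= phi u <= 1 by rewrite /phi; case: (g \in u.2); rewrite ?lexx ler01.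
apply: (@bounded_sum_lim (fun N => al phi N (uinit s0)) _ _ (\sum_u X u)).
  move=> e e0; have [N0 H] := reach_ex sigma s0 g e0; exists N0 => N le.
  have := ex_al N [::] mono; rewrite /rw /qw /= addr0 !mul1r mul0r addr0 => <-.
  exact: H.
(* Weighted by the flow [X], the deviations telescope by [X_test], and [S] stays between 0 and the
   sum of [X]. *)
pose S N := \sum_u X u * al phi N u.
have SE N : al phi N (uinit s0) - \sum_u phi u * y u = S N - S N.+1.
  rewrite /S X_test -addrA; congr (_ + _).
  rewrite [X in _ = _ - X](eq_bigr (fun u => X u * P (al phi N) u + phi u * y u)).
    by rewrite big_split /= opprD addrA subrr add0r.
  move=> u _; rewrite /al iterS -/(al phi N) mulrDr; congr (_ + _).
  by rewrite mulrA XK ?[phi u * _]mulrC// => /XE[].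
have S0 N : 0 <= S N <= \sum_u X u.
  apply/andP; split.
    by apply: sumr_ge0 => u _; rewrite mulr_ge0//; have /andP[] := al_bnd N u bnd.
  by apply: ler_sum => u _; rewrite ler_piMr//; have /andP[] := al_bnd N u bnd.
move=> K; have -> : \sum_(N < K) (al phi N (uinit s0) - \sum_u phi u * y u) = S 0%N - S K.
  elim: K => [|K IHK]; first by rewrite big_ord0 subrr.
  by rewrite big_ord_recr /= IHK SE addrA subrK.
have := S0 0%N; have := S0 K; rewrite ler_norml => /andP[a1 a2] /andP[b1 b2].
by apply/andP; split; lra.
Qed.

End flow_sched.

(** The initial state is an argument of a scheduler, so schedulers built separately for each initial
    state can be glued. *)
Lemma flow_exists_scheduler (x c : state M -> ustate -> act M -> R) (y : state M -> ustate -> R) :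
  (forall s, flow_sol s (x s) (c s) (y s)) ->
  exists sigma : scheduler R M, forall s g,
    reach_prob sigma s (T g) = \sum_(u : ustate) (g \in u.2)%:R * y s u.
Proof.
move=> H; pose sg s := flow_scheduler (H s).
have g0 s h : is_path s h -> forall a, 0 <= sg s s h a by exact: sched_ge0.
have s1 s h : is_path s h -> \sum_a sg s s h a = 1 by exact: sched_sum1.
have en s h : is_path s h -> forall a, sg s s h a != 0 -> enabled (last_state s h) a.
  exact: sched_enabled.
exists (@Scheduler R M (fun s => sg s s) g0 s1 en) => s g.
by rewrite -(flow_scheduler_reach (H s)); exact: reach_prob_ext.
Qed.

End unfolding.

(** * Parsing the input and building the matrix *)

Local Open Scope nat_scope.

Definition oseq {T} (o : option T) : seq T := if o is Some x then [:: x] else [::].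

Definition dec_step (st : seq nat * seq bool) (x : option bool) : seq nat * seq bool :=
  if nilp (oseq x) then (bval (rev st.2) :: st.1, [::])
  else (st.1, head false (oseq x) :: st.2).

Definition decode (w : seq (option bool)) : seq nat :=
  rev (foldl dec_step ([::], [::]) w).1.

Definition etok (ts : seq nat) : word := flatten (map enc_nat ts).

Lemma decode_etok ts : decode (etok ts) = ts.
Proof.
have H s acc r : foldl dec_step (acc, r) (map Some s) = (acc, rev s ++ r).
  by elim: s r => //= b s IHs r; rewrite IHs rev_cons cat_rcons.
have K acc : foldl dec_step (acc, [::]) (etok ts) = (rev ts ++ acc, [::]).
  elim: ts acc => //= n ts IHts acc.
  rewrite foldl_cat foldl_rcons H cats0 /dec_step /= revK bval_bits IHts.
  by rewrite rev_cons cat_rcons.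
by rewrite /decode K cats0 revK.
Qed.

Definition bseqs (ix : seq nat) : seq (seq bool) :=
  foldl (fun acc _ => [seq false :: v | v <- acc] ++ [seq true :: v | v <- acc])
    [:: [::]] ix.

Lemma bseqs_rcons ix i : bseqs (rcons ix i) =
  [seq false :: v | v <- bseqs ix] ++ [seq true :: v | v <- bseqs ix].
Proof. exact: foldl_rcons. Qed.

Lemma size_bseqs ix : size (bseqs ix) = 2 ^ size ix.
Proof.
elim/last_ind: ix => // ix i IH.
by rewrite bseqs_rcons size_cat !size_map IH size_rcons expnS mul2n addnn.
Qed.

Lemma mem_bseqs ix v : (v \in bseqs ix) = (size v == size ix).
Proof.
elim/last_ind: ix v => [|ix i IH] v; first by rewrite inE; case: v.
rewrite bseqs_rcons mem_cat size_rcons; case: v => [|b v] /=.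
  by apply/norP; split; apply/mapP => -[].
rewrite eqSS -IH; case: b.
  rewrite mem_map => [|? ? []//].
  by case: mapP => // -[? _ []].
rewrite mem_map => [|? ? []//].
by case: mapP => [[? _ []]|]; rewrite // orbF.
Qed.

Lemma bseqs_uniq ix : uniq (bseqs ix).
Proof.
elim/last_ind: ix => // ix i IH; rewrite bseqs_rcons cat_uniq !map_inj_uniq ?IH//=.
- by rewrite andbT; apply/hasPn => _ /mapP[v _ ->]; apply/mapP => -[].
- by move=> ? ? [].
- by move=> ? ? [].
Qed.

(* Operators without tolerance are given the tolerance 0/1, so that all fields of
   a predicate are at fixed positions. *)
Definition nrm (r : seq nat) : seq nat :=
  if head 0 r < 2 then head 0 r :: 0 :: 0 :: 1 :: behead r else r.

Definition rst_step (k : nat) (st : seq nat * seq (seq nat)) (_ : nat) :=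
  (drop (7 + k) (nrm st.1), nrm st.1 :: st.2).

(** Numbers of the input are binary; clipping a range to the length of the input keeps its listing
    polynomial on every input. *)
Definition upto (ts : seq nat) (n : nat) : seq nat :=
  seq.filter (fun i => i < n) (iota 0 (size ts)).

Lemma uptoE ts n : n <= size ts -> upto ts n = iota 0 n.
Proof.
move=> le; rewrite /upto -(subnKC le) iotaD filter_cat.
rewrite (_ : seq.filter _ (iota 0 n) = iota 0 n); last first.
  by apply/all_filterP/allP => i; rewrite mem_iota.
rewrite (_ : seq.filter _ _ = [::]) ?cats0//; apply/eqP; rewrite -[_ == _]negbK -has_filter.
by apply/hasPn => i; rewrite mem_iota add0n -leqNgt => /andP[].
Qed.

(** A record has 7 leading numbers, the operator and its tolerance (1 + 3) and the bound (3), then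
    [5 + |S|] for each operand: coefficient (3), state, scheduler and target bits. Before the
    records come 5 header numbers and 3 for each transition probability. *)
Definition rsts (ts : seq nat) : seq (seq nat) :=
  rev (foldl (rst_step (nth 0 ts 1 * (5 + nth 0 ts 3)))
     (drop (5 + nth 0 ts 3 * nth 0 ts 4 * nth 0 ts 3 * 3) ts, [::]) (upto ts (nth 0 ts 0))).2.

(** A common multiple of all denominators that is found without knowing which numbers are
    denominators; its length is polynomial. *)
Definition den (ts : seq nat) : nat := \prod_(x <- [seq if t == 0 then 1 else t | t : nat <- ts]) x.

Notation dat := (seq nat * seq (seq nat) * nat * (seq nat * seq nat * seq nat)
  * (seq nat * seq nat * seq nat) * (seq (seq bool) * seq (seq bool)))%type.

(* The numbers 0, 1, 2, 3, 4 of the input are [l], [m], [n], [#|S|] and [#|Act|]. *)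
Definition dataof (ts : seq nat) : dat :=
  (ts, rsts ts, den ts, (upto ts (nth 0 ts 3), upto ts (nth 0 ts 4), upto ts (nth 0 ts 0)),
   (upto ts (nth 0 ts 1), upto ts (nth 0 ts 2), upto ts (nth 0 ts 0 * nth 0 ts 1)),
   (bseqs (upto ts (nth 0 ts 0 * nth 0 ts 1)), bseqs (upto ts (nth 0 ts 0)))).

Definition d_ts (d : dat) := d.1.1.1.1.1.
Definition d_rs (d : dat) := d.1.1.1.1.2.
Definition d_D (d : dat) := d.1.1.1.2.
Definition d_S (d : dat) := d.1.1.2.1.1.
Definition d_A (d : dat) := d.1.1.2.1.2.
Definition d_l (d : dat) := d.1.1.2.2.
Definition d_m (d : dat) := d.1.2.1.1.
Definition d_n (d : dat) := d.1.2.1.2.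
Definition d_G (d : dat) := d.1.2.2.
Definition d_V (d : dat) := d.2.1.
Definition d_B (d : dat) := d.2.2.

Definition b2z (b : bool) : int := if b then 1%:Z else 0%:Z.

Definition rz (d : dat) (ts : seq nat) (p : nat) : int :=
  zmk (0 < nth 0 ts p) (nth 0 ts p.+1 * (d_D d %/ nth 0 ts p.+2)).

Definition trz (d : dat) (s a s' : nat) : int :=
  rz d (d_ts d) (5 + ((s * size (d_A d) + a) * size (d_S d) + s') * 3).

Definition pr (d : dat) (j : nat) : seq nat := nth [::] (d_rs d) j.
Definition pbase (d : dat) (i : nat) : nat := 7 + i * (5 + size (d_S d)).
Definition coefz (d : dat) (i j : nat) : int := rz d (pr d j) (pbase d i).
Definition pst (d : dat) (i j : nat) : nat := nth 0 (pr d j) (pbase d i + 3).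
Definition psch (d : dat) (i j : nat) : nat := nth 0 (pr d j) (pbase d i + 4).
Definition ptg (d : dat) (i j s : nat) : bool := 0 < nth 0 (pr d j) (pbase d i + (5 + s)).

(** Bit [j * m + i] belongs to target [i] of predicate [j]; this is the rank of [(j, i)]. *)
Definition tau (d : dat) (s : nat) : seq bool :=
  flatten [seq [seq ptg d i j s | i : nat <- d_m d] | j : nat <- d_l d].

Definition unionV (d : dat) (V : seq bool) (s : nat) : seq bool :=
  [seq nth false V p || nth false (tau d s) p | p : nat <- d_G d].

Definition eqV (d : dat) (V V' : seq bool) : bool :=
  all (fun p : nat => if nth false V p then nth false V' p else ~~ nth false V' p) (d_G d).

Definition kapz (d : dat) (u : nat * seq bool) (a : nat) (u' : nat * seq bool) : int :=
  (\sum_(z <- [seq (trz d u.1 a s' * (b2z ((u.1 == u'.1) && eqV d u.2 u'.2) +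
      - b2z ((s' == u'.1) && eqV d (unionV d u.2 s') u'.2)))%R | s' : nat <- d_S d]) z)%R.

Definition enz (d : dat) (s a : nat) : int :=
  (\sum_(z <- [seq trz d s a s' | s' : nat <- d_S d]) z)%R.

Notation vlab := (nat * nat * (nat * seq bool))%type.
Notation lab := (nat * vlab * nat)%type.

Definition sameks (v v' : vlab) : bool := (v.1.1 == v'.1.1) && (v.1.2 == v'.1.2).
Definition eqv (d : dat) (v v' : vlab) : bool :=
  sameks v v' && ((v.2.1 == v'.2.1) && eqV d v.2.2 v'.2.2).
Definition vinit (d : dat) (v : vlab) : bool := (v.2.1 == v.1.2) && eqV d (tau d v.1.2) v.2.2.

Definition op (d : dat) (j : nat) : nat := head 0 (pr d j).
(** Each predicate gets two rows, normalized to [sg (sum - bound) + kpz >= 0]. For [CmpApprox] they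
    have opposite signs and give both sides of the absolute value; for the other operators they
    agree, and for [CmpNApprox] the bit of [b] guesses the side. *)
Definition sg (d : dat) (b : seq bool) (j r : nat) : int :=
  if op d j < 2 then 1%:Z else
  if op d j == 2 then (if r == 0 then 1%:Z else (- 1%:Z)%R)
  else if nth false b j then 1%:Z else (- 1%:Z)%R.
Definition kpz (d : dat) (j : nat) : int :=
  if op d j == 3 then (- rz d (pr d j) 1)%R else rz d (pr d j) 1.

Definition predy (d : dat) (b : seq bool) (j r : nat) (v : vlab) : int :=
  (sg d b j r * \sum_(z <- [seq (coefz d i j * b2z ((v.1.1 == psch d i j) &&
     ((v.1.2 == pst d i j) && nth false v.2.2 (j * size (d_m d) + i))))%R | i : nat <- d_m d]) z)%R.
Definition predt (d : dat) (b : seq bool) (j r : nat) : int :=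
  (- (sg d b j r * rz d (pr d j) 4) + kpz d j)%R.

Definition Dz (d : dat) (b : bool) : int := if b then (d_D d)%:Z else 0%:Z.

(* Tags of rows: 0 flow, 1 circulation, 2 the bound of [y] by [c], 3 predicates.
   Tags of columns: 0 [x], 1 [c], 2 [y], 3 the slacks of rows 2, 4 the
   homogenizing variable, 5 the slacks of rows 3. *)
Definition coefm (d : dat) (b : seq bool) (r c : lab) : int :=
  if r.1.1 == 0 then
    if c.1.1 == 0 then (if sameks c.1.2 r.1.2 then kapz d c.1.2.2 c.2 r.1.2.2 else 0%:Z)
    else if c.1.1 == 2 then Dz d (eqv d c.1.2 r.1.2)
    else if c.1.1 == 4 then (- Dz d (vinit d r.1.2))%R else 0%:Z
  else if r.1.1 == 1 then
    if c.1.1 == 1 then (if sameks c.1.2 r.1.2 then kapz d c.1.2.2 c.2 r.1.2.2 else 0%:Z)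
    else 0%:Z
  else if r.1.1 == 2 then
    if c.1.1 == 1 then (if eqv d c.1.2 r.1.2 then (- enz d c.1.2.2.1 c.2)%R else 0%:Z)
    else if (c.1.1 == 2) || (c.1.1 == 3) then Dz d (eqv d c.1.2 r.1.2) else 0%:Z
  else
    if c.1.1 == 2 then predy d b r.1.2.1.1 r.2 c.1.2
    else if c.1.1 == 4 then predt d b r.1.2.1.1 r.2
    else if c.1.1 == 5 then (- Dz d ((c.1.2.1.1 == r.1.2.1.1) && (c.2 == r.2)))%R
    else 0%:Z.

Definition vlabs (d : dat) : seq vlab :=
  flatten [seq flatten [seq flatten [seq [seq (k, s0, (s, V)) | V : seq bool <- d_V d]
    | s : nat <- d_S d] | s0 : nat <- d_S d] | k : nat <- d_n d].

Definition valabs (d : dat) (g : nat) : seq lab :=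
  flatten [seq [seq (g, v, a) | a : nat <- d_A d] | v : vlab <- vlabs d].
Definition vzlabs (d : dat) (g : nat) : seq lab := [seq (g, v, 0) | v : vlab <- vlabs d].
Definition jlabs (d : dat) (g : nat) : seq lab :=
  flatten [seq [seq (g, (j, 0, (0, [::])), r) | r : nat <- [:: 0; 1]] | j : nat <- d_l d].

Definition cols (d : dat) : seq lab :=
  valabs d 0 ++ (valabs d 1 ++ (vzlabs d 2 ++ (vzlabs d 3 ++
    ((4, (0, 0, (0, [::])), 0) :: jlabs d 5)))).
Definition rows (d : dat) : seq lab :=
  vzlabs d 0 ++ (vzlabs d 1 ++ (vzlabs d 2 ++ jlabs d 3)).

(** A positive slack makes the rows of [CmpGt] and [CmpNApprox] strict; the homogenizing variable
    must be positive to be normalized to 1. *)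
Definition strict (d : dat) (c : lab) : bool :=
  (c.1.1 == 4) || ((c.1.1 == 5) && ((op d c.1.2.1.1 == 0) || (op d c.1.2.1.1 == 3))).

Definition Jl (d : dat) : seq bool := [seq strict d c | c : lab <- cols d].
Definition mat (d : dat) (b : seq bool) : seq (seq int) :=
  [seq [seq coefm d b r c | c : lab <- cols d] | r : lab <- rows d].

Definition decide (d : dat) : bool :=
  has (fun b => kerpos (iota 0 (size (Jl d))) (mat d b) (Jl d)) (d_B d).

(** * Running time of parsing and of the matrix *)

Section parse_pt.
Variables (T : encType) (mu : T -> nat).

Lemma PT_oseq (E : encType) (f : T -> option E) : PT mu f -> PT mu (fun x => oseq (f x)).
Proof. by apply: PT_recode => x; case: (f x). Qed.

Lemma esz_bval (s : seq bool) : esz (bval s) <= 1 + 4 * size s.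
Proof.
by apply: leq_trans (esz_nat _) _; have := blen_min (bval_lt s); lia.
Qed.

End parse_pt.

Lemma PT_decode (T : encType) (mu : T -> nat) (f : T -> seq (option bool)) :
  PT mu f -> PT mu (fun x => decode (f x)).
Proof.
move=> Hf; have [_ hf _] := Hf; apply: PT_rev; apply: PT_fst.
apply: (PT_foldl (step := fun _ => dec_step) (a0 := fun=> ([::], [::]))) => //.
- exact: PT_const (PT_adq Hf).
- by rewrite /dec_step; pt; apply: PT_oseq; pt.
exists (fun x => 4 + 8 * esz (f x)); first by pb.
move=> x i lei; set s := take i _.
have H : esz (foldl dec_step ([::], [::]) s).1 + 6 * size (foldl dec_step ([::], [::]) s).2
    <= 1 + 6 * size s.
  elim/last_ind: s => [|s o IH]; first by rewrite /= esz_nil.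
  rewrite foldl_rcons size_rcons; set st := foldl _ _ _ in IH *.
  case: o => [b|] /=; rewrite /dec_step /=; first by elia.
  by rewrite esz_cons; have := esz_bval (rev st.2); rewrite size_rev; elia.
case: (foldl _ _ _) H => u v /=; rewrite esz_pair; have := esz_bits v.
have : size s <= esz (f x) by rewrite /s size_take_min; have := size_esz (f x); lia.
by elia.
Qed.

(** The only source of lists of exponential length, for which [mu] must account. *)
Lemma PT_bseqs (T : encType) (mu : T -> nat) (f : T -> seq nat) :
  PT mu f -> pb mu (fun x => 2 ^ size (f x)) -> PT mu (fun x => bseqs (f x)).
Proof.
move=> Hf h2; have [_ hf _] := Hf.
apply: (PT_foldl (step := fun _ (acc : seq (seq bool)) (_ : nat) =>
  [seq false :: v | v : seq bool <- acc] ++ [seq true :: v | v : seq bool <- acc])) => //.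
- exact: PT_const (PT_adq Hf).
- by pt.
exists (fun x => 1 + 2 ^ size (f x) * (2 + 4 * esz (f x))); first by pb.
move=> x i lei; rewrite -/(bseqs (take i (f x))).
have le : size (take i (f x)) <= size (f x) by rewrite size_take_min geq_minr.
apply: leq_trans (@esz_seq_le _ _ (1 + 4 * esz (f x)) _) _.
  move=> x0 k ltk; apply: leq_trans (esz_bits _) _.
  have := mem_nth x0 ltk; rewrite mem_bseqs => /eqP ->.
  by have := size_esz (f x); elia.
by rewrite size_bseqs leq_add2l leq_mul// leq_exp2l.
Qed.

Lemma PT_upto (T : encType) (mu : T -> nat) (f : T -> seq nat) (g : T -> nat) :
  PT mu f -> PT mu g -> PT mu (fun x => upto (f x) (g x)).
Proof. by apply: PT_app2; rewrite /upto; pt. Qed.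

(** [nrm] may insert three numbers, but at least seven are dropped afterwards, so the remaining
    stream never grows. *)
Lemma esz_rst_next k r : esz (drop (7 + k) (nrm r)) <= esz r.
Proof.
rewrite /nrm; case: ifP => _; last exact: esz_drop.
rewrite (_ : 7 + k = (3 + k).+4) /=; last lia.
by apply: leq_trans (esz_drop _ _) _; rewrite -drop1; exact: esz_drop.
Qed.

Lemma esz_nrm (r : seq nat) : esz (nrm r) <= 20 + esz r.
Proof.
rewrite /nrm; case: ifP => _; last by rewrite leq_addl.
rewrite !esz_cons.
have : esz (head 0 r) + esz (behead r) <= 1 + esz r.
  by case: r => [|x r] //=; rewrite esz_cons; elia.
have := esz_nat 0; have := esz_nat 1; rewrite /blen.
by rewrite (_ : size (bits 0) = 0)// (_ : size (bits 1) = 1)//; elia.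
Qed.

Lemma PT_rsts (T : encType) (mu : T -> nat) (f : T -> seq nat) :
  PT mu f -> PT mu (fun x => rsts (f x)).
Proof.
move=> Hf; apply: (PT_comp (g := rsts) Hf); rewrite /rsts.
have H : PT esz (fun ts : seq nat => upto ts (nth 0 ts 0)) by apply: PT_upto; pt.
have [_ hl _] := H.
apply: PT_rev; apply: PT_snd.
apply: (PT_foldl (step := fun (ts : seq nat) => rst_step (nth 0 ts 1 * (5 + nth 0 ts 3)))
  (a0 := fun ts => (drop (5 + nth 0 ts 3 * nth 0 ts 4 * nth 0 ts 3 * 3) ts, [::]))
  (l := fun ts => upto ts (nth 0 ts 0))) => //.
- by pt.
- by rewrite /rst_step /nrm; pt.
exists (fun ts => 2 + esz ts + esz ts * (21 + esz ts)); first by pb.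
move=> ts i lei; set k := _ * _; set a := drop _ ts; set s := take i _.
have ha : esz a <= esz ts by exact: esz_drop.
have hs : size s <= esz ts.
  rewrite /s size_take_min size_filter; apply: leq_trans (geq_minr _ _) _.
  by apply: leq_trans (count_size _ _) _; rewrite size_iota; have := size_esz ts; elia.
have H1 : esz (foldl (rst_step k) (a, [::]) s).1 <= esz ts /\
    esz (foldl (rst_step k) (a, [::]) s).2 <= 1 + size s * (21 + esz ts).
  elim/last_ind: s {hs} => [|s o [IH1 IH2]]; first by [].
  rewrite foldl_rcons size_rcons; set st := foldl _ _ _ in IH1 IH2 *; rewrite /rst_step /=; split.
    exact: leq_trans (esz_rst_next _ _) IH1.
  by rewrite esz_cons; have := esz_nrm st.1; rewrite mulSn; elia.
case: (foldl _ _ _) H1 => u v /= [h1 h2]; rewrite esz_pair.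
by have := leq_mul hs (leqnn (21 + esz ts)); elia.
Qed.

Ltac pt_hook2 ::= first [simple apply PT_upto | simple apply PT_rsts].

Lemma PT_dataof (T : encType) (mu : T -> nat) (f : T -> seq nat) : PT mu f ->
  pb mu (fun x => 2 ^ size (upto (f x) (nth 0 (f x) 0 * nth 0 (f x) 1))) ->
  pb mu (fun x => 2 ^ size (upto (f x) (nth 0 (f x) 0))) ->
  PT mu (fun x => dataof (f x)).
Proof.
move=> Hf h1 h2; rewrite /dataof.
have HG : PT mu (fun x => upto (f x) (nth 0 (f x) 0 * nth 0 (f x) 1)) by pt.
have Hl : PT mu (fun x => upto (f x) (nth 0 (f x) 0)) by pt.
have HV := PT_bseqs HG h1; have HB := PT_bseqs Hl h2.
have HD : PT mu (fun x => den (f x)).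
  by apply: (PT_comp (g := den) Hf); rewrite /den; pt.
by pt.
Qed.

Section data_pt.
Variables (T : encType) (mu : T -> nat) (d : T -> dat).
Hypothesis Hd : PT mu d.

Lemma PT_d_ts : PT mu (fun x => d_ts (d x)). Proof. by rewrite /d_ts; pt. Qed.
Lemma PT_d_rs : PT mu (fun x => d_rs (d x)). Proof. by rewrite /d_rs; pt. Qed.
Lemma PT_d_D : PT mu (fun x => d_D (d x)). Proof. by rewrite /d_D; pt. Qed.
Lemma PT_d_S : PT mu (fun x => d_S (d x)). Proof. by rewrite /d_S; pt. Qed.
Lemma PT_d_A : PT mu (fun x => d_A (d x)). Proof. by rewrite /d_A; pt. Qed.
Lemma PT_d_l : PT mu (fun x => d_l (d x)). Proof. by rewrite /d_l; pt. Qed.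
Lemma PT_d_m : PT mu (fun x => d_m (d x)). Proof. by rewrite /d_m; pt. Qed.
Lemma PT_d_n : PT mu (fun x => d_n (d x)). Proof. by rewrite /d_n; pt. Qed.
Lemma PT_d_G : PT mu (fun x => d_G (d x)). Proof. by rewrite /d_G; pt. Qed.
Lemma PT_d_V : PT mu (fun x => d_V (d x)). Proof. by rewrite /d_V; pt. Qed.
Lemma PT_d_B : PT mu (fun x => d_B (d x)). Proof. by rewrite /d_B; pt. Qed.
Lemma PT_b2z (f : T -> bool) : PT mu f -> PT mu (fun x => b2z (f x)).
Proof. by move=> h; rewrite /b2z; pt. Qed.

End data_pt.

Ltac pt_hook2 ::= first [simple apply PT_d_ts | simple apply PT_d_rs | simple apply PT_d_D
  | simple apply PT_d_S | simple apply PT_d_A | simple apply PT_d_l | simple apply PT_d_m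
  | simple apply PT_d_n | simple apply PT_d_G | simple apply PT_d_V | simple apply PT_d_B
  | simple apply PT_b2z ].

Lemma PT_app4 (T A B C D E : encType) (mu : T -> nat) (g : A -> B -> C -> D -> E)
    (f : T -> A) (h : T -> B) (k : T -> C) (m : T -> D) :
  PT esz (fun q : A * B * C * D => g q.1.1.1 q.1.1.2 q.1.2 q.2) ->
  PT mu f -> PT mu h -> PT mu k -> PT mu m ->
  PT mu (fun x => g (f x) (h x) (k x) (m x)).
Proof.
by move=> H Hf Hh Hk Hm; exact: (PT_comp (PT_pair (PT_pair (PT_pair Hf Hh) Hk) Hm) H).
Qed.

Section matrix_pt1.
Variables (T : encType) (mu : T -> nat).

Lemma PT_rz (d : T -> dat) (ts : T -> seq nat) (p : T -> nat) :
  PT mu d -> PT mu ts -> PT mu p -> PT mu (fun x => rz (d x) (ts x) (p x)).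
Proof. by move=> H1 H2 H3; rewrite /rz; pt. Qed.

Lemma PT_pr (d : T -> dat) (p : T -> nat) : PT mu d -> PT mu p -> PT mu (fun x => pr (d x) (p x)).
Proof. by move=> H1 H2; rewrite /pr; pt. Qed.

Lemma PT_pbase (d : T -> dat) (p : T -> nat) :
  PT mu d -> PT mu p -> PT mu (fun x => pbase (d x) (p x)).
Proof. by move=> H1 H2; rewrite /pbase; pt. Qed.

Lemma PT_op (d : T -> dat) (p : T -> nat) : PT mu d -> PT mu p -> PT mu (fun x => op (d x) (p x)).
Proof. by move=> H1 H2; apply: PT_head; exact: PT_pr. Qed.

Lemma PT_trz (d : T -> dat) (f g h : T -> nat) :
  PT mu d -> PT mu f -> PT mu g -> PT mu h -> PT mu (fun x => trz (d x) (f x) (g x) (h x)).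
Proof. by move=> H1 H2 H3 H4; rewrite /trz; apply: PT_rz => //; pt. Qed.

End matrix_pt1.

Ltac pt_hook3 := fail.
Ltac pt_hook2 ::= first [simple apply PT_d_ts | simple apply PT_d_rs | simple apply PT_d_D
  | simple apply PT_d_S | simple apply PT_d_A | simple apply PT_d_l | simple apply PT_d_m
  | simple apply PT_d_n | simple apply PT_d_G | simple apply PT_d_V | simple apply PT_d_B
  | simple apply PT_b2z | simple apply PT_rz | simple apply PT_pr | simple apply PT_pbase
  | simple apply PT_op | simple apply PT_trz | pt_hook3 ].

Section matrix_pt2.
Variables (T : encType) (mu : T -> nat) (d : T -> dat).
Hypothesis Hd : PT mu d.

Lemma PT_tau (f : T -> nat) : PT mu f -> PT mu (fun x => tau (d x) (f x)).
Proof. by move=> Hf; apply: (PT_app2 (g := tau)) => //; rewrite /tau /ptg; pt. Qed.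

Lemma PT_eqV (f g : T -> seq bool) : PT mu f -> PT mu g -> PT mu (fun x => eqV (d x) (f x) (g x)).
Proof. by move=> Hf Hg; apply: (PT_app3 (g := eqV)) => //; rewrite /eqV; pt. Qed.

Lemma PT_enz (f g : T -> nat) : PT mu f -> PT mu g -> PT mu (fun x => enz (d x) (f x) (g x)).
Proof. by move=> Hf Hg; apply: (PT_app3 (g := enz)) => //; rewrite /enz; pt. Qed.

Lemma PT_sg (b : T -> seq bool) (f g : T -> nat) : PT mu b -> PT mu f -> PT mu g ->
  PT mu (fun x => sg (d x) (b x) (f x) (g x)).
Proof. by move=> Hb Hf Hg; rewrite /sg; pt. Qed.

Lemma PT_kpz (f : T -> nat) : PT mu f -> PT mu (fun x => kpz (d x) (f x)).
Proof. by move=> Hf; rewrite /kpz; pt. Qed.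

Lemma PT_Dz (f : T -> bool) : PT mu f -> PT mu (fun x => Dz (d x) (f x)).
Proof. by move=> Hf; rewrite /Dz; pt. Qed.

Lemma PT_sameks (f g : T -> vlab) : PT mu f -> PT mu g -> PT mu (fun x => sameks (f x) (g x)).
Proof. by move=> Hf Hg; rewrite /sameks; pt. Qed.

End matrix_pt2.

Ltac pt_hook3 ::= first [simple apply PT_tau | simple apply PT_eqV | simple apply PT_enz
  | simple apply PT_sg | simple apply PT_kpz | simple apply PT_Dz | simple apply PT_sameks].

Section matrix_pt3.
Variables (T : encType) (mu : T -> nat) (d : T -> dat).
Hypothesis Hd : PT mu d.

Lemma PT_unionV (f : T -> seq bool) (g : T -> nat) : PT mu f -> PT mu g ->
  PT mu (fun x => unionV (d x) (f x) (g x)).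
Proof. by move=> Hf Hg; apply: (PT_app3 (g := unionV)) => //; rewrite /unionV; pt. Qed.

Lemma PT_eqv (f g : T -> vlab) : PT mu f -> PT mu g -> PT mu (fun x => eqv (d x) (f x) (g x)).
Proof. by move=> Hf Hg; rewrite /eqv; pt. Qed.

Lemma PT_vinit (f : T -> vlab) : PT mu f -> PT mu (fun x => vinit (d x) (f x)).
Proof. by move=> Hf; rewrite /vinit; pt. Qed.

Lemma PT_predt (b : T -> seq bool) (f g : T -> nat) : PT mu b -> PT mu f -> PT mu g ->
  PT mu (fun x => predt (d x) (b x) (f x) (g x)).
Proof. by move=> Hb Hf Hg; rewrite /predt; pt. Qed.

Lemma PT_predy (b : T -> seq bool) (f g : T -> nat) (v : T -> vlab) :
  PT mu b -> PT mu f -> PT mu g -> PT mu v ->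
  PT mu (fun x => predy (d x) (b x) (f x) (g x) (v x)).
Proof.
move=> Hb Hf Hg Hv.
apply: (PT_app4 (g := fun d' w j (b' : seq bool * nat) => predy d' b'.1 j b'.2 w)
  (m := fun x => (b x, g x))) => //; last exact: PT_pair.
by rewrite /predy /coefz /psch /pst; pt.
Qed.

End matrix_pt3.

Lemma PT_kapz (T : encType) (mu : T -> nat) (d : T -> dat) (f : T -> nat * seq bool)
    (g : T -> nat) (h : T -> nat * seq bool) : PT mu d -> PT mu f -> PT mu g -> PT mu h ->
  PT mu (fun x => kapz (d x) (f x) (g x) (h x)).
Proof.
move=> Hd Hf Hg Hh; apply: (PT_app4 (g := kapz)) => //; rewrite /kapz; pt.
by apply: PT_unionV; pt.
Qed.

Ltac pt_hook3 ::= first [simple apply PT_eqv | simple apply PT_vinit | simple apply PT_predt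
  | simple apply PT_predy | simple apply PT_kapz | simple apply PT_enz | simple apply PT_Dz
  | simple apply PT_sameks].

Lemma PT_coefm (T : encType) (mu : T -> nat) (d : T -> dat) (b : T -> seq bool) (r c : T -> lab) :
  PT mu d -> PT mu b -> PT mu r -> PT mu c -> PT mu (fun x => coefm (d x) (b x) (r x) (c x)).
Proof. by move=> Hd Hb Hr Hc; rewrite /coefm; pt. Qed.

Lemma PT_vlabs (T : encType) (mu : T -> nat) (d : T -> dat) : PT mu d ->
  PT mu (fun x => vlabs (d x)).
Proof. by move=> Hd; apply: (PT_comp (g := vlabs) Hd); rewrite /vlabs; pt. Qed.

Ltac pt_hook3 ::= first [simple apply PT_vlabs | simple apply PT_coefm].

Lemma PT_cols (T : encType) (mu : T -> nat) (d : T -> dat) : PT mu d ->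
  PT mu (fun x => cols (d x)).
Proof.
by move=> Hd; apply: (PT_comp (g := cols) Hd); rewrite /cols /valabs /vzlabs /jlabs; pt.
Qed.

Lemma PT_rows (T : encType) (mu : T -> nat) (d : T -> dat) : PT mu d ->
  PT mu (fun x => rows (d x)).
Proof.
by move=> Hd; apply: (PT_comp (g := rows) Hd); rewrite /rows /vzlabs /jlabs; pt.
Qed.

Ltac pt_hook3 ::= first [simple apply PT_cols | simple apply PT_rows | simple apply PT_coefm].

Lemma PT_decide (T : encType) (mu : T -> nat) (d : T -> dat) : PT mu d ->
  PT mu (fun x => decide (d x)).
Proof.
move=> Hd; apply: (PT_comp (g := decide) Hd); rewrite /decide.
have HJ : PT esz (fun q : dat * seq bool => Jl q.1).
  by rewrite /Jl /strict; pt.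
have HM : PT esz (fun q : dat * seq bool => mat q.1 q.2).
  by rewrite /mat; pt.
by pt; exact: PT_kerpos.
Qed.

(** * The input as a list of numbers *)

Lemma nth_flatten_const (T U : Type) (x0 : U) (t0 : T) (f : T -> seq U) w s i q :
  (forall x, size (f x) = w) -> i < size s -> q < w ->
  nth x0 (flatten [seq f x | x <- s]) (i * w + q) = nth x0 (f (nth t0 s i)) q.
Proof.
move=> hw; elim: s i => // x s IHs [|i] lti ltq /=; rewrite nth_cat hw.
  by rewrite mul0n add0n ltq.
by rewrite mulSn -addnA ltnNge leq_addr addKn IHs.
Qed.

Lemma size_flatten_map (T U : Type) (f : T -> seq U) w s : (forall x, size (f x) = w) ->
  size (flatten [seq f x | x <- s]) = size s * w.
Proof. by move=> hw; elim: s => //= x s IHs; rewrite size_cat IHs hw mulSn. Qed.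

Lemma enum_prodE (T1 T2 : finType) : enum {: T1 * T2} =
  flatten [seq [seq (x, y) | y <- enum T2] | x <- enum T1].
Proof. by transitivity (prod_enum T1 T2) => //; rewrite enumT unlock. Qed.

Lemma enum_rank_prod (T1 T2 : finType) (x : T1) (y : T2) :
  enum_rank (x, y) = enum_rank x * #|T2| + enum_rank y :> nat.
Proof.
have lt : enum_rank x * #|T2| + enum_rank y < #|{: T1 * T2}|.
  have h1 : enum_rank x < #|T1| by []; have h2 : enum_rank y < #|T2| by [].
  rewrite card_prod; move: h1 h2; set a := nat_of_ord _; set b := nat_of_ord _.
  by set c := #|T1|; set d := #|T2|; nia.
have e : nth (x, y) (enum {: T1 * T2}) (enum_rank x * #|T2| + enum_rank y) = (x, y).
  rewrite enum_prodE (@nth_flatten_const _ _ _ x)//.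
  - by rewrite (nth_map y) -?cardE// !nth_enum_rank.
  - by move=> z; rewrite size_map -cardE.
  - by rewrite -cardE.
have : enum_val (Ordinal lt) = (x, y) by rewrite (enum_val_nth (x, y)).
by move=> /(congr1 enum_rank); rewrite enum_valK => /(congr1 val)/= ->.
Qed.

Lemma rank_eq (T : finType) (x y : T) : ((enum_rank x : nat) == enum_rank y) = (x == y).
Proof. by rewrite -(inj_eq enum_rank_inj). Qed.

Lemma iota_rank (T : finType) : iota 0 #|T| = [seq (enum_rank x : nat) | x <- enum T].
Proof.
apply: (@eq_from_nth _ 0); first by rewrite size_iota size_map -cardE.
move=> i; rewrite size_iota => lti; have x0 := enum_val (Ordinal lti).
rewrite nth_iota// (nth_map x0) -?cardE// add0n.
have -> : nth x0 (enum T) i = enum_val (Ordinal lti) by rewrite (enum_val_nth x0).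
by rewrite enum_valK.
Qed.

Lemma iota_ord n : iota 0 n = [seq nat_of_ord i | i : 'I_n <- enum 'I_n].
Proof. by rewrite val_enum_ord. Qed.

Definition rtoks (q : rat) : seq nat := [:: ((numq q < 0)%R : nat); `|numq q|%N; `|denq q|%N].

Definition ttoks (M : mdp) : seq nat :=
  flatten [seq flatten [seq rtoks (trans sa.1 sa.2 s') | s' <- enum (state M)]
          | sa <- enum {: state M * act M}].

Definition ctoks (c : cmp_op) : seq nat :=
  match c with
  | CmpGt => [:: 0] | CmpGe => [:: 1]
  | CmpApprox e => 2 :: rtoks e | CmpNApprox e => 3 :: rtoks e
  end.

Definition ccode (c : cmp_op) : nat :=
  match c with CmpGt => 0 | CmpGe => 1 | CmpApprox _ => 2 | CmpNApprox _ => 3 end.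

Lemma etok_cat s t : etok (s ++ t) = etok s ++ etok t.
Proof. by rewrite /etok map_cat flatten_cat. Qed.

Lemma etok_flatten (T : Type) (f : T -> seq nat) s :
  etok (flatten [seq f x | x <- s]) = flatten [seq etok (f x) | x <- s].
Proof. by elim: s => //= x s IHs; rewrite etok_cat IHs. Qed.

Lemma etok_rat q : etok (rtoks q) = enc_rat q.
Proof. by rewrite /etok /enc_rat /= cats0. Qed.

Lemma enc_mdp_etok M : enc_mdp M = etok ([:: #|state M|; #|act M|] ++ ttoks M).
Proof.
rewrite etok_cat [etok [:: _; _]]/etok /= cats0 /enc_mdp -catA; do 2 congr (_ ++ _).
rewrite /ttoks etok_flatten; elim: (enum {: state M * act M}) => //= sa ss IHs.
rewrite flatten_cat IHs etok_flatten; congr (flatten _ ++ _).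
by apply: eq_map => s'; rewrite etok_rat.
Qed.

Lemma size_ttoks M : size (ttoks M) = #|state M| * #|act M| * #|state M| * 3.
Proof.
rewrite /ttoks (@size_flatten_map _ _ _ (#|state M| * 3)) => [|sa].
  by rewrite -cardE card_prod mulnA.
by rewrite (@size_flatten_map _ _ _ 3)// -cardE.
Qed.

Section tokens.
Variable I : conj_rel_reach.
Let M := crr_mdp I.
Let l := crr_l I.
Let m := crr_m I.
Let n := crr_n I.
Let S := #|state M|.
Let A := #|act M|.

Definition itoks (j : 'I_l) (i : 'I_m) : seq nat :=
  rtoks (crr_coef i j) ++ ((enum_rank (crr_state i j) : nat) :: (crr_sched i j : nat) ::
    [seq (x \in crr_target i j : nat) | x <- enum (state M)]).

Definition ptoks (j : 'I_l) : seq nat :=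
  ctoks (crr_cmp j) ++ rtoks (crr_bound j) ++ flatten [seq itoks j i | i <- enum 'I_m].

Definition ntoks (j : 'I_l) : seq nat :=
  (ccode (crr_cmp j) :: rtoks (cmp_eps (crr_cmp j))) ++ rtoks (crr_bound j) ++
    flatten [seq itoks j i | i <- enum 'I_m].

Definition toks : seq nat :=
  [:: l; m; n; S; A] ++ ttoks M ++ flatten [seq ptoks j | j <- enum 'I_l].

Lemma enc_crr_etok : enc_crr I = etok toks.
Proof.
have -> : etok toks = enc_nat l ++ enc_nat m ++ enc_nat n ++
  etok (([:: S; A] ++ ttoks M) ++ flatten [seq ptoks j | j <- enum 'I_l]) by [].
rewrite /enc_crr; do 3 congr (_ ++ _); rewrite etok_cat -enc_mdp_etok; congr (_ ++ _).
rewrite etok_flatten; congr flatten; apply: eq_map => j; rewrite !etok_cat etok_rat; congr (_ ++ _).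
  by case: (crr_cmp j) => [||e|e] //=; rewrite /etok /= ?cats0 // -etok_rat.
congr (_ ++ _); rewrite etok_flatten; congr flatten; apply: eq_map => i.
rewrite etok_cat etok_rat /etok /=; congr (_ ++ (_ ++ (_ ++ _))).
  by rewrite /enc_fin enum_rank_ord.
by rewrite /enc_set -map_comp.
Qed.

Lemma size_itoks j i : size (itoks j i) = 5 + S.
Proof. by rewrite /itoks size_cat /= size_map -cardE. Qed.

Lemma size_ntoks j : size (ntoks j) = 7 + m * (5 + S).
Proof.
by rewrite /ntoks !size_cat (size_flatten_map _ (size_itoks j)) /= size_enum_ord.
Qed.

Lemma nrm_ptoks j r : nrm (ptoks j ++ r) = ntoks j ++ r.
Proof. by rewrite /nrm /ptoks /ntoks; case: (crr_cmp j). Qed.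

Lemma size_ptoks j : 4 + m * (5 + S) <= size (ptoks j).
Proof.
rewrite /ptoks !size_cat (size_flatten_map _ (size_itoks j)) size_enum_ord.
by rewrite /=; case: (crr_cmp j) => [||e|e] /=; lia.
Qed.

Lemma size_toks : 5 + S * A * S * 3 + l * (4 + m * (5 + S)) <= size toks.
Proof.
rewrite /toks !size_cat size_ttoks /= -addnA leq_add2l.
rewrite leq_add2l; rewrite -{1}(size_enum_ord l).
by elim: (enum _) => //= j s IHs; rewrite size_cat mulSn leq_add ?size_ptoks.
Qed.

(** Surjectivity of the scheduler indices bounds [n], which is written in binary, by a number that
    the input is long enough to list. *)
Lemma le_n : n <= l * m.
Proof.
have : codom (fun g : 'I_l * 'I_m => crr_sched g.2 g.1) =i predT.
  move=> k; rewrite inE; apply/codomP; have [i [j <-]] := crr_sched_surj k.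
  by exists (j, i).
move=> H; have := leq_image_card (fun g : 'I_l * 'I_m => crr_sched g.2 g.1) predT.
rewrite (eq_card H) card_ord => h; apply: leq_trans h _.
by rewrite card_prod !card_ord.
Qed.

Let S0 : 0 < S. Proof. exact: state_gt0. Qed.
Let A0 : 0 < A. Proof. exact: act_gt0. Qed.

Definition dI : dat := dataof toks.

Lemma dI_S : d_S dI = [seq (enum_rank x : nat) | x <- enum (state M)].
Proof.
rewrite -iota_rank; apply: uptoE; apply: leq_trans size_toks; rewrite /=.
by have := leq_mul (leq_mul (leqnn S) A0) S0; rewrite !muln1; lia.
Qed.

Lemma dI_A : d_A dI = [seq (enum_rank x : nat) | x <- enum (act M)].
Proof.
rewrite -iota_rank; apply: uptoE; apply: leq_trans size_toks; rewrite /=.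
by have := leq_mul (leq_mul S0 (leqnn A)) S0; rewrite !muln1 mul1n; lia.
Qed.

Lemma dI_l : d_l dI = [seq nat_of_ord j | j : 'I_l <- enum 'I_l].
Proof.
rewrite -iota_ord; apply: uptoE; apply: leq_trans size_toks; rewrite /= mulnDr; lia.
Qed.

Let le_lm : l * m <= size toks.
Proof.
by apply: leq_trans size_toks; rewrite mulnDr mulnA mulnDr; lia.
Qed.

(** For [l = 0] no operand is written, and [m] may exceed the length of the input. *)
Lemma dI_m : 0 < l -> d_m dI = [seq nat_of_ord j | j : 'I_m <- enum 'I_m].
Proof.
move=> l0; rewrite -iota_ord; apply: uptoE; apply: leq_trans le_lm; rewrite /=.
by rewrite leq_pmull.
Qed.

Lemma dI_n : d_n dI = [seq nat_of_ord j | j : 'I_n <- enum 'I_n].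
Proof. by rewrite -iota_ord; apply: uptoE; apply: leq_trans le_lm; exact: le_n. Qed.

Lemma dI_G : d_G dI = iota 0 (l * m).
Proof. exact: uptoE. Qed.

Lemma size_dI_S : size (d_S dI) = S. Proof. by rewrite dI_S size_map -cardE. Qed.
Lemma size_dI_A : size (d_A dI) = A. Proof. by rewrite dI_A size_map -cardE. Qed.

(** A record is the whole remaining stream; only its front is read, and [r j] is the rest. *)
Lemma dI_rs : exists r : 'I_l -> seq nat, forall j : 'I_l, pr dI j = ntoks j ++ r j.
Proof.
pose k := m * (5 + S).
pose ch := fix ch (js : seq 'I_l) := if js is j :: js' then
  (ntoks j ++ flatten (map ptoks js')) :: ch js' else [::].
have H js ix acc : size ix = size js ->
    foldl (rst_step k) (flatten (map ptoks js), acc) ix = ([::], rev (ch js) ++ acc).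
  elim: js ix acc => [|j js IHjs] [|i ix] acc //= [e].
  rewrite /rst_step /= nrm_ptoks drop_size_cat ?size_ntoks// IHjs//.
  by rewrite rev_cons cat_rcons.
have rsE : d_rs dI = ch (enum 'I_l).
  rewrite /dI /d_rs /= /rsts -/(d_l dI).
  have -> : drop (5 + nth 0 toks 3 * nth 0 toks 4 * nth 0 toks 3 * 3) toks =
      flatten (map ptoks (enum 'I_l)).
    rewrite /toks [nth 0 _ 3]/= [nth 0 _ 4]/= catA drop_size_cat//.
    by rewrite size_cat size_ttoks.
  rewrite H; first by rewrite cats0 revK.
  by have := dI_l; rewrite /d_l /= => ->; rewrite size_map.
exists (fun j => flatten (map ptoks (drop j.+1 (enum 'I_l)))) => j.
rewrite /pr rsE; have N js i j0 : i < size js -> nth [::] (ch js) i =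
    ntoks (nth j0 js i) ++ flatten (map ptoks (drop i.+1 js)).
  by elim: js i => // a js IHjs [|i] lti /=; rewrite ?drop0// IHjs.
by rewrite (N _ _ j) ?size_enum_ord// nth_ord_enum.
Qed.

Lemma pr_base (j : 'I_l) p : p < 7 -> nth 0 (pr dI j) p =
  nth 0 (ccode (crr_cmp j) :: rtoks (cmp_eps (crr_cmp j)) ++ rtoks (crr_bound j)) p.
Proof.
move=> ltp; have [r ->] := dI_rs; rewrite nth_cat size_ntoks ltn_addr// /ntoks catA nth_cat.
by rewrite /= ltp.
Qed.

Lemma pr_item (j : 'I_l) (i : 'I_m) q : q < 5 + S ->
  nth 0 (pr dI j) (pbase dI i + q) = nth 0 (itoks j i) q.
Proof.
move=> ltq; have [r ->] := dI_rs; rewrite /pbase size_dI_S nth_cat size_ntoks.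
have lt : i * (5 + S) + q < m * (5 + S).
  by have := ltn_ord i; move: (nat_of_ord i) => a; nia.
rewrite -addnA ltn_add2l lt /ntoks catA nth_cat (_ : size (_ ++ _) = 7)// ltnNge leq_addr addKn.
by rewrite (@nth_flatten_const _ _ _ i) ?size_enum_ord ?nth_ord_enum//; exact: size_itoks.
Qed.

Lemma dvd_den t : t \in toks -> 0 < t -> t %| den toks.
Proof.
rewrite /den big_map; elim: toks => // a s IHs; rewrite inE big_cons => /predU1P[<-|ts] t0.
  by rewrite (gtn_eqF t0) dvdn_mulr.
by rewrite dvdn_mull// IHs.
Qed.

Lemma den_gt0 : 0 < d_D dI.
Proof.
rewrite /d_D /= /den big_map; elim: toks => [|a s IHs]; rewrite ?big_nil// big_cons muln_gt0 IHs andbT.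
by case: eqP => // /eqP; rewrite lt0n.
Qed.

Lemma op_dI (j : 'I_l) : op dI j = ccode (crr_cmp j).
Proof. by rewrite /op -nth0 pr_base. Qed.

Lemma psch_dI (j : 'I_l) (i : 'I_m) : psch dI i j = crr_sched i j.
Proof. by rewrite /psch pr_item. Qed.

Lemma pst_dI (j : 'I_l) (i : 'I_m) : pst dI i j = enum_rank (crr_state i j).
Proof. by rewrite /pst pr_item. Qed.

Lemma ptg_dI (j : 'I_l) (i : 'I_m) s : ptg dI i j (enum_rank s) = (s \in crr_target i j).
Proof.
rewrite /ptg pr_item ?ltn_add2l// /itoks nth_cat /= (nth_map s) -?cardE ?add0n ?ltn_ord//.
by rewrite nth_enum_rank; case: (s \in _).
Qed.

Section scaled.
Variable R : realType.

Lemma rzE (d : dat) ts p q : [/\ nth 0 ts p = (numq q < 0)%R, nth 0 ts p.+1 = `|numq q|%N &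
    nth 0 ts p.+2 = `|denq q|%N] -> `|denq q|%N %| d_D d ->
  ((rz d ts p)%:~R = (d_D d)%:R * ratr q :> R)%R.
Proof.
rewrite /rz => -[-> -> ->] /dvdnP[k ->]; rewrite mulnK ?absz_gt0 ?denq_neq0//.
have -> : zmk (0 < (numq q < 0)%R) (`|numq q| * k) = (numq q * k%:Z)%R.
  by rewrite -[in RHS](zmk_abs (numq q)) /zmk; case: (numq q < 0)%R => /=; rewrite PoszM ?mulNr.
rewrite natrM intrM /ratr.
have -> : (`|denq q|%:R = (denq q)%:~R :> R)%R by rewrite -[in RHS]absz_denq -pmulrn.
have -> : ((k%:Z)%:~R = k%:R :> R)%R by [].
have dn : ((denq q)%:~R != 0 :> R)%R by rewrite intr_eq0 denq_neq0.
by field.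
Qed.

Lemma den_mem q (s : seq nat) : `|denq q|%N \in s -> {subset s <= toks} -> `|denq q|%N %| d_D dI.
Proof. by move=> qs sub; apply: dvd_den; [exact: sub|rewrite absz_gt0 denq_neq0]. Qed.

Lemma ptoks_sub j : {subset ptoks j <= toks}.
Proof.
move=> t tj; rewrite /toks !mem_cat; apply/orP; right; apply/orP; right.
by apply/flattenP; exists (ptoks j) => //; apply/mapP; exists j; rewrite ?mem_enum.
Qed.

Lemma trzE (s : state M) (a : act M) (s' : state M) : ((trz dI (enum_rank s) (enum_rank a) (enum_rank s'))%:~R =
  (d_D dI)%:R * trR R s a s')%R.
Proof.
have e q : q < 3 -> nth 0 toks (5 + ((enum_rank s * A + enum_rank a) * S + enum_rank s') * 3 + q) =
    nth 0 (rtoks (trans s a s')) q.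
  move=> ltq; have lt : ((enum_rank s * A + enum_rank a) * S + enum_rank s') * 3 + q < S * A * S * 3.
    have := ltn_ord (enum_rank s); have := ltn_ord (enum_rank a); have := ltn_ord (enum_rank s').
    rewrite -/S -/A; move: (nat_of_ord (enum_rank s)) (nat_of_ord (enum_rank a)) (nat_of_ord (enum_rank s')).
    move=> x y z hz hy hx.
    have h1 : x * A + y < S * A by nia.
    have h2 : (x * A + y) * S + z < S * A * S by nia.
    by nia.
  rewrite /toks nth_cat [size [:: _; _; _; _; _]]/= -addnA ltnNge leq_addr addKn nth_cat size_ttoks lt.
  rewrite /ttoks -enum_rank_prod mulnDl -addnA -mulnA.
  rewrite (@nth_flatten_const _ _ _ (s, a))//.
  - rewrite nth_enum_rank (@nth_flatten_const _ _ _ s)//; first by rewrite nth_enum_rank.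
    by rewrite -cardE.
  - by move=> sa; rewrite (@size_flatten_map _ _ _ 3)// -cardE.
  - by rewrite -cardE.
  - by have := ltn_ord (enum_rank s'); rewrite -/S; move: (nat_of_ord _) => z; nia.
rewrite /trz size_dI_S size_dI_A; apply: rzE.
  by split; [rewrite -[X in nth _ _ X]addn0 e|rewrite -addn1 e|rewrite -addn2 e].
have /den_mem : `|denq (trans s a s')|%N \in ttoks M.
  apply/flattenP; exists (flatten [seq rtoks (trans s a s') | s' <- enum (state M)]).
    by apply/mapP; exists (s, a); rewrite ?mem_enum.
  apply/flattenP; exists (rtoks (trans s a s')); last by rewrite !inE eqxx !orbT.
  by apply/mapP; exists s'; rewrite ?mem_enum.
by apply=> t tt; rewrite /toks !mem_cat tt orbT.
Qed.

Lemma epszE (j : 'I_l) : ((rz dI (pr dI j) 1)%:~R = (d_D dI)%:R * ratr (cmp_eps (crr_cmp j)) :> R)%R.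
Proof.
apply: rzE; first by rewrite !pr_base.
case E : (crr_cmp j) => [||e|e] /=; rewrite ?dvd1n//; apply: (@den_mem _ (ptoks j)) (@ptoks_sub j);
  by rewrite /ptoks E mem_cat !inE eqxx !orbT.
Qed.

Lemma bndzE (j : 'I_l) : ((rz dI (pr dI j) 4)%:~R = (d_D dI)%:R * ratr (crr_bound j) :> R)%R.
Proof.
apply: rzE; first by rewrite !pr_base.
by apply: (@den_mem _ (ptoks j)) (@ptoks_sub j); rewrite /ptoks !mem_cat !inE eqxx !orbT.
Qed.

Lemma coefzE (j : 'I_l) (i : 'I_m) :
  ((coefz dI i j)%:~R = (d_D dI)%:R * ratr (crr_coef i j) :> R)%R.
Proof.
apply: rzE.
  by split; [rewrite -[X in nth _ _ X]addn0 pr_item|rewrite -addn1 pr_item|rewrite -addn2 pr_item].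
apply: (@den_mem _ (ptoks j)) (@ptoks_sub j); rewrite /ptoks !mem_cat; apply/orP; right; apply/orP; right.
apply/flattenP; exists (itoks j i); first by apply/mapP; exists i; rewrite ?mem_enum.
by rewrite mem_cat !inE eqxx !orbT.
Qed.

End scaled.
End tokens.

(** * The matrix over the reals *)

Local Open Scope ring_scope.

Lemma sum_rank (V : nmodType) (K : finType) (h : nat -> V) :
  \sum_(i <- [seq (enum_rank x : nat) | x <- enum K]) h i = \sum_(x : K) h (enum_rank x).
Proof. by rewrite big_map big_enum. Qed.

Lemma sum_ord (V : nmodType) (n : nat) (h : nat -> V) :
  \sum_(i <- [seq nat_of_ord x | x : 'I_n <- enum 'I_n]) h i = \sum_(x < n) h x.
Proof. by rewrite big_map big_enum. Qed.

(** The first hypothesis says, in the form needed for sums, that [scols] lists every index exactly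
    once; testing it with an indicator gives membership. *)
Lemma kerpos_finType (F : realFieldType) (SC SR : finType) (scols : seq SC) (srows : seq SR)
    (f : SR -> SC -> int) (J : SC -> bool) :
  (forall h : SC -> F, \sum_(c <- scols) h c = \sum_c h c) -> (forall r, r \in srows) ->
  kerpos (iota 0 (size scols)) [seq [seq f r c | c <- scols] | r <- srows] [seq J c | c <- scols] <->
  exists x : SC -> F, [/\ forall c, 0 <= x c, forall r, \sum_c (f r c)%:~R * x c = 0 &
    forall c, J c -> 0 < x c].
Proof.
move=> hsum hrow; set N := size scols.
have mem c : c \in scols.
  apply/negPn/negP => nc; have := hsum (fun c' => (c' == c)%:R).
  rewrite big_seq big1 => [|c' c's]; last by case: eqP nc c's => // -> /negbTE ->.
  rewrite (bigD1 c)//= eqxx => /esym/eqP; rewrite paddr_eq0 ?ler01//; last by apply: sumr_ge0.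
  by rewrite oner_eq0.
have rE r (z : 'cV[F]_N) : (map_mx intr (rvl N [seq f r c | c <- scols]) *m z) 0 0 =
    \sum_(i < N) (nth 0 [seq f r c | c <- scols] i)%:~R * z i 0.
  by rewrite mxE; apply: eq_bigr => i _; rewrite !mxE.
split.
  move=> /(kerposP F)[z [[z0 zA] zJ]].
  exists (fun c => \sum_(i < N) (nth c scols i == c)%:R * z i 0); split.
  - by move=> c; apply: sumr_ge0 => i _; rewrite mulr_ge0.
  - move=> r; have := zA _ (map_f _ (hrow r)) => /matrixP/(_ 0 0); rewrite rE mxE => e; rewrite -[RHS]e.
    rewrite (eq_bigr (fun c => \sum_(i < N) (f r c)%:~R * ((nth c scols i == c)%:R * z i 0))) => [|c _]; last by rewrite mulr_sumr.
    rewrite exchange_big /=; apply: eq_bigr => i _.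
    have c0 : SC := tnth (in_tuple scols) i.
    rewrite (nth_map c0)//.
    rewrite (eq_bigr (fun c => (c == nth c0 scols i)%:R * ((f r c)%:~R * z i 0))) => [|c _].
      rewrite (bigD1 (nth c0 scols i))//= eqxx mul1r big1 ?addr0// => c /negbTE ->.
      by rewrite mul0r.
    by rewrite (set_nth_default c0)// [nth _ _ _ == _]eq_sym mulrCA.
  - move=> c Jc; have lt : (index c scols < N)%N by rewrite index_mem.
    rewrite (bigD1 (Ordinal lt))//= nth_index// eqxx mul1r.
    rewrite ltr_wpDr//; first by apply: sumr_ge0 => i _; rewrite mulr_ge0.
    by apply: zJ; rewrite (nth_map c) ?nth_index.
move=> [x [x0 xA xJ]]; apply/(kerposP F).
have nthE (i : 'I_N) c0 : nth 0 [seq x c | c <- scols] i = x (nth c0 scols i) by rewrite (nth_map c0).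
exists (\col_i nth 0 [seq x c | c <- scols] i); split; last first.
  move=> i; rewrite mxE; have c0 : SC := tnth (in_tuple scols) i.
  by rewrite (nthE _ c0) (nth_map c0)//; exact: xJ.
split; first by move=> i; rewrite mxE (nthE _ (tnth (in_tuple scols) i)).
move=> _ /mapP[r _ ->]; apply/matrixP => a b; rewrite !ord1 rE mxE -[RHS](xA r) -hsum.
have -> : \sum_(c <- scols) (f r c)%:~R * x c = \sum_(z <- [seq (f r c)%:~R * x c | c <- scols]) z by rewrite big_map.
rewrite (big_nth 0) size_map big_mkord; apply: eq_bigr => i _; rewrite mxE.
have c0 : SC := tnth (in_tuple scols) i.
by rewrite (nthE _ c0) !(nth_map c0).
Qed.

Lemma sum_pair (V : nmodType) (A B : finType) (h : A * B -> V) :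
  \sum_p h p = \sum_a \sum_b h (a, b).
Proof. by rewrite (pair_bigA _ (fun a b => h (a, b))); apply: eq_bigr => -[]. Qed.

(** * Raw labels against typed indices *)

Section semantic_matrix.
Variables (R : realType) (I : conj_rel_reach).
Let M := crr_mdp I.
Let l := crr_l I.
Let m := crr_m I.
Let n := crr_n I.
Let G : finType := ('I_l * 'I_m)%type.
Let Tg (g : G) : {set state M} := crr_target g.2 g.1.
Let US : finType := ustate M G.
Let d := dI I.

Definition svar : finType := ('I_n * state M * US)%type.
Definition scol : finType :=
  ((svar * act M + svar * act M) + ((svar + svar) + (unit + 'I_l * bool)))%type.
Definition srow : finType := ((svar + svar) + (svar + 'I_l * bool))%type.

Definition rawV (V : {set G}) : seq bool := [seq g \in V | g <- enum G].
Definition setV (v : seq bool) : {set G} := [set g | nth false v (enum_rank g)].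
Definition rawu (u : US) : nat * seq bool := (enum_rank u.1 : nat, rawV u.2).
Definition rawv (v : svar) : vlab := (v.1.1 : nat, enum_rank v.1.2 : nat, rawu v.2).
Definition rawj (j : 'I_l) : vlab := (j : nat, 0%N, (0%N, [::])).

Definition rawc (c : scol) : lab :=
  match c with
  | inl (inl (v, a)) => (0%N, rawv v, enum_rank a : nat)
  | inl (inr (v, a)) => (1%N, rawv v, enum_rank a : nat)
  | inr (inl (inl v)) => (2%N, rawv v, 0%N)
  | inr (inl (inr v)) => (3%N, rawv v, 0%N)
  | inr (inr (inl _)) => (4%N, (0%N, 0%N, (0%N, [::])), 0%N)
  | inr (inr (inr (j, r))) => (5%N, rawj j, r : nat)
  end.

Definition rawr (r : srow) : lab :=
  match r with
  | inl (inl v) => (0%N, rawv v, 0%N)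
  | inl (inr v) => (1%N, rawv v, 0%N)
  | inr (inl v) => (2%N, rawv v, 0%N)
  | inr (inr (j, r)) => (3%N, rawj j, r : nat)
  end.

Let cardG : #|G| = (l * m)%N. Proof. by rewrite card_prod !card_ord. Qed.

Lemma size_rawV V : size (rawV V) = (l * m)%N. Proof. by rewrite size_map -cardE cardG. Qed.

Lemma nth_rawV V g : nth false (rawV V) (enum_rank g) = (g \in V).
Proof. by rewrite (nth_map g) -?cardE// nth_enum_rank. Qed.

Lemma rawVK : cancel rawV setV.
Proof. by move=> V; apply/setP => g; rewrite inE nth_rawV. Qed.

Lemma setVK v : size v = (l * m)%N -> rawV (setV v) = v.
Proof.
move=> sv; apply: (@eq_from_nth _ false); first by rewrite size_rawV.
move=> i; rewrite size_rawV -cardG => lti.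
have -> : i = enum_rank (enum_val (Ordinal lti)) by rewrite enum_valK.
by rewrite nth_rawV inE.
Qed.

Lemma eqV_raw (V W : {set G}) : eqV d (rawV V) (rawV W) = (V == W).
Proof.
rewrite /eqV dI_G; apply/allP/eqP => [H|-> i _]; last by case: (nth _ _ _).
apply/setP => g; rewrite -!nth_rawV; have := H (enum_rank g).
rewrite mem_iota add0n /= -cardG ltn_ord => /(_ isT).
by case: (nth false (rawV V) _) (nth false (rawV W) _) => -[].
Qed.

Lemma tau_raw s : tau d (enum_rank s) = rawV [set g | s \in Tg g].
Proof.
rewrite /tau /rawV enum_prodE /d dI_l map_flatten -!map_comp; congr flatten.
apply: eq_map => j /=; rewrite dI_m -?map_comp; last by case: j => ? h; exact: leq_ltn_trans h.
by apply: eq_map => i /=; rewrite ptg_dI inE.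
Qed.

Lemma union_raw V s : unionV d (rawV V) (enum_rank s) = rawV (V :|: [set g | s \in Tg g]).
Proof.
rewrite /unionV tau_raw dI_G -cardG iota_rank -map_comp; apply: eq_map => g /=.
by rewrite !nth_rawV !inE.
Qed.

Lemma rawu_eq (u v : US) : (enum_rank u.1 == enum_rank v.1 :> nat) && eqV d (rawV u.2) (rawV v.2) = (u == v).
Proof. by rewrite rank_eq eqV_raw; case: u v => [a b] [a' b']. Qed.

Lemma sameks_raw (v w : svar) : sameks (rawv v) (rawv w) = (v.1 == w.1).
Proof. by rewrite /sameks /= rank_eq; case: v w => [[k s] u] [[k' s'] u'] /=. Qed.

Lemma eqv_raw (v w : svar) : eqv d (rawv v) (rawv w) = (v == w).
Proof.
rewrite /eqv sameks_raw /= rawu_eq.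
by case: v w => [k u] [k' u'].
Qed.

Lemma vinit_raw (v : svar) : vinit d (rawv v) = (v.2 == uinit Tg v.1.2).
Proof.
rewrite /vinit /= tau_raw eq_sym -/(uinit Tg v.1.2) [RHS]eq_sym -rawu_eq /=.
by rewrite [(enum_rank v.1.2 == _ :> nat)]eq_sym.
Qed.

Let D : R := (d_D d)%:R.

Lemma b2zE (b : bool) : (b2z b)%:~R = b%:R :> R. Proof. by case: b. Qed.

Lemma kapz_raw (u v : US) a : (kapz d (rawu u) (enum_rank a) (rawu v))%:~R = D * kap R Tg u a v.
Proof.
rewrite /kapz big_map /d dI_S sum_rank rmorph_sum /kap mulr_sumr; apply: eq_bigr => s' _.
rewrite rmorphM rmorphD rmorphN /= trzE -/d !b2zE -/D mulrA; congr (_ * (_ - _)).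
  by rewrite rawu_eq.
by rewrite union_raw -(rawu_eq (unext Tg u s') v).
Qed.

Lemma enz_raw (s : state M) (a : act M) : (enz d (enum_rank s) (enum_rank a))%:~R = D * enR R s a.
Proof.
rewrite /enz big_map /d dI_S sum_rank rmorph_sum /enR mulr_sumr; apply: eq_bigr => s' _.
by rewrite /= trzE.
Qed.

Variable b : seq bool.

Definition sgR (j : 'I_l) (r : bool) : R :=
  match crr_cmp j with
  | CmpApprox _ => if r then -1 else 1
  | CmpNApprox _ => if nth false b j then 1 else -1
  | _ => 1
  end.

Definition kpR (j : 'I_l) : R :=
  match crr_cmp j with
  | CmpApprox e => ratr e
  | CmpNApprox e => - ratr e
  | _ => 0
  end.

Lemma sg_raw (j : 'I_l) (r : bool) : (sg d b j r)%:~R = sgR j r.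
Proof.
rewrite /sg /sgR op_dI; case: (crr_cmp j) => [||e|e] //=.
  by case: r; rewrite //= ?rmorphN.
by case: ifP => _; rewrite //= ?rmorphN.
Qed.

Lemma kp_raw (j : 'I_l) : (kpz d j)%:~R = D * kpR j.
Proof.
rewrite /kpz op_dI; have := epszE R j; rewrite -/d -/D /kpR.
by case: (crr_cmp j) => [||e|e] /= E; rewrite ?rmorphN /= E ?mulrN ?rmorph0.
Qed.

Definition RC (r : srow) (c : scol) : R :=
  match r, c with
  | inl (inl v), inl (inl (w, a)) => (w.1 == v.1)%:R * kap R Tg w.2 a v.2
  | inl (inl v), inr (inl (inl w)) => (w == v)%:R
  | inl (inl v), inr (inr (inl _)) => - (v.2 == uinit Tg v.1.2)%:R
  | inl (inr v), inl (inr (w, a)) => (w.1 == v.1)%:R * kap R Tg w.2 a v.2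
  | inr (inl v), inl (inr (w, a)) => - ((w == v)%:R * enR R w.2.1 a)
  | inr (inl v), inr (inl (inl w)) => (w == v)%:R
  | inr (inl v), inr (inl (inr w)) => (w == v)%:R
  | inr (inr (j, r)), inr (inl (inl w)) => sgR j r * \sum_(i < m) ratr (crr_coef i j) *
      ((w.1 == (crr_sched i j, crr_state i j)) && ((j, i) \in w.2.2))%:R
  | inr (inr (j, r)), inr (inr (inl _)) => - (sgR j r * ratr (crr_bound j)) + kpR j
  | inr (inr jr), inr (inr (inr jr')) => - (jr' == jr)%:R
  | _, _ => 0
  end.

Lemma Dz_raw (x : bool) : (Dz d x)%:~R = D * x%:R.
Proof. by rewrite /Dz; case: x; rewrite ?mulr1 ?mulr0. Qed.

(** All entries are cleared of denominators by the same factor [D], so the two matrices have the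
    same kernel. *)
Lemma coefm_raw r c : (coefm d b (rawr r) (rawc c))%:~R = D * RC r c.
Proof.
case: r => [[v|v]|[v|[j r]]]; case: c => [[[w a]|[w a]]|[[w|w]|[[]|[j' r']]]];
  rewrite /coefm [(rawr _).1.1]/= [(rawc _).1.1]/= ?mulr0 //=.
- by rewrite sameks_raw; case: eqP => _; rewrite ?mul0r ?mulr0 ?mul1r// kapz_raw.
- by rewrite Dz_raw eqv_raw.
- by rewrite rmorphN /= Dz_raw vinit_raw mulrN.
- by rewrite sameks_raw; case: eqP => _; rewrite ?mul0r ?mulr0 ?mul1r// kapz_raw.
- by rewrite eqv_raw; case: eqP => _; rewrite ?mul0r ?oppr0 ?mulr0 ?mul1r// rmorphN /= enz_raw mulrN.
- by rewrite Dz_raw eqv_raw.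
- by rewrite Dz_raw eqv_raw.
- rewrite /predy rmorphM /= sg_raw mulrCA; congr (_ * _).
  have l0 : (0 < l)%N by case: j => ? h; exact: leq_ltn_trans h.
  rewrite big_map (dI_m l0) sum_ord rmorph_sum mulr_sumr; apply: eq_bigr => i _.
  rewrite rmorphM /= coefzE b2zE -mulrA -/d -/D; congr (_ * (_ * _%:R)).
  rewrite psch_dI pst_dI size_map size_enum_ord rank_eq -nth_rawV.
  have -> : enum_rank ((j, i) : G) = (j * m + i)%N :> nat.
    by rewrite enum_rank_prod !enum_rank_ord /= card_ord.
  by rewrite andbA; congr (_ && _).
- by rewrite /predt rmorphD rmorphN rmorphM /= sg_raw bndzE -/d kp_raw -/D mulrCA -mulrN -mulrDr.
- rewrite rmorphN /= Dz_raw mulrN; congr (- (_ * _%:R)).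
  have -> : ((j', r') == (j, r)) = (j' == j) && (r' == r) by [].
  by case: r r' => -[].
Qed.

Definition sstrict (c : scol) : bool :=
  match c with
  | inr (inr (inl _)) => true
  | inr (inr (inr (j, _))) => match crr_cmp j with CmpGt | CmpNApprox _ => true | _ => false end
  | _ => false
  end.

Lemma strict_raw c : strict d (rawc c) = sstrict c.
Proof.
case: c => [[[w a]|[w a]]|[[w|w]|[[]|[j' r']]]] //; rewrite /strict /= op_dI.
by case: (crr_cmp j').
Qed.

Lemma dV_E : d_V d = bseqs (iota 0 (l * m)).
Proof. by rewrite -(dI_G I). Qed.

Definition sVs : seq {set G} := [seq setV v | v <- d_V d].

Lemma dV_raw : d_V d = [seq rawV V | V <- sVs].
Proof.
rewrite /sVs -map_comp -[LHS]map_id; apply/eq_in_map => v /=.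
rewrite dV_E mem_bseqs size_iota => /eqP sv.
by rewrite setVK.
Qed.

Lemma sum_sVs (V : nmodType) (h : {set G} -> V) : \sum_(W <- sVs) h W = \sum_W h W.
Proof.
rewrite -big_enum; apply: perm_big; apply: uniq_perm; rewrite ?enum_uniq//.
  rewrite map_inj_in_uniq ?dV_E ?bseqs_uniq// => v w.
  rewrite !mem_bseqs size_iota => /eqP sv /eqP sw e.
  by rewrite -(setVK sv) -(setVK sw) e.
move=> W; transitivity true; last by rewrite mem_enum.
apply/mapP; exists (rawV W); last by rewrite rawVK.
by rewrite dV_E mem_bseqs size_iota size_rawV.
Qed.

Definition svs : seq svar :=
  flatten [seq flatten [seq flatten [seq [seq (k, s0, (s, V)) | V <- sVs]
    | s <- enum (state M)] | s0 <- enum (state M)] | k <- enum 'I_n].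

Lemma vlabs_raw : vlabs d = [seq rawv v | v <- svs].
Proof.
rewrite /vlabs /svs /d dI_n dI_S -/d dV_raw map_flatten -!map_comp; congr flatten.
apply: eq_map => k /=; rewrite map_flatten -!map_comp; congr flatten.
apply: eq_map => s0 /=; rewrite map_flatten -!map_comp; congr flatten.
by apply: eq_map => s /=; rewrite -!map_comp.
Qed.

Lemma sum_svs (V : nmodType) (h : svar -> V) : \sum_(v <- svs) h v = \sum_v h v.
Proof.
rewrite /svs big_flatten big_map big_enum /=.
rewrite (eq_bigr (fun k => \sum_s0 \sum_s \sum_W h (k, s0, (s, W)))); last first.
  move=> k _; rewrite big_flatten big_map big_enum /=; apply: eq_bigr => s0 _.
  rewrite big_flatten big_map big_enum /=; apply: eq_bigr => s _.
  by rewrite big_map sum_sVs.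
rewrite [RHS]sum_pair [RHS]sum_pair; apply: eq_bigr => k _; apply: eq_bigr => s0 _.
by rewrite [RHS]sum_pair.
Qed.

Definition sva : seq (svar * act M) := flatten [seq [seq (v, a) | a <- enum (act M)] | v <- svs].
Definition sjr : seq ('I_l * bool) := flatten [seq [seq (j, r) | r <- [:: false; true]] | j <- enum 'I_l].

Lemma valabs_raw g (f : svar * act M -> scol) :
  (forall v a, rawc (f (v, a)) = (g, rawv v, enum_rank a : nat)) ->
  valabs d g = [seq rawc (f q) | q <- sva].
Proof.
move=> H; rewrite /valabs /sva vlabs_raw map_flatten -!map_comp; congr flatten.
by apply: eq_map => v /=; rewrite /d dI_A -!map_comp; apply: eq_map => a /=; rewrite H.
Qed.

Lemma sum_sva (V : nmodType) (h : svar * act M -> V) : \sum_(v <- sva) h v = \sum_v h v.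
Proof.
rewrite /sva big_flatten big_map sum_svs [RHS]sum_pair.
by apply: eq_bigr => v _; rewrite big_map big_enum.
Qed.

Lemma jlabs_raw g : jlabs d g = [seq (g, rawj q.1, nat_of_bool q.2) | q : 'I_l * bool <- sjr].
Proof. by rewrite /jlabs /sjr /d dI_l map_flatten -!map_comp. Qed.

Lemma sum_sjr (V : nmodType) (h : 'I_l * bool -> V) : \sum_(v <- sjr) h v = \sum_v h v.
Proof.
rewrite /sjr big_flatten big_map big_enum [RHS]sum_pair.
by apply: eq_bigr => j _; rewrite /= !big_cons big_nil /= addr0 [RHS]big_bool addrC.
Qed.

Definition scols : seq scol :=
  [seq inl (inl q) | q <- sva] ++ ([seq inl (inr q) | q <- sva] ++
  ([seq inr (inl (inl v)) | v <- svs] ++ ([seq inr (inl (inr v)) | v <- svs] ++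
  (inr (inr (inl tt)) :: [seq inr (inr (inr q)) | q <- sjr])))).

Definition srows : seq srow :=
  [seq inl (inl v) | v <- svs] ++ ([seq inl (inr v) | v <- svs] ++
  ([seq inr (inl v) | v <- svs] ++ [seq inr (inr q) | q <- sjr])).

Lemma cols_raw : cols d = [seq rawc c | c <- scols].
Proof.
rewrite /cols (@valabs_raw _ (fun q => inl (inl q)))// (@valabs_raw _ (fun q => inl (inr q)))//.
rewrite /vzlabs vlabs_raw jlabs_raw /scols !map_cat /= -!map_comp.
by do 4 congr (_ ++ _); congr (_ :: _); apply: eq_map => -[j r].
Qed.

Lemma rows_raw : rows d = [seq rawr c | c <- srows].
Proof.
rewrite /rows /vzlabs vlabs_raw jlabs_raw /srows !map_cat -!map_comp.
by do 3 congr (_ ++ _); apply: eq_map => -[j r].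
Qed.

Lemma sum_scols (V : nmodType) (h : scol -> V) : \sum_(c <- scols) h c = \sum_c h c.
Proof.
rewrite /scols !big_cat big_cons !big_map /= !sum_sva !sum_svs sum_sjr.
have -> : h (inr (inr (inl tt))) = \sum_(i : unit) h (inr (inr (inl i))).
  by rewrite (bigD1 tt)//= big1 ?addr0// => -[].
by rewrite !big_sumType /= -!addrA.
Qed.

Lemma mem_srows r : r \in srows.
Proof.
have ms v : v \in svs.
  apply/negPn/negP => nc; have := sum_svs (fun c' => nat_of_bool (c' == v)).
  rewrite big_seq big1 => [|c' c's]; last by case: eqP nc c's => // -> /negbTE ->.
  by rewrite (bigD1 v)//= eqxx.
have mj v : v \in sjr.
  apply/negPn/negP => nc; have := sum_sjr (fun c' => nat_of_bool (c' == v)).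
  rewrite big_seq big1 => [|c' c's]; last by case: eqP nc c's => // -> /negbTE ->.
  by rewrite (bigD1 v)//= eqxx.
by case: r => [[v|v]|[v|q]]; rewrite /srows !mem_cat; apply/orP;
  do ?[by left; exact: map_f | by exact: map_f | right; apply/orP | right; exact: map_f].
Qed.

Lemma kerpos_raw : kerpos (iota 0 (size (Jl d))) (mat d b) (Jl d) <->
  exists x : scol -> R, [/\ forall c, 0 <= x c, forall r, \sum_c RC r c * x c = 0 &
    forall c, sstrict c -> 0 < x c].
Proof.
have -> : Jl d = [seq sstrict c | c <- scols].
  by rewrite /Jl cols_raw -map_comp; apply: eq_map => c /=; rewrite strict_raw.
have -> : mat d b = [seq [seq coefm d b (rawr r) (rawc c) | c <- scols] | r <- srows].
  rewrite /mat cols_raw rows_raw -map_comp; apply: eq_map => r /=.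
  by rewrite -map_comp.
have D0 : D != 0 by rewrite pnatr_eq0 -lt0n den_gt0.
rewrite size_map; apply: iff_trans (@kerpos_finType R _ _ _ _ _ _ (@sum_scols _) mem_srows) _.
have E r (x : scol -> R) : \sum_c (coefm d b (rawr r) (rawc c))%:~R * x c = D * \sum_c RC r c * x c.
  by rewrite mulr_sumr; apply: eq_bigr => c _; rewrite coefm_raw mulrA.
split=> -[x [x0 xA xJ]]; exists x; split=> // r; last by rewrite E xA mulr0.
by have := xA r; rewrite E => /eqP; rewrite mulf_eq0 (negbTE D0) => /eqP.
Qed.

End semantic_matrix.

(** * Solutions of the system and schedulers *)

Lemma sum_delta_pair (R : realType) (P U A : finType) (p : P) (F : P * U * A -> R) :
  \sum_q (q.1.1 == p)%:R * F q = \sum_u \sum_a F (p, u, a).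
Proof.
rewrite sum_pair sum_pair -(sum_delta (fun p => \sum_u \sum_a F (p, u, a)) p).
apply: eq_bigr => p' _; rewrite mulr_sumr; apply: eq_bigr => u _.
by rewrite mulr_sumr.
Qed.

Section lp_reach.
Variables (R : realType) (I : conj_rel_reach).
Let M := crr_mdp I.
Let l := crr_l I.
Let m := crr_m I.
Let n := crr_n I.
Let G : finType := ('I_l * 'I_m)%type.
Let Tg (g : G) : {set state M} := crr_target g.2 g.1.
Let US : finType := ustate M G.
Let P : finType := ('I_n * state M)%type.

Section rows.
Variables (b : seq bool) (x : scol I -> R).
Let X (p : P) (u : US) (a : act M) : R := x (inl (inl (p, u, a))).
Let C (p : P) (u : US) (a : act M) : R := x (inl (inr (p, u, a))).
Let Y (p : P) (u : US) : R := x (inr (inl (inl (p, u)))).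
Let Z (p : P) (u : US) : R := x (inr (inl (inr (p, u)))).
Let t : R := x (inr (inr (inl tt))).
Let W (j : 'I_l) (r : bool) : R := x (inr (inr (inr (j, r)))).

Let z1 (K : finType) (f : K -> R) : \sum_k 0 * f k = 0.
Proof. by rewrite big1// => k _; rewrite mul0r. Qed.

Let sum_unit (f : unit -> R) : \sum_i f i = f tt.
Proof. by rewrite (bigD1 tt)//= big1 ?addr0// => -[]. Qed.

Lemma row_flow (p : P) (u : US) : \sum_c RC R b (inl (inl (p, u))) c * x c =
  \sum_w \sum_a X p w a * kap R Tg w a u + Y p u - (u == uinit Tg p.2)%:R * t.
Proof.
rewrite !big_sumType /= !z1 !addr0 sum_unit mulNr -/t addrA; congr (_ + _ - _).
  rewrite (eq_bigr (fun q : svar I * act M => (q.1.1 == p)%:R * (x (inl (inl q)) * kap R Tg q.1.2 q.2 u))).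
    by rewrite sum_delta_pair.
  by move=> [w a] _ /=; rewrite -mulrA [kap _ _ _ _ _ * _]mulrC.
by rewrite sum_delta.
Qed.

Lemma row_circ (p : P) (u : US) : \sum_c RC R b (inl (inr (p, u))) c * x c =
  \sum_w \sum_a C p w a * kap R Tg w a u.
Proof.
rewrite !big_sumType /= !z1 !addr0 add0r.
rewrite (eq_bigr (fun q : svar I * act M => (q.1.1 == p)%:R * (x (inl (inr q)) * kap R Tg q.1.2 q.2 u))).
  by rewrite sum_delta_pair.
by move=> [w a] _ /=; rewrite -mulrA [kap _ _ _ _ _ * _]mulrC.
Qed.

Lemma row_slack (p : P) (u : US) : \sum_c RC R b (inr (inl (p, u))) c * x c =
  Y p u + Z p u - \sum_a C p u a * enR R u.1 a.
Proof.
rewrite !big_sumType /= !z1 !addr0 add0r !sum_delta addrC; congr (_ + _).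
rewrite sum_pair -(sum_delta (fun v : svar I => \sum_a x (inl (inr (v, a))) * enR R v.2.1 a) (p, u)) -sumrN.
apply: eq_bigr => v _; rewrite -mulrN -sumrN mulr_sumr; apply: eq_bigr => a _ /=.
by rewrite mulNr mulrN -mulrA [enR _ _ _ * _]mulrC.
Qed.

Lemma row_pred (j : 'I_l) (r : bool) : \sum_c RC R b (inr (inr (j, r))) c * x c =
  sgR R b j r * (\sum_(i < m) ratr (crr_coef i j) *
    \sum_(u : US) ((j, i) \in u.2)%:R * Y (crr_sched i j, crr_state i j) u)
  + (- (sgR R b j r * ratr (crr_bound j)) + kpR R j) * t - W j r.
Proof.
rewrite !big_sumType /= !z1 !addr0 !add0r sum_unit -/t addrA; congr (_ + _ + _).
  rewrite (eq_bigr (fun v : svar I => sgR R b j r * ((\sum_(i < m) ratr (crr_coef i j) *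
      ((v.1 == (crr_sched i j, crr_state i j)) && ((j, i) \in v.2.2))%:R) * x (inr (inl (inl v)))))); last first.
    by move=> v _; rewrite mulrA.
  rewrite -mulr_sumr; congr (_ * _).
  rewrite (eq_bigr (fun v : svar I => \sum_(i < m) ratr (crr_coef i j) *
      (((v.1 == (crr_sched i j, crr_state i j)) && ((j, i) \in v.2.2))%:R * x (inr (inl (inl v)))))); last first.
    by move=> v _; rewrite mulr_suml; apply: eq_bigr => i _; rewrite mulrA.
  rewrite exchange_big /=; apply: eq_bigr => i _; rewrite -mulr_sumr; congr (_ * _).
  rewrite sum_pair -(sum_delta (fun p => \sum_(u : US) ((j, i) \in u.2)%:R * Y p u) (crr_sched i j, crr_state i j)).
  apply: eq_bigr => p _; rewrite mulr_sumr; apply: eq_bigr => u _ /=.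
  by rewrite mulrA; congr (_ * _); case: (p == _); rewrite ?mul1r ?mul0r.
rewrite -(sum_delta (fun q : 'I_l * bool => - x (inr (inr (inr q)))) (j, r)).
by apply: eq_bigr => q _; rewrite mulNr mulrN.
Qed.

End rows.

Let lp (b : seq bool) := exists x : scol I -> R, [/\ forall c, 0 <= x c,
  forall r, \sum_c RC R b r c * x c = 0 & forall c, sstrict c -> 0 < x c].

Lemma lp_normal b : lp b -> exists x : scol I -> R, [/\ forall c, 0 <= x c,
  forall r, \sum_c RC R b r c * x c = 0, forall c, sstrict c -> 0 < x c &
  x (inr (inr (inl tt))) = 1].
Proof.
move=> [x [x0 xA xJ]]; set t := x (inr (inr (inl tt))).
have t0 : 0 < t by apply: xJ.
exists (fun c => x c / t); split=> [c|r|c Jc|].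
- by rewrite divr_ge0// ltW.
- rewrite (eq_bigr (fun c => RC R b r c * x c / t)) => [|c _]; last by rewrite mulrA.
  by rewrite -mulr_suml xA mul0r.
- by rewrite divr_gt0// xJ.
- by rewrite divff// gt_eqF.
Qed.

(** The value that row [(j, r)] forces on its slack when the sum is [v] and the homogenizing
    variable is 1. *)
Definition wval b (j : 'I_l) (v : R) (r : bool) : R :=
  sgR R b j r * v + (- (sgR R b j r * ratr (crr_bound j)) + kpR R j).

Lemma cmp_wval b (j : 'I_l) v : (forall r, 0 <= wval b j v r) ->
  (forall r, sstrict (inr (inr (inr (j, r))) : scol I) -> 0 < wval b j v r) ->
  cmp_holds (crr_cmp j) v (ratr (crr_bound j)).
Proof.
rewrite /wval /sgR /kpR /sstrict; case: (crr_cmp j) => [||e|e] /= h0 h1.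
- have := h1 true isT; move: (ratr (crr_bound j)) {h0 h1} => q a1.
  by have : q < v by lra.
- have := h0 true; move: (ratr (crr_bound j)) {h0 h1} => q a1.
  by have : q <= v by lra.
- rewrite ler_norml; have := h0 true; have := h0 false => /=.
  by set q := ratr (crr_bound j); set f := ratr e => a1 a2; apply/andP; split; lra.
- rewrite lter_normr; have := h1 true isT.
  move: (ratr (crr_bound j)) (ratr e) {h0 h1} => q f; case: ifP => _ a1; apply/orP.
    by left; have : f < v - q by lra.
  by right; have : f < - (v - q) by lra.
Qed.

(** Here [b] records the side of the bound on which [v] lies, while [cmp_wval] accepts every [b]: a
    wrong guess may reject a [v] but never accepts a false predicate. *)
Lemma wval_cmp b (j : 'I_l) v : cmp_holds (crr_cmp j) v (ratr (crr_bound j)) ->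
  nth false b j = (ratr (crr_bound j) < v) ->
  (forall r, 0 <= wval b j v r) /\
  (forall r, sstrict (inr (inr (inr (j, r))) : scol I) -> 0 < wval b j v r).
Proof.
have e0 := crr_eps_ge0 j; rewrite /wval /sgR /kpR /sstrict.
case: (crr_cmp j) e0 => [||e|e] /= e0 H bE.
- by split=> [r|r _]; lra.
- by split=> // r; lra.
- split=> // r; move: H; rewrite ler_norml => /andP[].
  by set q := ratr (crr_bound j); set f := ratr e; case: r; lra.
- have f0 : 0 <= ratr e :> R by rewrite ler0q.
  have H' : 0 < (if nth false b j then 1 else -1) * v +
      (- ((if nth false b j then 1 else -1) * ratr (crr_bound j)) - ratr e).
    rewrite bE; move: H f0; set q := ratr (crr_bound j); set f := ratr e.
    rewrite lter_normr; case: (ltP q v) => lt /orP[] h f0; lra.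
  by split=> [r|r _]; rewrite ?ltW.
Qed.

Lemma lp_sound b : lp b -> crr_holds R I.
Proof.
move=> /lp_normal[x [x0 xA xJ xt]].
have fl (k : 'I_n) (s : state M) : flow_sol Tg s (fun u a => x (inl (inl ((k, s), u, a))))
    (fun u a => x (inl (inr ((k, s), u, a)))) (fun u => x (inr (inl (inl ((k, s), u))))).
  split; last split.
  - split=> // u; have := row_slack b x (k, s) u; rewrite xA => e.
    have := x0 (inr (inl (inr ((k, s), u)))); move: e; set S := \sum_a _; lra.
  - move=> v; have := row_flow b x (k, s) v; rewrite xA xt mulr1 => e.
    by apply/eqP; rewrite -subr_eq0 -e.
  - by move=> v; have := row_circ b x (k, s) v; rewrite xA.
have /choice[sigma hs] (k : 'I_n) := flow_exists_scheduler (fl k).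
exists sigma => j.
set v := \sum_(i < _) _.
have wE r : wval b j v r = x (inr (inr (inr (j, r)))).
  have := row_pred b x j r; rewrite xA xt mulr1 => e; apply/eqP; rewrite -subr_eq0 [X in _ == X]e.
  rewrite /wval; apply/eqP; congr (_ * _ + _ - _).
  by apply: eq_bigr => i _; rewrite (hs (crr_sched i j) (crr_state i j) (j, i)).
by apply: (@cmp_wval b) => r; rewrite wE//; exact: xJ.
Qed.

Lemma lp_complete : crr_holds R I -> exists2 b, size b = l & lp b.
Proof.
move=> [sigma H].
pose v (j : 'I_l) := \sum_(i < m) ratr (crr_coef i j) *
         reach_prob (sigma (crr_sched i j)) (crr_state i j) (crr_target i j).
pose b := [seq ratr (crr_bound j) < v j | j <- enum 'I_l].
have bE (j : 'I_l) : nth false b j = (ratr (crr_bound j) < v j).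
  by rewrite (nth_map j) ?size_enum_ord// nth_ord_enum.
have /choice[q hq] (p : P) : exists q : (US -> act M -> R) * (US -> act M -> R) * (US -> R),
    flow_sol Tg p.2 q.1.1 q.1.2 q.2 /\ forall g, reach_prob (sigma p.1) p.2 (Tg g) =
      \sum_(u : US) (g \in u.2)%:R * q.2 u.
  by have [x [c [y h]]] := sched_flow Tg (sigma p.1) p.2; exists (x, c, y).
exists b; first by rewrite size_map size_enum_ord.
pose x (c : scol I) : R := match c with
  | inl (inl (p, u, a)) => (q p).1.1 u a
  | inl (inr (p, u, a)) => (q p).1.2 u a
  | inr (inl (inl (p, u))) => (q p).2 u
  | inr (inl (inr (p, u))) => \sum_a (q p).1.2 u a * enR R u.1 a - (q p).2 u
  | inr (inr (inl _)) => 1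
  | inr (inr (inr (j, r))) => wval b j (v j) r
  end.
exists x; split.
- case=> [[[[p u] a]|[[p u] a]]|[[[p u]|[p u]]|[[]|[j r]]]] /=.
  + by have [[[]]] := hq p.
  + by have [[[]]] := hq p.
  + by have [[[]]] := hq p.
  + by rewrite subr_ge0; have [[[_ _ _ h] _] _] := hq p; exact: h.
  + exact: ler01.
  + by have [] := wval_cmp (H j) (bE j).
- case=> [[[p u]|[p u]]|[[p u]|[j r]]].
  + rewrite row_flow /= mulr1; have [[_ [e _]] _] := hq p.
    by apply/eqP; rewrite subr_eq0 -(e u).
  + by rewrite row_circ /=; have [[_ [_ e]] _] := hq p; exact: e.
  + by rewrite row_slack /= addrCA subrr addr0 subrr.
  + rewrite row_pred /= mulr1 /wval; apply/eqP; rewrite subr_eq0; apply/eqP; congr (_ * _ + _).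
    apply: eq_bigr => i _; congr (_ * _).
    by have [_ /(_ (j, i)) e] := hq (crr_sched i j, crr_state i j); rewrite -[RHS]/(reach_prob _ _ (Tg (j, i))) e.
- case=> [[[[p u] a]|[[p u] a]]|[[[p u]|[p u]]|[[]|[j r]]]] //=.
  by have [_] := wval_cmp (H j) (bE j); exact.
Qed.

Lemma decideP : decide (dI I) <-> crr_holds R I.
Proof.
have BE : d_B (dI I) = bseqs (iota 0 l).
  by have := dI_l I; rewrite -iota_ord => <-.
split.
  move=> /hasP[b _ /(kerpos_raw R)]; exact: lp_sound.
move=> /lp_complete[b sb]; rewrite /lp => /(kerpos_raw R) H; apply/hasP; exists b => //.
by rewrite BE mem_bseqs size_iota sb.
Qed.

End lp_reach.

(** * The decision procedure *)

Local Open Scope nat_scope.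

(** An instance is represented by its input word, so that [PT] can speak of instances and measure
    them by [crr_mu]. *)
Canonical crr_encType := EncType (fun I : conj_rel_reach => enc (enc_crr I : seq (option bool))).

Definition crr_mu (I : conj_rel_reach) : nat :=
  size (enc_crr I) + 2 ^ (crr_l I * crr_m I) + 2 ^ crr_l I.

Lemma esz_word (w : seq (option bool)) : esz w <= 1 + size w * 7.
Proof.
apply: (@esz_seq_le _ w 6) => x0 i _; move: (nth x0 w i) => [[]|] //.
Qed.

Lemma PT_decide_crr : PT crr_mu (fun I => decide (dI I)).
Proof.
have adq : pb crr_mu esz.
  apply: (@pb_le _ _ _ (fun I => 1 + crr_mu I * 7)); last by pb.
  move=> I; apply: leq_trans (esz_word (enc_crr I)) _.
  by rewrite /crr_mu leq_add2l leq_mul2r /=; lia.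
have Hw : PT crr_mu (fun I => enc_crr I : seq (option bool)).
  exact: (PT_recode (f := fun I : conj_rel_reach => I)) (PT_id adq).
have Ht : PT crr_mu (fun I => toks I).
  by apply: PT_ext (PT_decode Hw) => I; rewrite enc_crr_etok decode_etok.
apply: PT_decide; apply: PT_dataof => //.
  apply: (@pb_le _ _ _ crr_mu); last exact: pb_mu.
  by move=> I; have := dI_G I; rewrite /d_G /= => ->; rewrite size_iota /crr_mu; lia.
apply: (@pb_le _ _ _ crr_mu); last exact: pb_mu.
by move=> I; have := dI_l I; rewrite /d_l /= => ->; rewrite size_map size_enum_ord /crr_mu; lia.
Qed.

Lemma size_flatten_enum (K : finType) (U : Type) (f : K -> seq U) :
  size (flatten [seq f x | x <- enum K]) = \sum_x size (f x).
Proof. by rewrite size_flatten /shape -map_comp sumnE big_map big_enum. Qed.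

Lemma size_enc_nat n : size (enc_nat n) = (blen n).+1.
Proof. by rewrite size_rcons size_map. Qed.

Lemma size_etok ts : size ts <= size (etok ts).
Proof.
elim: ts => // n ts IHts; rewrite /etok /= size_cat -/(etok ts) size_enc_nat.
by rewrite addSn ltnS (leq_trans IHts)// leq_addl.
Qed.

Lemma card_state_mdp_size M : #|state M| <= mdp_size M.
Proof.
rewrite /mdp_size enc_mdp_etok; apply: leq_trans (size_etok _).
rewrite size_cat size_ttoks /=.
by apply: leq_trans (leq_addl _ _); rewrite -!mulnA leq_pmulr// !muln_gt0 act_gt0 state_gt0.
Qed.

Lemma size_enc_crr (I : conj_rel_reach) : size (enc_crr I) <=
  crr_l I + crr_m I + crr_n I + 3 + mdp_size (crr_mdp I) + const_size I + 3 * crr_l I +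
  crr_l I * crr_m I * (3 * mdp_size (crr_mdp I) + crr_n I + 2).
Proof.
set S := mdp_size _; set n := crr_n I.
have hS := card_state_mdp_size (crr_mdp I); rewrite -/S in hS.
have hc c : size (enc_cmp c) <= 3 + size (enc_rat (cmp_eps c)).
  by case: c => [||e|e] /=; rewrite ?size_cat ?size_enc_nat.
have hj (j : 'I_(crr_l I)) : size (enc_cmp (crr_cmp j) ++ enc_rat (crr_bound j) ++
     flatten [seq enc_rat (crr_coef i j) ++ enc_fin (crr_state i j) ++
                enc_fin (crr_sched i j) ++ enc_set (crr_target i j)
             | i <- enum 'I_(crr_m I)]) <=
   (size (enc_rat (crr_bound j)) + size (enc_rat (cmp_eps (crr_cmp j))) +
     \sum_(i < crr_m I) size (enc_rat (crr_coef i j))) + (3 + crr_m I * (3 * S + n + 2)).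
  rewrite size_cat size_cat size_flatten_enum; have := hc (crr_cmp j).
  have : \sum_(i < crr_m I) size (enc_rat (crr_coef i j) ++ enc_fin (crr_state i j) ++
                enc_fin (crr_sched i j) ++ enc_set (crr_target i j)) <=
      \sum_(i < crr_m I) size (enc_rat (crr_coef i j)) + crr_m I * (3 * S + n + 2).
    rewrite -[X in _ + X * _]card_ord -sum_nat_const -big_split /=; apply: leq_sum => i _.
    rewrite !size_cat leq_add2l /enc_fin !size_enc_nat /enc_set size_flatten_enum.
    have h1 : blen (enum_rank (crr_state i j)) <= S.
      by apply: leq_trans (blenn _) _; apply: leq_trans hS; exact: ltnW.
    have h2 : blen (enum_rank (crr_sched i j)) <= n.
      by apply: leq_trans (blenn _) _; rewrite enum_rank_ord; exact: ltnW (ltn_ord (crr_sched i j)).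
    have h3 : \sum_x size (enc_nat (x \in crr_target i j)) <= 2 * S.
      apply: (@leq_trans (\sum_(x : state (crr_mdp I)) 2)).
        by apply: leq_sum => x _; rewrite size_enc_nat; case: (x \in _).
      by rewrite sum_nat_const mulnC leq_mul2l.
    by move: (\sum_x _) h1 h2 h3 => *; lia.
  by move: (\sum_(i < _) size (_ ++ _)) (\sum_(i < _) size (enc_rat _)) (size (enc_cmp _))
    (size (enc_rat (crr_bound j))) (size (enc_rat (cmp_eps _))) (crr_m I * _) => *; lia.
have hJ : \sum_(j < crr_l I) size (enc_cmp (crr_cmp j) ++ enc_rat (crr_bound j) ++
     flatten [seq enc_rat (crr_coef i j) ++ enc_fin (crr_state i j) ++
                enc_fin (crr_sched i j) ++ enc_set (crr_target i j)
             | i <- enum 'I_(crr_m I)]) <= const_size I + crr_l I * (3 + crr_m I * (3 * S + n + 2)).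
  rewrite -[X in _ + X * _]card_ord -sum_nat_const -big_split /=.
  by apply: leq_sum => j _; exact: hj.
have -> : size (enc_crr I) = (blen (crr_l I)).+1 + ((blen (crr_m I)).+1 + ((blen n).+1 + (S +
    \sum_(j < crr_l I) size (enc_cmp (crr_cmp j) ++ enc_rat (crr_bound j) ++
     flatten [seq enc_rat (crr_coef i j) ++ enc_fin (crr_state i j) ++
                enc_fin (crr_sched i j) ++ enc_set (crr_target i j)
             | i <- enum 'I_(crr_m I)])))).
  rewrite /enc_crr size_cat size_enc_nat; congr (_ + _).
  rewrite size_cat size_enc_nat; congr (_ + _).
  rewrite size_cat size_enc_nat; congr (_ + _).
  by rewrite size_cat size_flatten_enum.
move: hJ; move: (\sum_(j < _) _) => Q.
have := blenn (crr_l I); have := blenn (crr_m I); have := blenn n.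
rewrite -mulnA mulnDr; move: (crr_m I * _) (blen _) (blen _) (blen _) => A b1 b2 b3.
move: (crr_l I * A) => B; lia.
Qed.

(** [X] dominates every parameter separately, [n] through [le_n]; the square pays for the product of
    [l * m] with the size of an operand. *)
Lemma crr_mu_le (I : conj_rel_reach) : 0 < crr_l I -> 0 < crr_m I ->
  let X := crr_l I * crr_m I * (mdp_size (crr_mdp I) + const_size I) * 2 ^ (crr_l I * crr_m I) in
  0 < X /\ crr_mu I <= 30 * (X * X).
Proof.
move=> l0 m0 X; set E := crr_l I * crr_m I.
have S0 : 0 < mdp_size (crr_mdp I) by apply: leq_trans (state_gt0 _) (card_state_mdp_size _).
have E0 : 0 < E by rewrite muln_gt0 l0.
have P0 : 0 < 2 ^ E by rewrite expn_gt0.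
have EX : E <= X by rewrite /X -mulnA leq_pmulr// muln_gt0 addn_gt0 S0.
have SX : mdp_size (crr_mdp I) + const_size I <= X.
  by rewrite /X mulnAC leq_pmull// muln_gt0 E0.
have PX : 2 ^ E <= X by rewrite /X leq_pmull// muln_gt0 E0 addn_gt0 S0.
have lE : crr_l I <= E by rewrite leq_pmulr.
have mE : crr_m I <= E by rewrite leq_pmull.
have nE : crr_n I <= E := le_n I.
have X0 : 0 < X by apply: leq_trans EX.
have l2 : 2 ^ crr_l I <= X by apply: leq_trans PX; rewrite leq_exp2l.
split=> //; rewrite /crr_mu; have := size_enc_crr I; rewrite -/E.
have hq : E * (3 * mdp_size (crr_mdp I) + crr_n I + 2) <= X * (4 * X + 2).
  by apply: leq_mul => //; lia.
have XX : X <= X * X by rewrite leq_pmulr.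
move: (size _) (E * _) hq (2 ^ E) PX P0 (2 ^ crr_l I) l2 => sz A hA p1 hp1 _ p2 hp2.
have e : X * (4 * X + 2) = 4 * (X * X) + 2 * X by rewrite mulnDr mulnCA [X * 2]mulnC.
rewrite {}e in hA; move: (X * X) XX hA => Y; lia.
Qed.

Lemma crr_decider (R : realType) : exists A : turing_machine, exists k : nat,
  forall I : conj_rel_reach, exists2 t,
    decides_within A (enc_crr I) (crr_holds R I) t & t <= pol k (crr_mu I).
Proof.
have [_ _ [p [t [ht Hp]]]] := PT_decide_crr.
have [k hk] : pb crr_mu (fun I => t I + 60 * (crr_mu I).+1) by pb.
exists (decider p), k => I; have [t' [le vd]] := decider_verdict (Hp I).
exists t'; last first.
  apply: leq_trans (hk I); apply: leq_trans le _; rewrite leq_add2l leq_mul2l /= ltnS /crr_mu.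
  by rewrite -addnA leq_addr.
exists (decide (dI I)); last exact: decideP.
by rewrite vd; case: (decide _).
Qed.

Lemma pol_crr_mu_le k (I : conj_rel_reach) : 0 < crr_l I -> 0 < crr_m I ->
  pol k (crr_mu I) <= 32 ^ k * (crr_l I * crr_m I * (mdp_size (crr_mdp I) + const_size I)
    * 2 ^ (crr_l I * crr_m I)) ^ (2 * k).
Proof.
move=> l0 m0; have [X0 le] := crr_mu_le l0 m0; set X := _ * 2 ^ _ in X0 le *.
rewrite expnM -mulnn -expnMn; case: k => // k; rewrite /pol leq_exp2r//.
have : 0 < X * X by rewrite muln_gt0 X0.
by move: (X * X) le => Y; lia.
Qed.

Local Open Scope ring_scope.

Theorem theorem7p19 (R : realType) :
  exists (A : turing_machine) (p : {poly nat}), forall I : conj_rel_reach,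
    exists2 t : nat, decides_within A (enc_crr I) (crr_holds R I) t &
      (0 < crr_l I)%N -> (0 < crr_m I)%N ->
      (t <= 2 ^ crr_lneq I *
            p.[(crr_l I * crr_m I * (mdp_size (crr_mdp I) + const_size I)
                 * 2 ^ (crr_l I * crr_m I))%N])%N.
Proof.
have [A [k H]] := crr_decider R.
(* The time is at most [(crr_mu + 2) ^ k], and [crr_mu + 2 <= 32 X^2] since [crr_mu <= 30 X^2] and
   [X > 0]. *)
exists A, ((32 ^ k)%N%:P * 'X^(2 * k)) => I; have [t dt lt] := H I.
exists t => // l0 m0; rewrite hornerCM hornerXn; apply: leq_trans lt _.
apply: leq_trans (pol_crr_mu_le k l0 m0) _.
by apply: leq_pmull; rewrite expn_gt0.
Qed.
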